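(* Let $L,K\ge1$ be integers and $\gamma>0$. Suppose we observe $N$ pairs $\{(y_t,X_t)\}_{t=1}^N$ satisfying $y_t=\langle X_t,M\rangle+\xi_t$, where the $X_t$ are i.i.d. uniformly sampled from $\mathcal{X}$ and the $\xi_t$ are i.i.d. $N(0,\sigma^2)$, independent of the $X_t$. Assume $M\in\mathcal{M}(L,\gamma,K)$ and $N\ge(n\wedge p)\log^2(n+p)$. Then there is a constant $C_2>0$ depending only on $\sigma$ and $\|M\|_\infty$ such that, with $\lambda=C_2\sqrt{\frac{\log(n+p)}{N(n\wedge p)}}$, the following holds. The upper bound $$C_2^2\left(\frac{1+\sqrt2}{2}\right)^2\frac{(n\vee p)\log(n+p)}{N}J^*(\epsilon)+\epsilon^2,$$ in which $J^*(\epsilon)$ is of order $\epsilon^{-K/L}$, is optimized (in order of magnitude) at $$\epsilon=\left(\frac{(n\vee p)\log(n+p)}{N}\right)^{\frac{L}{2L+K}},$$ resulting in $$\frac{1}{np}\|\widehat M-M\|_F^2=O_P\left(\left[\frac{(n\vee p)\log(n+p)}{N}\right]^{\frac{2L}{2L+K}}\right).$$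
   Context: $n,p,N$ are positive integers; $a\wedge b=\min(a,b)$, $a\vee b=\max(a,b)$. For matrices, $\langle A,B\rangle=\operatorname{tr}(A^TB)$, $\|A\|_F$ is the Frobenius norm, $\|A\|_\infty=\max_{i,j}|a_{ij}|$, and $\|A\|_*$ is the nuclear norm. $\mathcal{X}=\{e_n(i)e_p(j)^T: 1\le i\le n,\ 1\le j\le p\}$, where $e_n(i)$ is the $i$-th standard basis vector of $\mathbb{R}^n$; uniform sampling gives each element probability $1/(np)$. Estimator: $\widehat M$ is the minimizer over $A\in\mathbb{R}^{n\times p}$ of $\frac{1}{np}\|A\|_F^2-\left\langle\frac{2}{N}\sum_{t=1}^N y_tX_t,A\right\rangle+\lambda\|A\|_*$. $\mathcal{F}(L,\gamma,K)$ is the set of $L$-th order differentiable functions $f:[0,1]^K\to\mathbb{R}$ with $\left|\frac{\partial^L f}{\partial x_1^{L_1}\cdots\partial x_K^{L_K}}(\mathbf{x}^0)\right|\le\gamma$ for all $\mathbf{x}^0\in[0,1]^K$ and all nonnegative integers $L_1,\dots,L_K$ with $L_1+\cdots+L_K=L$. $\mathcal{M}(L,\gamma,K)$ is the set of $M\in\mathbb{R}^{n\times p}$ with $m_{ij}=f_j(\theta_{i,\cdot})$ for some $f_1,\dots,f_p\in\mathcal{F}(L,\gamma,K)$ and $\theta_{1,\cdot},\dots,\theta_{n,\cdot}\in[0,1]^K$. $J^*(\epsilon)$ denotes the minimal cardinality of a finite set $\{\psi_1,\dots,\psi_J\}\subset\mathcal{F}=\mathcal{F}(L,\gamma,K)$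 with $\|\psi_l\|_\infty\le C_0$ for all $l$ and $\max_{f\in\mathcal{F}}\min_{\|\beta\|_2^2\le C_0}\|f-\sum_l\beta_l\psi_l\|_\infty\le\epsilon$, for a fixed $C_0>0$. ''Optimized in order of magnitude'' means: with $J^*(\epsilon)$ replaced by its order $\epsilon^{-K/L}$ and $r=\frac{(n\vee p)\log(n+p)}{N}$, the quantity $r\,\epsilon^{-K/L}+\epsilon^2$ is minimized over $\epsilon>0$, up to a constant factor depending only on $L,K$, at the stated $\epsilon$ (where its two terms are equal). The $O_P$ statement means: for every $\eta>0$ there are a constant $C$ and an integer $m_0$, depending only on $\eta,\sigma,\|M\|_\infty,L,\gamma,K$, such that for all $n,p,N$ with $n+p\ge m_0$ and $N\ge(n\wedge p)\log^2(n+p)$, the left side exceeds $C$ times the rate with probability at most $\eta$.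
   Formalization: The clause that J*(ε) is of order ε^{-K/L} is not asserted: as defined, F contains all constants while the combinations are bounded, so J* is infinite. The optimization is stated with ε^{-K/L} and for any J of that order; the bound with J* itself is then vacuous. *)

(* Defs.v *)
From HB Require Import structures.
From mathcomp Require Import all_boot all_order all_algebra.
From mathcomp Require Import all_classical all_reals all_analysis.
Set Implicit Arguments.
Unset Strict Implicit.
Unset Printing Implicit Defensive.
Import Order.TTheory GRing.Theory Num.Theory.
Import numFieldNormedType.Exports.
Local Open Scope classical_set_scope.
Local Open Scope ring_scope.

(* The entrywise maximum norm of a matrix is the library norm [`|A|], that is,
   [mx_norm A]. *)

Section MatrixNorms.
Context {R : realType}.
Implicit Types n p : nat.

Definition inner n p (A B : 'M[R]_(n, p)) : R := \tr (A^T *m B).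

Definition frobenius n p (A : 'M[R]_(n, p)) : R :=
  Num.sqrt (\sum_(i < n) \sum_(j < p) A i j ^+ 2).

(* The eigenvalues of [S], repeated according to algebraic multiplicity, when
   the characteristic polynomial of [S] splits over [R] (which is the case for
   every symmetric matrix). The list is unique up to permutation. *)
Definition eigenvalues n (S : 'M[R]_n) : seq R :=
  xget [::] [set s : seq R | char_poly S = \prod_(x <- s) ('X - x%:P)].

(* The sum of the singular values of [A], i.e. of the square roots of the
   eigenvalues of [A^T A]. *)
Definition nuclear_norm n p (A : 'M[R]_(n, p)) : R :=
  \sum_(x <- eigenvalues (A^T *m A)) Num.sqrt x.

End MatrixNorms.

Section Smoothness.
Context {R : realType}.
Implicit Types (K L : nat).

Definition unit_cube K : set 'rV[R]_K :=
  [set x | forall i, 0 <= x 0 i <= 1].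

(* A function on the cube is represented by a function on the whole space; all
   the notions below only use its values on the cube. In particular partial
   derivatives are taken within the cube, hence are one-sided on its faces. *)
Definition partial K (i : 'I_K) (f : 'rV[R]_K -> R) (x : 'rV[R]_K) : R :=
  lim ((fun h : R => h^-1 * (f (x + h *: delta_mx 0 i) - f x)) @
       within [set h : R | unit_cube (x + h *: delta_mx 0 i)] 0^').

(* (Frechet) differentiability at every point of the cube, relative to the
   cube. *)
Definition differentiable_on_cube K (f : 'rV[R]_K -> R) : Prop :=
  forall x, unit_cube x -> exists a : 'rV[R]_K,
    (fun y : 'rV[R]_K =>
       (f y - f x - \sum_(i < K) a 0 i * (y 0 i - x 0 i)) / `|y - x|)
    @ within (@unit_cube K) x^' --> (0 : R).

Fixpoint times_differentiable K L (f : 'rV[R]_K -> R) : Prop :=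
  if L is L'.+1 then
    differentiable_on_cube f /\
    forall i : 'I_K, times_differentiable L' (partial i f)
  else True.

Definition mpartial K (m : 'I_K -> nat) (f : 'rV[R]_K -> R) : 'rV[R]_K -> R :=
  foldr (fun i g => iter (m i) (partial i) g) f (enum 'I_K).

(* The class F(L, gamma, K). *)
Definition smooth_class L (gamma : R) K : set ('rV[R]_K -> R) :=
  [set f | times_differentiable L f /\
    forall m : 'I_K -> nat, (\sum_(i < K) m i = L)%N ->
      forall x, unit_cube x -> `|mpartial m f x| <= gamma].

(* The class M(L, gamma, K); the latent vector of row [i] is [row i theta]. *)
Definition smooth_matrix n p L (gamma : R) K : set 'M[R]_(n, p) :=
  [set M | exists (f : 'I_p -> 'rV[R]_K -> R) (theta : 'M[R]_(n, K)),
    [/\ forall j, smooth_class L gamma (f j),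
        forall i, unit_cube (row i theta) &
        forall i j, M i j = f j (row i theta)]].

(* [psi] enumerates, without repetition (as functions on the cube), a finite
   subset of F(L, gamma, K) whose combinations approximate the whole class. *)
Definition approximating_family L (gamma : R) K (C0 eps : R) J
    (psi : 'I_J -> 'rV[R]_K -> R) : Prop :=
  [/\ forall l, smooth_class L gamma (psi l),
      forall l l', (forall x, unit_cube x -> psi l x = psi l' x) -> l = l',
      forall l x, unit_cube x -> `|psi l x| <= C0 &
      forall f, smooth_class L gamma f ->
        exists beta : 'I_J -> R, \sum_(l < J) beta l ^+ 2 <= C0 /\
          forall x, unit_cube x ->
            `|f x - \sum_(l < J) beta l * psi l x| <= eps].

(* The minimal cardinality J*(eps), equal to +oo when no finite family
   qualifies. The latter always happens: for [0 < L] and [0 <= gamma] the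
   class contains all the constants, whereas the combinations of a given
   family are bounded on the cube, uniformly in [beta]. *)
Definition Jstar L (gamma : R) K (C0 eps : R) : \bar R :=
  ereal_inf [set (J%:R)%:E | J in
    [set J : nat | exists psi : 'I_J -> 'rV[R]_K -> R,
       approximating_family L gamma C0 eps psi]].

End Smoothness.

Section Rates.
Context {R : realType}.

Definition base_rate (n p N : nat) : R :=
  (maxn n p)%:R * ln (n + p)%:R / N%:R.

Definition eps_opt (L K n p N : nat) : R :=
  base_rate n p N `^ (L%:R / (2 * L + K)%:R).

Definition rate (L K n p N : nat) : R :=
  base_rate n p N `^ ((2 * L)%:R / (2 * L + K)%:R).

Definition tuning (C2 : R) (n p N : nat) : R :=
  C2 * Num.sqrt (ln (n + p)%:R / (N%:R * (minn n p)%:R)).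

Definition upper_bound (C2 : R) (J : R -> \bar R) (n p N : nat) (eps : R) :
    \bar R :=
  ((C2 ^+ 2 * ((1 + Num.sqrt 2) / 2) ^+ 2 * base_rate n p N)%:E * J eps +
   (eps ^+ 2)%:E)%E.

End Rates.

Section Model.
Context {R : realType}.

Definition sampling_basis (n p : nat) : set 'M[R]_(n, p) :=
  [set E | exists i j,
     E = (delta_mx i 0 : 'cV[R]_n) *m (delta_mx j 0 : 'cV[R]_p)^T].

Definition mutually_independent d (T : measurableType d)
    (P : probability T R) (I : finType) (F : I -> set (set T)) : Prop :=
  forall (D : {set I}) (A : I -> set T), (forall i, i \in D -> F i (A i)) ->
    (P (\bigcap_(i in [set i | i \in D]) A i) =
     \prod_(i in D) P (A i))%E.

(* The designs take finitely many values, so that the sigma-algebra generated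
   by [X t] consists of the preimages of all sets of matrices. *)
Definition generated_events d (T : measurableType d) (P : probability T R)
    (n p N : nat) (X : 'I_N -> T -> 'M[R]_(n, p))
    (xi : 'I_N -> {RV P >-> R}) (k : 'I_N + 'I_N) : set (set T) :=
  match k with
  | inl t => [set A | exists B : set 'M[R]_(n, p), A = X t @^-1` B]
  | inr t => [set A | exists2 B : set R, measurable B & A = xi t @^-1` B]
  end.

(* Joint mutual independence of [X 0, X 1, ..., xi 0, xi 1, ...] amounts to
   independence within each of the two families and between them. *)
Definition completion_sample d (T : measurableType d) (P : probability T R)
    (n p N : nat) (M : 'M[R]_(n, p)) (sigma : R)
    (X : 'I_N -> T -> 'M[R]_(n, p)) (xi : 'I_N -> {RV P >-> R})
    (y : 'I_N -> T -> R) : Prop :=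
  [/\ forall t w, sampling_basis (X t w),
      forall t E, sampling_basis E ->
        measurable (X t @^-1` [set E]) /\
        P (X t @^-1` [set E]) = ((n * p)%:R^-1)%:E,
      forall t (B : set R), measurable B ->
        P (xi t @^-1` B) = normal_prob 0 sigma B,
      mutually_independent P (generated_events X xi) &
      forall t w, y t w = inner (X t w) M + xi t w].

Definition objective (n p N : nat) (lambda : R) (y : 'I_N -> R)
    (X : 'I_N -> 'M[R]_(n, p)) (A : 'M[R]_(n, p)) : R :=
  (n * p)%:R^-1 * frobenius A ^+ 2
  - inner ((2 / N%:R) *: \sum_(t < N) y t *: X t) A
  + lambda * nuclear_norm A.

Definition is_estimator (n p N : nat) (lambda : R) (y : 'I_N -> R)
    (X : 'I_N -> 'M[R]_(n, p)) (Mhat : 'M[R]_(n, p)) : Prop :=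
  forall A, objective lambda y X Mhat <= objective lambda y X A.

Definition loss (n p : nat) (Mhat M : 'M[R]_(n, p)) : R :=
  (n * p)%:R^-1 * frobenius (Mhat - M) ^+ 2.

End Model.

(* Main.v *)
Require Import Defs.
From HB Require Import structures.
From mathcomp Require Import all_boot all_order all_algebra.
From mathcomp Require Import complex.
From mathcomp Require Import all_classical all_reals all_analysis.
From mathcomp Require Import measurable_realfun.
From mathcomp Require Import ring lra.
Set Implicit Arguments.
Unset Strict Implicit.
Unset Printing Implicit Defensive.
Import Order.TTheory GRing.Theory Num.Theory.
Import numFieldNormedType.Exports.
Local Open Scope classical_set_scope.
Local Open Scope ring_scope.

(** The theorem has an elementary part, on the choice of the accuracy, and a
   probabilistic part, the bound on the loss.

   The first is a balance between the increasing function [eps ^+ 2] and a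
   decreasing power of [eps], which agree at [eps_opt]. The approximation number
   [Jstar] itself is infinite, because the class contains all constants while
   the approximants are bounded ([Jstar_pinfty]); so is the upper bound built
   from it, and the event that the loss exceeds it is empty.

   The loss is controlled in three steps.

   - Oracle inequality ([oracle_inequality]). If half of the tuning parameter
     dominates the operator norm of the deviation of the mean of the data from
     its expectation [(n * p)%:R^-1 *: M], the loss is at most a multiple of
     [loss A M] plus [n * p * lambda ^+ 2 * \rank A], for every [A]. The nuclear
     norm is dual to the operator norm ([trace_duality]), with equality at the
     polar factor ([polar]). Hence the deviation, divided by its bound, can be
     traded for a contraction dual to [A] at the cost of a term of the order of
     the rank ([dual_contraction]).

   - Approximation ([smooth_matrix_low_rank]). The unit cube of latent vectors
     is divided into [q.+1 ^ K] cells. In each of them Taylor's formula makes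
     the rows of [M] combinations of a bounded number of fixed rows, up to an
     error of order [q.+1%:R^-1 ^+ L]. Taking for the side of the cells
     [eps_opt ^ (1 / L)] makes both terms of the oracle inequality of the order
     of [rate] ([loss_le_rate]).

   - Deviation ([noise_operator_bound]). The deviation is the sum of a centred
     uniform sample of the entries of [M] and of the noise matrix. Both are
     compared with sums with independent signs, the first by symmetrization
     ([symmetrization]), the second because the Gaussian law is symmetric
     ([sign_flip]). For matrices with independent signs, the trace of an even
     power of the dilation is bounded by a noncommutative Khintchine inequality
     ([rademacher_moment]), obtained by flipping one sign at a time. The bound
     involves the largest sum of squares in a row or column, which Chernoff's
     inequality controls ([overloaded_prob]); this is where the lower bound on
     [N] enters. Moments of order [ln (n + p)] give the logarithm in the tuning
     parameter.

   Since the estimator is any function that minimizes the objective pointwise,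
   its loss has to be shown to be measurable. It is, because the minimizer is a
   Lipschitz function of the mean of the data ([minimizer_lipschitz]), which
   follows from the strong convexity of the objective. *)

(** * Spectral theorem for real symmetric matrices *)

Section Dot.
Context {R : rcfType}.

Definition dot n (x y : 'rV[R]_n) : R := \sum_(i < n) x 0 i * y 0 i.

Lemma dot_mx n (x y : 'rV[R]_n) : x *m y^T = (dot x y)%:M.
Proof.
by apply/matrixP => i j; rewrite !ord1 !mxE eqxx; apply: eq_bigr => k _; rewrite mxE.
Qed.

Lemma dotC n (x y : 'rV[R]_n) : dot x y = dot y x.
Proof. by apply: eq_bigr => i _; rewrite mulrC. Qed.

Lemma dotDl n (x y z : 'rV[R]_n) : dot (x + y) z = dot x z + dot y z.
Proof. by rewrite /dot -big_split; apply: eq_bigr => i _; rewrite mxE mulrDl. Qed.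

Lemma dotZl n c (x z : 'rV[R]_n) : dot (c *: x) z = c * dot x z.
Proof. by rewrite /dot mulr_sumr; apply: eq_bigr => i _; rewrite mxE mulrA. Qed.

Lemma dotDr n (x y z : 'rV[R]_n) : dot z (x + y) = dot z x + dot z y.
Proof. by rewrite dotC dotDl !(dotC z). Qed.

Lemma dotZr n c (x z : 'rV[R]_n) : dot z (c *: x) = c * dot z x.
Proof. by rewrite dotC dotZl dotC. Qed.

Lemma dot_ge0 n (x : 'rV[R]_n) : 0 <= dot x x.
Proof. by apply: sumr_ge0 => i _; rewrite -expr2 sqr_ge0. Qed.

Lemma dot_eq0 n (x : 'rV[R]_n) : (dot x x == 0) = (x == 0).
Proof.
apply/idP/eqP => [|->]; last first.
  by rewrite /dot big1 // => i _; rewrite mxE mul0r.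
rewrite /dot psumr_eq0 => [/allP h|i _]; last by rewrite -expr2 sqr_ge0.
apply/rowP => i; apply/eqP; rewrite mxE.
by have := h i (mem_index_enum i); rewrite /= mulf_eq0 orbb.
Qed.

Lemma dot_adj n p (A : 'M[R]_(n, p)) x y : dot (x *m A) y = dot x (y *m A^T).
Proof.
have h : (x *m A) *m y^T = x *m (y *m A^T)^T by rewrite trmx_mul trmxK mulmxA.
by move: h; rewrite !dot_mx => /matrixP/(_ 0 0); rewrite !mxE !eqxx.
Qed.

Lemma cauchy_schwarz n (x y : 'rV[R]_n) : dot x y ^+ 2 <= dot x x * dot y y.
Proof.
have [/eqP y0|y0] := boolP (dot y y == 0).
  have -> : y = 0 by apply/eqP; rewrite -dot_eq0 y0.
  have d0 z : dot z (0 : 'rV[R]_n) = 0 by rewrite /dot big1 // => i _; rewrite mxE mulr0.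
  by rewrite !d0 expr0n mulr0.
have yp : 0 < dot y y by rewrite lt_def y0 dot_ge0.
have := dot_ge0 (dot y y *: x - dot x y *: y).
rewrite -scaleN1r dotDl !dotDr !dotZl !dotZr (dotC y x) => h.
have : 0 <= dot y y * (dot x x * dot y y - dot x y ^+ 2) by apply: le_trans h _; lra.
by rewrite pmulr_rge0 // subr_ge0.
Qed.

(** The complex characteristic polynomial provides an eigenvector [x + i y];
    symmetry makes its eigenvalue real, so that [x] and [y] are real
    eigenvectors and one of them is nonzero. *)
Lemma symmetric_eigenvector n (S : 'M[R]_n.+1) : S^T = S ->
  exists (a : R) (v : 'rV[R]_n.+1), v != 0 /\ v *m S = a *: v.
Proof.
move=> Ssym.
pose rc : R -> (complex R) := real_complex R.
have [[a b] /eigenvalueP[v vS v0]] :=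
  @eigenvalue_closed ((complex R)) n.+1 (map_mx rc S) isT.
pose x : 'rV[R]_n.+1 := \row_j complex.Re (v 0 j).
pose y : 'rV[R]_n.+1 := \row_j complex.Im (v 0 j).
have reS (u : (complex R)) (r : R) : u * rc r = Complex (complex.Re u * r) (complex.Im u * r).
  by case: u => u1 u2; rewrite /rc/= /real_complex_def; congr Complex; rewrite mulr0 ?subr0 ?add0r.
have sumC (I : Type) (s : seq I) (f : I -> (complex R)) :
   \sum_(i <- s) f i = Complex (\sum_(i <- s) complex.Re (f i)) (\sum_(i <- s) complex.Im (f i)).
  elim: s => [|i s ih]; first by rewrite !big_nil.
  by rewrite !big_cons ih; case: (f i).
have vSj j : Complex ((x *m S) 0 j) ((y *m S) 0 j) =
    Complex (a * x 0 j - b * y 0 j) (a * y 0 j + b * x 0 j).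
  have := congr1 (fun u : 'rV__ => u 0 j) vS.
  rewrite /= !mxE sumC; case: (v 0 j) => v1 v2 /=.
  move=> h; rewrite -[RHS]/(Complex a b * Complex v1 v2) -h.
  by congr Complex; apply: eq_bigr => k _; rewrite !mxE reS.
have xS : x *m S = a *: x - b *: y.
  by apply/rowP => j; have [] := vSj j; rewrite !mxE => -> _.
have yS : y *m S = a *: y + b *: x.
  by apply/rowP => j; have [_] := vSj j; rewrite !mxE => ->.
have xy0 : (x != 0) || (y != 0).
  rewrite -negb_and; apply: contra v0 => /andP[/eqP x0 /eqP y0]; apply/eqP/rowP => j.
  have := congr1 (fun u : 'rV__ => u 0 j) x0; have := congr1 (fun u : 'rV__ => u 0 j) y0.
  by rewrite !mxE; case: (v 0 j) => v1 v2 /= -> ->.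
have : b * (dot x x + dot y y) = 0.
  have := dot_adj S x y; rewrite Ssym xS yS -scaleN1r dotDl dotDr !(dotZl, dotZr).
  by move=> h; lra.
move/eqP; rewrite mulf_eq0 => /orP[/eqP b0|]; last first.
  by rewrite paddr_eq0 ?dot_ge0 // !dot_eq0 => /andP[/eqP x0 /eqP y0]; move: xy0; rewrite x0 y0 eqxx.
case/orP: xy0 => h; exists a.
  by exists x; split => //; rewrite xS b0 scale0r subr0.
by exists y; split => //; rewrite yS b0 scale0r addr0.
Qed.

(** The Householder reflection that exchanges [u] and the first basis vector,
   or the identity when the two agree. *)
Lemma exists_orthogonal_row n (u : 'rV[R]_n.+1) : dot u u = 1 ->
  exists H : 'M[R]_n.+1, [/\ H^T = H, H *m H = 1%:M & delta_mx 0 0 *m H = u].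
Proof.
move=> uu; pose e : 'rV[R]_n.+1 := delta_mx 0 0.
have ee : dot e e = 1.
  rewrite /dot (bigD1 0) //= big1 => [|i /negPf i0]; rewrite !mxE eqxx ?i0 ?mulr1 ?addr0 //=; lra.
have [->|ue] := eqVneq u e.
  by exists 1%:M; split; rewrite ?trmx1 ?mulmx1.
pose w := u - e; pose q := dot w w.
have q0 : q != 0 by rewrite dot_eq0 subr_eq0.
have qE : q = 2 - 2 * dot e u.
  by rewrite /q /w -scaleN1r !dotDl !dotDr !dotZl !dotZr ?dotZl (dotC u e) uu ee; lra.
exists (1%:M - (2 / q) *: (w^T *m w)); split.
- by rewrite linearB /= linearZ /= trmx1 trmx_mul trmxK.
- set P := w^T *m w.
  have PP : P *m P = q *: P by rewrite /P -mulmxA (mulmxA w) dot_mx mul_scalar_mx -scalemxAr.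
  rewrite mulmxBl mul1mx mulmxBr mulmx1 -!scalemxAl -!scalemxAr PP.
  by move: P {PP} => P; apply/matrixP => i j; rewrite !mxE; field.
- have eP : e *m (w^T *m w) = dot e w *: w by rewrite mulmxA dot_mx mul_scalar_mx.
  have ewq : 2 / q * dot e w = -1.
    rewrite /w -scaleN1r dotDr dotZr ee; apply: (mulfI q0).
    by rewrite [RHS]mulrN1 mulrA mulrCA mulfV // mulr1 qE; lra.
  by rewrite mulmxBr mulmx1 -scalemxAr eP scalerA ewq scaleN1r opprK /w addrC subrK.
Qed.

(** Deflation: a reflection that moves an eigenvector to the first basis vector
   splits off a block of size one. *)
Theorem real_spectral n (S : 'M[R]_n) : S^T = S ->
  exists (V : 'M[R]_n) (d : 'rV[R]_n),
    V *m V^T = 1%:M /\ S = V^T *m diag_mx d *m V.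
Proof.
elim: n S => [|n IHn] S Ssym.
  by exists 0, 0; split; apply/matrixP => [[]].
have [a [v [v0 vS]]] := symmetric_eigenvector Ssym.
have vv : 0 < dot v v by rewrite lt_def dot_eq0 v0 dot_ge0.
pose u := (Num.sqrt (dot v v))^-1 *: v.
have uu : dot u u = 1.
  rewrite dotZl dotZr mulrA -invfM -expr2 sqr_sqrtr ?ltW // mulVf // gt_eqF //.
have uS : u *m S = a *: u by rewrite -scalemxAl vS !scalerA mulrC.
have [H [Hs HH eH]] := exists_orthogonal_row uu.
pose S' : 'M[R]_(1 + n) := H *m S *m H.
have S's : S'^T = S' by rewrite /S' !trmx_mul Hs Ssym mulmxA.
have eS : delta_mx 0 0 *m S' = a *: (delta_mx 0 0 : 'rV_(1 + n)).
  rewrite /S' !mulmxA eH uS -scalemxAl -eH -mulmxA HH mulmx1 //.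
have SE : S = H *m S' *m H by rewrite /S' !mulmxA HH mul1mx -mulmxA HH mulmx1.
clearbody S'.
have [V2 [d2 [V2o S2]]] := IHn (drsubmx S') (etrans (trmx_drsub S') (congr1 drsubmx S's)).
have S'row (i j : 'I_(1 + n)) : i = 0%N :> nat -> S' i j = a * (j == 0%N :> nat)%:R.
  move=> i0; have -> : i = 0 by apply/val_inj.
  have := congr1 (fun M : 'rV__ => M 0 j) eS.
  by rewrite /= -rowE !mxE eqxx => ->.
have S'E : S' = block_mx a%:M 0 0 (drsubmx S').
  rewrite -{1}[S']submxK; congr block_mx.
  - by apply/matrixP => i j; rewrite !ord1 !mxE S'row //= mulr1.
  - by apply/matrixP => i j; rewrite ord1 !mxE S'row //= mulr0.
  - by apply/matrixP => i j; rewrite (ord1 j) !mxE -S's mxE S'row //= mulr0.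
pose W : 'M[R]_(1 + n) := block_mx 1%:M 0 0 V2.
have Wo : W *m W^T = 1%:M.
  by rewrite /W tr_block_mx !trmx0 mulmx_block !mul0mx !mulmx0 !addr0 !add0r mul1mx trmx1 V2o -scalar_mx_block.
have S'W : S' = W^T *m diag_mx (row_mx a%:M d2) *m W.
  rewrite {1}S'E diag_mx_row /W tr_block_mx !trmx0 !mulmx_block.
  rewrite !(mul0mx, mulmx0, addr0, add0r) trmx1 mul1mx mulmx1 -S2; congr block_mx.
  by apply/matrixP => i j; rewrite !ord1 !mxE.
exists (W *m H), (row_mx a%:M d2 : 'rV_(1 + n)); split.
  by rewrite trmx_mul Hs mulmxA -(mulmxA W) HH mulmx1 Wo.
by rewrite SE S'W trmx_mul Hs !mulmxA.
Qed.

End Dot.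

(** * Trace duality and the oracle inequality *)

Section Matrices.
Context {R : rcfType}.

Definition ip n p (A B : 'M[R]_(n, p)) : R := \tr (A^T *m B).

(** For [0 <= c] this says that the operator norm of [A] is at most [c]. The
   squares keep square roots out of the computations. *)
Definition opbd n p (A : 'M[R]_(n, p)) (c : R) : Prop :=
  forall x y, dot (x *m A) y ^+ 2 <= c ^+ 2 * (dot x x * dot y y).

Lemma ipE n p (A B : 'M[R]_(n, p)) : ip A B = \sum_i \sum_j A i j * B i j.
Proof.
rewrite /ip /mxtrace exchange_big; apply: eq_bigr => j _; rewrite mxE.
by apply: eq_bigr => i _; rewrite mxE.
Qed.

Lemma ip_row n p (A B : 'M[R]_(n, p)) : ip A B = \sum_i dot (row i A) (row i B).
Proof.
by rewrite ipE; apply: eq_bigr => i _; apply: eq_bigr => j _; rewrite !mxE.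
Qed.

Lemma ipC n p (A B : 'M[R]_(n, p)) : ip A B = ip B A.
Proof. by rewrite !ip_row; apply: eq_bigr => i _; rewrite dotC. Qed.

Lemma ip_tr n p (A B : 'M[R]_(n, p)) : ip A^T B^T = ip A B.
Proof. by rewrite /ip trmxK mxtrace_mulC -mxtrace_tr trmx_mul trmxK. Qed.

Lemma ipDl n p (A B C : 'M[R]_(n, p)) : ip (A + B) C = ip A C + ip B C.
Proof. by rewrite /ip linearD /= mulmxDl linearD. Qed.

Lemma ipZl n p a (A C : 'M[R]_(n, p)) : ip (a *: A) C = a * ip A C.
Proof. by rewrite /ip linearZ /= -scalemxAl linearZ. Qed.

Lemma ipDr n p (A B C : 'M[R]_(n, p)) : ip C (A + B) = ip C A + ip C B.
Proof. by rewrite ipC ipDl !(ipC C). Qed.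

Lemma ipZr n p a (A C : 'M[R]_(n, p)) : ip C (a *: A) = a * ip C A.
Proof. by rewrite ipC ipZl ipC. Qed.

Lemma ipNl n p (A C : 'M[R]_(n, p)) : ip (- A) C = - ip A C.
Proof. by rewrite -scaleN1r ipZl mulN1r. Qed.

Lemma ipNr n p (A C : 'M[R]_(n, p)) : ip C (- A) = - ip C A.
Proof. by rewrite -scaleN1r ipZr mulN1r. Qed.

Definition ip_lin := (@ipDl, @ipDr, @ipZl, @ipZr, @ipNl, @ipNr).

Lemma ip_ge0 n p (A : 'M[R]_(n, p)) : 0 <= ip A A.
Proof. by rewrite ip_row sumr_ge0 // => i _; rewrite dot_ge0. Qed.

Lemma ip_mulr n p q (A : 'M[R]_(n, p)) (B : 'M[R]_(p, q)) C :
  ip C (A *m B) = ip (C *m B^T) A.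
Proof. by rewrite /ip trmx_mul trmxK mulmxA mxtrace_mulC mulmxA. Qed.

Lemma ip_mull n p q (A : 'M[R]_(n, p)) (B : 'M[R]_(p, q)) C :
  ip C (A *m B) = ip (A^T *m C) B.
Proof. by rewrite /ip trmx_mul trmxK mulmxA. Qed.

Lemma ip_cauchy_schwarz n p (A B : 'M[R]_(n, p)) :
  ip A B ^+ 2 <= ip A A * ip B B.
Proof.
have h (C D : 'M[R]_(n, p)) : ip C D = dot (mxvec C) (mxvec D).
  rewrite ipE /dot pair_bigA /= (reindex _ (curry_mxvec_bij _ _)) /=.
  by apply: eq_bigr => [[i j]] _ /=; rewrite !mxvecE.
by rewrite !h cauchy_schwarz.
Qed.

(** The inequality between the arithmetic and the geometric mean, in the form in
   which it follows an application of the Cauchy-Schwarz inequality. *)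
Lemma sqr_le_mul_le (x s t : R) : x ^+ 2 <= s * t -> 0 <= s -> 0 <= t ->
  x <= s / 4 + t.
Proof.
move=> h s0 t0; rewrite leNgt; apply/negP => lt_x.
have : (s / 4 + t) ^+ 2 < x ^+ 2 by rewrite ltr_sqr ?nnegrE; lra.
have := sqr_ge0 (s / 4 - t); lra.
Qed.

(** The vector that tests the row [x *m A] best is that row itself. *)
Lemma opbd_row n p (A : 'M[R]_(n, p)) c : opbd A c <->
  forall x, dot (x *m A) (x *m A) <= c ^+ 2 * dot x x.
Proof.
split=> h x; last first.
  move=> y; apply: le_trans (cauchy_schwarz _ _) _.
  by rewrite mulrA ler_wpM2r ?dot_ge0.
have := h x (x *m A); set q := dot (x *m A) _; rewrite mulrA.
have := dot_ge0 (x *m A); rewrite -/q le_eqVlt => /orP[/eqP <- _|q0].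
  by rewrite mulr_ge0 ?sqr_ge0 ?dot_ge0.
by rewrite expr2 ler_pM2r.
Qed.

Lemma opbd_tr n p (A : 'M[R]_(n, p)) c : opbd A c -> opbd A^T c.
Proof. by move=> h x y; rewrite dotC -dot_adj [dot x x * _]mulrC. Qed.

Lemma opbdZ n p (A : 'M[R]_(n, p)) c k : opbd A c -> opbd (k *: A) (k * c).
Proof.
move=> h x y; rewrite -scalemxAr dotZl !exprMn -[leRHS]mulrA.
by rewrite ler_wpM2l ?sqr_ge0.
Qed.

Lemma opbd_ip_mul n p q (C : 'M[R]_(n, p)) (D : 'M[R]_(p, q)) c : opbd D c ->
  ip (C *m D) (C *m D) <= c ^+ 2 * ip C C.
Proof.
move=> /opbd_row h; rewrite !ip_row mulr_sumr; apply: ler_sum => i _.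
by rewrite row_mul h.
Qed.

Lemma opbdD n p (A B : 'M[R]_(n, p)) a b : 0 <= a -> 0 <= b ->
  opbd A a -> opbd B b -> opbd (A + B) (a + b).
Proof.
move=> a0 b0 hA hB x y; rewrite mulmxDr dotDl.
have h (C : 'M[R]_(n, p)) c : 0 <= c -> opbd C c ->
   `|dot (x *m C) y| <= c * Num.sqrt (dot x x * dot y y).
  move=> c0 hC; rewrite -ler_sqr ?nnegrE ?mulr_ge0 ?sqrtr_ge0 //.
  rewrite real_normK ?num_real // exprMn sqr_sqrtr ?mulr_ge0 ?dot_ge0 //.
have s0 : 0 <= dot x x * dot y y by rewrite mulr_ge0 ?dot_ge0.
rewrite -(sqr_sqrtr s0) -exprMn -[X in X <= _]real_normK ?num_real //.
rewrite ler_sqr ?nnegrE ?mulr_ge0 ?addr_ge0 ?sqrtr_ge0 //.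
by apply: le_trans (ler_normD _ _) _; rewrite mulrDl lerD // h.
Qed.

Lemma trace_orthogonal n (V C : 'M[R]_n) : V *m V^T = 1%:M ->
  \tr C = \sum_i dot (row i V *m C) (row i V).
Proof.
move=> /mulmx1C VV; rewrite -[C in LHS]mulmx1 -VV mulmxA mxtrace_mulC mulmxA.
apply: eq_bigr => i _; rewrite mxE; apply: eq_bigr => k _.
by rewrite -row_mul !mxE.
Qed.

Lemma dot_row_orthogonal n (V : 'M[R]_n) i : V *m V^T = 1%:M ->
  dot (row i V) (row i V) = 1.
Proof.
move=> /matrixP/(_ i i); rewrite !mxE eqxx => h; rewrite -[RHS]h.
by apply: eq_bigr => k _; rewrite !mxE.
Qed.

(** A singular value decomposition of [A], in the form of an eigenbasis of
   [A^T A]: the rows of [V] are right singular vectors, and [d] lists the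
   squares of the singular values. *)
Definition gram_spectral n p (A : 'M[R]_(n, p)) (V : 'M[R]_p) (d : 'rV[R]_p) :=
  V *m V^T = 1%:M /\ A^T *m A = V^T *m diag_mx d *m V.

Lemma exists_gram_spectral n p (A : 'M[R]_(n, p)) :
  exists V d, gram_spectral A V d.
Proof. by apply: real_spectral; rewrite trmx_mul trmxK. Qed.

Lemma gram_row n p (A : 'M[R]_(n, p)) V d i : gram_spectral A V d ->
  dot (row i V *m A^T) (row i V *m A^T) = d 0 i.
Proof.
move=> [VV h]; rewrite dot_adj trmxK -mulmxA h.
have -> : row i V *m (V^T *m diag_mx d *m V) = d 0 i *: row i V.
  rewrite -row_mul !mulmxA VV mul1mx; apply/rowP => k.
  by rewrite mxE mul_diag_mx !mxE.
by rewrite dotZr (dot_row_orthogonal i VV) mulr1.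
Qed.

Lemma gram_ge0 n p (A : 'M[R]_(n, p)) V d i : gram_spectral A V d -> 0 <= d 0 i.
Proof. by move=> h; rewrite -(gram_row i h) dot_ge0. Qed.

Lemma gram_char_poly n p (A : 'M[R]_(n, p)) V d : gram_spectral A V d ->
  char_poly (A^T *m A) = \prod_(i < p) ('X - (d 0 i)%:P).
Proof.
move=> [VV ->]; have VV' := mulmx1C VV.
have -> : char_poly (V^T *m diag_mx d *m V) = char_poly (diag_mx d).
  rewrite /char_poly /char_poly_mx.
  have -> : 'X%:M - map_mx polyC (V^T *m diag_mx d *m V) =
     map_mx polyC V^T *m ('X%:M - map_mx polyC (diag_mx d)) *m map_mx polyC V.
    rewrite mulmxBr mulmxBl !map_mxM /=; congr (_ - _).
    by rewrite scalar_mxC -mulmxA -map_mxM VV' map_mx1 mulmx1.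
  by rewrite !det_mulmx mulrAC -det_mulmx -map_mxM VV' map_mx1 det1 mul1r.
rewrite char_poly_trig ?diag_mx_is_trig //.
by apply: eq_bigr => i _; rewrite mxE eqxx.
Qed.

(** The duality between operator norm and nuclear norm: expand the trace in
   the basis of right singular vectors. *)
Lemma trace_duality n p (A B : 'M[R]_(n, p)) V d c : gram_spectral A V d ->
  0 <= c -> opbd B c -> ip B A <= c * \sum_i Num.sqrt (d 0 i).
Proof.
move=> h c0 hB; rewrite /ip (trace_orthogonal _ h.1) mulr_sumr.
apply: ler_sum => i _; rewrite mulmxA dot_adj dotC -dot_adj -[B]trmxK.
apply: le_trans (ler_norm _) _; rewrite -ler_sqr ?nnegrE ?mulr_ge0 ?sqrtr_ge0 //.
rewrite real_normK ?num_real // exprMn sqr_sqrtr ?(gram_ge0 i h) //.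
rewrite trmxK; apply: le_trans (hB _ _) _.
by rewrite (gram_row i h) (dot_row_orthogonal i h.1) mulr1.
Qed.

Lemma mxrank_sum (I : Type) (s : seq I) (P : pred I) n p (F : I -> 'M[R]_(n, p)) :
  (\rank (\sum_(i <- s | P i) F i)%R <= \sum_(i <- s | P i) \rank (F i))%N.
Proof.
elim/big_ind2: _ => [|A a B b ha hb|//]; first by rewrite mxrank0.
exact: leq_trans (mxrank_add _ _) (leq_add ha hb).
Qed.

(** The identity is the sum of a multiple of [diag_mx d] and of the projection
   onto the coordinates at which [d] vanishes. *)
Lemma mxrank_diag_ge n (d : 'rV[R]_n) :
  (\sum_i (d 0 i != 0)%R <= \rank (diag_mx d))%N.
Proof.
have dE : 1%:M = diag_mx d *m diag_mx (\row_i (d 0 i)^-1) +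
    \sum_(i | d 0 i == 0) delta_mx i i.
  rewrite mulmx_diag; apply/matrixP => i j; rewrite !mxE summxE.
  have [->|ij] := eqVneq i j.
    have [d0|d0] := eqVneq (d 0 j) 0.
      rewrite (bigD1 j) ?d0 ?eqxx //= big1 => [|k /andP[_ /negPf kj]].
        by rewrite !mxE !eqxx mul0r mul0rn add0r addr0.
      by rewrite mxE eq_sym kj.
    rewrite big1 ?addr0 ?mulfV // => k /eqP dk.
    by rewrite !mxE; case: eqVneq => // jk; rewrite jk dk eqxx in d0.
  rewrite mulr0n add0r big1 // => k _; rewrite !mxE.
  by case: eqVneq => // <-; rewrite eq_sym (negPf ij).
have := mxrank1 R n; rewrite {1}dE => rk.
have := mxrank_add (diag_mx d *m diag_mx (\row_i (d 0 i)^-1)) (\sum_(i | d 0 i == 0) delta_mx i i).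
have := mxrankM_maxl (diag_mx d) (diag_mx (\row_i (d 0 i)^-1)).
have := mxrank_sum (index_enum 'I_n) (fun i => d 0 i == 0)%R (fun i => delta_mx i i : 'M[R]_n).
under eq_bigr do rewrite mxrank_delta.
have : (\sum_i (d 0 i != 0)%R + \sum_(i | (d 0 i == 0)%R) 1 = n)%N.
  rewrite -[RHS]card_ord -sum1_card [in RHS](bigID (fun i => d 0 i == 0)%R) /= addnC; congr addn.
  by rewrite big_mkcond [RHS]big_mkcond; apply: eq_bigr => i _ /=; case: eqP.
rewrite rk => h1 h2 h3 h4; rewrite -(leq_add2r (\sum_(i | (d 0 i == 0)%R) 1)) h1.
by apply: leq_trans h4 _; apply: leq_add.
Qed.

(** The polar factor of [A]: a partial isometry carrying the nuclear norm. It is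
   [A] multiplied by the pseudo-inverse of the square root of [A^T A]. *)
Lemma polar n p (A : 'M[R]_(n, p)) V d : gram_spectral A V d ->
  exists U : 'M[R]_(n, p),
    [/\ U *m U^T *m U = U, U *m U^T *m A = A,
        ip U A = \sum_i Num.sqrt (d 0 i) & ip U U <= (\rank A)%:R].
Proof.
move=> h; have [VV AA] := h; have VV' := mulmx1C VV.
pose s : 'rV[R]_p := \row_i (Num.sqrt (d 0 i))^-1.
pose e : 'rV[R]_p := \row_i (d 0 i != 0)%:R.
have sqd i : Num.sqrt (d 0 i) * Num.sqrt (d 0 i) = d 0 i.
  by rewrite -expr2 sqr_sqrtr ?(gram_ge0 i h).
have sq0 i : (Num.sqrt (d 0 i) == 0) = (d 0 i == 0).
  by rewrite -[in RHS]sqd mulf_eq0 orbb.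
pose U := A *m V^T *m diag_mx s *m V.
have Ut : U^T = V^T *m diag_mx s *m V *m A^T.
  by rewrite /U !trmx_mul trmxK tr_diag_mx !mulmxA.
have sds : diag_mx s *m diag_mx d *m diag_mx s = diag_mx e.
  rewrite !mulmx_diag; congr diag_mx; apply/rowP => i; rewrite !mxE.
  have [->|d0] := eqVneq (d 0 i) 0; first by rewrite mulr0 mul0r.
  by rewrite -{2}sqd mulrA mulVf ?sq0 // mul1r mulfV ?sq0.
have se : diag_mx s *m diag_mx e = diag_mx s.
  rewrite mulmx_diag; congr diag_mx; apply/rowP => i; rewrite !mxE.
  by have [d0|d0] := eqVneq (d 0 i) 0; rewrite ?mulr1 // d0 sqrtr0 invr0 mul0r.
have UtA : U^T *m A = V^T *m (diag_mx s *m diag_mx d) *m V.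
  by rewrite Ut -mulmxA AA !mulmxA -(mulmxA _ V V^T) VV mulmx1.
have UtU : U^T *m U = V^T *m diag_mx e *m V.
  by rewrite {2}/U !mulmxA UtA -(mulmxA _ V V^T) VV mulmx1 -sds !mulmxA.
have AVe : A *m V^T *m diag_mx e = A *m V^T.
  apply/matrixP => k i; rewrite mul_mx_diag mxE [e 0 i]mxE.
  have [d0|_] := eqVneq (d 0 i) 0; last by rewrite mulr1.
  have /eqP : dot (row i V *m A^T) (row i V *m A^T) = 0 by rewrite (gram_row i h).
  rewrite dot_eq0 => /eqP/rowP/(_ k); rewrite -row_mul !mxE => h0.
  rewrite mulr0 -[LHS]h0; apply: eq_bigr => l _; by rewrite !mxE mulrC.
exists U; split.
- by rewrite -mulmxA UtU /U !mulmxA -(mulmxA _ V V^T) VV mulmx1 -(mulmxA _ (diag_mx s)) se.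
- rewrite -mulmxA UtA /U !mulmxA -(mulmxA _ V V^T) VV mulmx1 -!mulmxA.
  have -> : diag_mx s *m (diag_mx s *m (diag_mx d *m V)) = diag_mx e *m V.
    by rewrite [diag_mx s *m (diag_mx d *m V)]mulmxA (diag_mxC s d) -sds !mulmxA.
  by rewrite !mulmxA AVe -mulmxA VV' mulmx1.
- rewrite /ip UtA mxtrace_mulC (mulmxA V) VV mul1mx mulmx_diag mxtrace_diag.
  apply: eq_bigr => i _; rewrite !mxE.
  have [d0|d0] := eqVneq (d 0 i) 0; first by rewrite d0 mulr0 sqrtr0.
  by rewrite -{2}sqd mulrA mulVf ?sq0 // mul1r.
- rewrite /ip UtU mxtrace_mulC (mulmxA V) VV mul1mx mxtrace_diag.
  under eq_bigr do rewrite mxE.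
  rewrite -natr_sum ler_nat; apply: leq_trans (mxrank_diag_ge d) _.
  have -> : diag_mx d = V *m A^T *m A *m V^T.
    by rewrite -(mulmxA V) AA !mulmxA VV mul1mx -mulmxA VV mulmx1.
  exact: leq_trans (mxrankM_maxl _ _) (mxrankM_maxr _ _).
Qed.

(** Pythagoras for [U *m U^T], the orthogonal projection onto the space on which
   the partial isometry [U] does not vanish. *)
Lemma isometry_complement n p (U : 'M[R]_(n, p)) (x : 'rV[R]_n) :
  U *m U^T *m U = U ->
  dot (x *m (1%:M - U *m U^T)) (x *m (1%:M - U *m U^T)) =
  dot x x - dot (x *m U) (x *m U).
Proof.
move=> UUU; set P := 1%:M - U *m U^T.
have PU : P *m U = 0 by rewrite mulmxBl mul1mx UUU subrr.
have Ps : P^T = P by rewrite linearB /= trmx1 trmx_mul trmxK.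
have PP : P *m P = P.
  by rewrite {2}/P mulmxBr mulmx1 mulmxA PU mul0mx subr0.
rewrite dot_adj Ps -mulmxA PP /P mulmxBr mulmx1 dotDr -scaleN1r dotZr mulmxA.
by rewrite [in RHS]dot_adj mulN1r.
Qed.

(** Compressing [D] to the orthogonal complements of the ranges of a partial
   isometry [U] and adding [U] keeps a contraction: the two pieces act between
   orthogonal subspaces. *)
Lemma opbd_isometry_add n p (U D : 'M[R]_(n, p)) :
  U *m U^T *m U = U -> opbd D 1 ->
  opbd (U + (1%:M - U *m U^T) *m D *m (1%:M - U^T *m U)) 1.
Proof.
move=> UUU hD; apply/opbd_row => x; rewrite expr1n mul1r.
have UUU' : U^T *m U^T^T *m U^T = U^T by rewrite -[RHS](congr1 trmx UUU) !trmx_mul mulmxA.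
have hQ (z : 'rV[R]_p) := isometry_complement z UUU'; rewrite trmxK in hQ.
have hP := isometry_complement x UUU.
set Q := 1%:M - U^T *m U in hQ *; set P := 1%:M - U *m U^T in hP *.
have UtQ : U *m Q = 0 by rewrite mulmxBr mulmx1 mulmxA UUU subrr.
have Qs : Q^T = Q by rewrite linearB /= trmx1 trmx_mul trmxK.
have c0 : dot (x *m (P *m D *m Q)) (x *m U) = 0.
  rewrite mulmxA dot_adj Qs -mulmxA UtQ mulmx0.
  by rewrite /dot big1 // => i _; rewrite [X in _ * X]mxE mulr0.
rewrite mulmxDr dotDl !dotDr c0 (dotC (x *m U)) c0 addr0 add0r.
rewrite [x *m (P *m D *m Q)]mulmxA hQ; have := dot_ge0 (x *m (P *m D) *m U^T).
by have /opbd_row/(_ (x *m P)) := hD; rewrite expr1n mul1r hP -[x *m P *m D]mulmxA; lra.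
Qed.

(** Any contraction [D] can be traded, at the cost of a term of rank order, for
   a contraction [B] that is dual to [A]. On the complements of the ranges of
   [A] the two agree; what is lost lives on spaces of dimension [\rank A], and
   there the Frobenius norm is at most the square root of the rank. *)
Lemma dual_contraction n p (A D H : 'M[R]_(n, p)) V d k :
  gram_spectral A V d -> opbd D 1 -> 0 < k ->
  exists B, [/\ opbd B 1, ip B A = \sum_i Num.sqrt (d 0 i) &
    ip D H <= ip B H + 3 * (k * ip H H + (\rank A)%:R / (4 * k))].
Proof.
move=> h hD k0; have [U [UUU UUA UA UUr]] := polar h.
set Q := 1%:M - U^T *m U; set P := 1%:M - U *m U^T.
exists (U + P *m D *m Q); split; first exact: opbd_isometry_add.
  rewrite ipDl UA -[RHS]addr0; congr (_ + _).
  rewrite -mulmxA ipC ip_mull /P linearB /= trmx1 trmx_mul trmxK mulmxBl mul1mx UUA subrr.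
  by rewrite /ip trmx0 mul0mx mxtrace0.
(* each error term has a Frobenius norm at most that of [U], which is at most
   the square root of the rank *)
have bnd (X : 'M[R]_(n, p)) : ip X X <= ip U U -> ip X H <= k * ip H H + (\rank A)%:R / (4 * k).
  move=> hX; have -> : k * ip H H = k * ip H H * 4 / 4 by field.
  apply: sqr_le_mul_le.
  - apply: le_trans (ip_cauchy_schwarz _ _) _.
    have -> : k * ip H H * 4 * ((\rank A)%:R / (4 * k)) = (\rank A)%:R * ip H H.
      by field; rewrite gt_eqF.
    by rewrite ler_wpM2r ?ip_ge0 // (le_trans hX).
  - by rewrite !mulr_ge0 ?ip_ge0 // ltW.
  - by rewrite divr_ge0 ?ler0n // mulr_ge0 // ltW.
have DE : D = P *m D *m Q + U *m U^T *m D + P *m D *m (U^T *m U).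
  rewrite /Q mulmxBr mulmx1 addrAC subrK /P mulmxBl mul1mx subrK //.
have b1 : ip (- U) H <= k * ip H H + (\rank A)%:R / (4 * k).
  by apply: bnd; rewrite ipNl ipNr opprK.
have pr : ip (U *m U^T) (U *m U^T) = ip U U.
  by rewrite ip_mull mulmxA -ip_tr trmxK !trmx_mul trmxK mulmxA UUU.
have b2 : ip (U *m U^T *m D) H <= k * ip H H + (\rank A)%:R / (4 * k).
  apply: bnd; apply: le_trans (opbd_ip_mul _ hD) _.
  by rewrite expr1n mul1r pr.
have b3 : ip (P *m D *m (U^T *m U)) H <= k * ip H H + (\rank A)%:R / (4 * k).
  apply: bnd; rewrite -ip_tr trmx_mul.
  have hDP : opbd (P *m D)^T 1.
    apply: opbd_tr; apply/opbd_row => x; rewrite mulmxA expr1n mul1r.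
    have /opbd_row/(_ (x *m P)) := hD; rewrite expr1n mul1r => /le_trans; apply.
    by rewrite isometry_complement // lerBlDr lerDl dot_ge0.
  apply: le_trans (opbd_ip_mul _ hDP) _.
  by rewrite expr1n mul1r !trmx_mul trmxK ip_mulr -ip_tr !trmx_mul !trmxK mulmxA UUU.
rewrite {1}DE !ipDl; rewrite ipNl in b1; lra.
Qed.

(** The oracle inequality for the penalized estimator: for noise dominated by
   half of the penalty, the contraction dual to [A] cancels the noise up to
   terms of rank order, which the strong convexity of the loss absorbs. *)
Lemma oracle_inequality n p (A M Mh D : 'M[R]_(n, p)) VA dA VM dM mu lam :
  gram_spectral A VA dA -> gram_spectral Mh VM dM -> 0 < mu -> 0 < lam ->
  opbd D (lam / 2) ->
  mu * ip Mh Mh - 2 * ip (mu *: M + D) Mh + lam * (\sum_i Num.sqrt (dM 0 i)) <=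
  mu * ip A A - 2 * ip (mu *: M + D) A + lam * (\sum_i Num.sqrt (dA 0 i)) ->
  mu * ip (Mh - M) (Mh - M) <=
  3 * (mu * ip (A - M) (A - M)) + 18 * (lam ^+ 2 / mu * (\rank A)%:R).
Proof.
move=> hA hM mu0 lam0 hD; rewrite !ip_lin => basic.
have hD' : opbd ((2 / lam) *: D) 1.
  by have := opbdZ (2 / lam) hD; rewrite (_ : 2 / lam * (lam / 2) = 1) //; field; rewrite gt_eqF.
(* for this value of [k] the term [3 * k * lam] is a quarter of [mu] *)
have k0 : 0 < mu / (12 * lam) by rewrite divr_gt0 // mulr_gt0.
have [B [hB BA BH]] := dual_contraction (Mh - A) hA hD' k0.
have := trace_duality hM ler01 hB; rewrite mul1r => hBM.
move: BH; rewrite !ip_lin -BA in basic *; set r := (\rank A)%:R => BH.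
have := ip_ge0 ((Mh - M) + (A - M)); rewrite !ip_lin => sq.
have {}BH : lam * (2 / lam * (ip D Mh - ip D A)) <= lam * (ip B Mh - ip B A) + mu / 4 * ip (Mh - A) (Mh - A) + 9 * (lam ^+ 2 / mu * r).
  have eq_ge0 (u v : R) : u = v -> 0 <= u -> 0 <= v by move=> ->.
  have := ler_wpM2l (ltW lam0) BH; rewrite !ip_lin -subr_ge0 => h.
  by rewrite -subr_ge0; move: h; apply: eq_ge0; field; rewrite !gt_eqF.
have lamK : lam * (2 / lam * (ip D Mh - ip D A)) = 2 * (ip D Mh - ip D A) by field; rewrite gt_eqF.
rewrite lamK !ip_lin in BH; move: (lam ^+ 2 / mu * r) BH => rr BH.
rewrite (ipC M A) (ipC M Mh) (ipC A Mh) in sq BH basic *.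
have := ler_wpM2l (ltW lam0) hBM; nra.
Qed.

(** Convexity of the nuclear norm: the polar factor of the midpoint is a test
   matrix for both endpoints. *)
Lemma nuclear_midpoint n p (A B : 'M[R]_(n, p)) VA dA VB dB VC dC :
  gram_spectral A VA dA -> gram_spectral B VB dB ->
  gram_spectral (2^-1 *: (A + B)) VC dC ->
  2 * (\sum_i Num.sqrt (dC 0 i)) <=
  \sum_i Num.sqrt (dA 0 i) + \sum_i Num.sqrt (dB 0 i).
Proof.
move=> hA hB hC; have [U [UUU _ <- _]] := polar hC.
have hU : opbd U 1.
  apply/opbd_row => x; rewrite expr1n mul1r -subr_ge0 -isometry_complement //.
  exact: dot_ge0.
have := trace_duality hA ler01 hU; have := trace_duality hB ler01 hU.
by rewrite !ip_lin !mul1r; lra.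
Qed.

(** Strong convexity of the objective makes its minimizer a Lipschitz function
   of the data [Y]; comparing both minimizers with their midpoint suffices. *)
Lemma minimizer_lipschitz n p (A B Y Z : 'M[R]_(n, p)) VA dA VB dB VC dC mu lam :
  gram_spectral A VA dA -> gram_spectral B VB dB ->
  gram_spectral (2^-1 *: (A + B)) VC dC -> 0 < mu -> 0 <= lam ->
  mu * ip A A - 2 * ip Y A + lam * (\sum_i Num.sqrt (dA 0 i)) <=
  mu * ip (2^-1 *: (A + B)) (2^-1 *: (A + B)) - 2 * ip Y (2^-1 *: (A + B))
    + lam * (\sum_i Num.sqrt (dC 0 i)) ->
  mu * ip B B - 2 * ip Z B + lam * (\sum_i Num.sqrt (dB 0 i)) <=
  mu * ip (2^-1 *: (A + B)) (2^-1 *: (A + B)) - 2 * ip Z (2^-1 *: (A + B))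
    + lam * (\sum_i Num.sqrt (dC 0 i)) ->
  mu ^+ 2 * ip (A - B) (A - B) <= 4 * ip (Y - Z) (Y - Z).
Proof.
move=> hA hB hC mu0 lam0 hYA hZB.
have h : mu * ip (A - B) (A - B) <= 2 * ip (Y - Z) (A - B).
  have := ler_wpM2l lam0 (nuclear_midpoint hA hB hC).
  move: hYA hZB; rewrite !ip_lin (ipC B A); lra.
have := ip_cauchy_schwarz (Y - Z) (A - B).
have := ip_ge0 (A - B); have := ip_ge0 (Y - Z); move: h.
move: (ip (A - B) (A - B)) (ip (Y - Z) (Y - Z)) (ip (Y - Z) (A - B)) => s t x h t0 s0 cs.
have [s00|s1] := eqVneq s 0; first by rewrite s00 mulr0 mulr_ge0.
have sp : 0 < s by rewrite lt_def s1.
rewrite -(ler_pM2r sp); apply: (@le_trans _ _ (4 * x ^+ 2)); last by nra.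
have -> : mu ^+ 2 * s * s = (mu * s) ^+ 2 by ring.
have -> : 4 * x ^+ 2 = (2 * x) ^+ 2 by ring.
have ms0 : 0 <= mu * s by rewrite mulr_ge0 // ltW.
by rewrite ler_sqr // nnegrE // (le_trans ms0).
Qed.

End Matrices.

(** * Moments of sums of matrices with independent signs *)

Section Khintchine.
Context {R : rcfType}.

(** The difference of the two sides is at least the product of the differences
   of the powers [q] and [m - q] of [|x|] and [|y|], which have the same sign. *)
Lemma expr_mixed_le (x y : R) m q : ~~ odd m -> (q <= m)%N ->
  x ^+ q * y ^+ (m - q) + x ^+ (m - q) * y ^+ q <= x ^+ m + y ^+ m.
Proof.
move=> me qm.
have ev (z : R) : z ^+ m = `|z| ^+ m.
  by rewrite -normrX ger0_norm // exprn_even_ge0.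
rewrite (ev x) (ev y); apply: (@le_trans _ _
    (`|x| ^+ q * `|y| ^+ (m - q) + `|x| ^+ (m - q) * `|y| ^+ q)).
  by rewrite lerD // -!normrX -normrM ler_norm.
have := normr_ge0 x; have := normr_ge0 y; move: `|x| `|y| => a b b0 a0.
have e z : z ^+ m = z ^+ q * z ^+ (m - q) :> R by rewrite -exprD subnKC.
rewrite (e a) (e b) -subr_ge0.
have -> : a ^+ q * a ^+ (m - q) + b ^+ q * b ^+ (m - q) -
    (a ^+ q * b ^+ (m - q) + a ^+ (m - q) * b ^+ q) =
    (a ^+ q - b ^+ q) * (a ^+ (m - q) - b ^+ (m - q)) by ring.
have [ab|ba] := leP a b.
  by rewrite mulr_le0 // subr_le0 lerXn2r ?nnegrE.
by rewrite mulr_ge0 // subr_ge0 lerXn2r ?nnegrE // ltW.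
Qed.

Lemma sum_expr_mixed_le (x y : R) m : ~~ odd m ->
  \sum_(q < m.+1) x ^+ q * y ^+ (m - q) <= m.+1%:R / 2 * (x ^+ m + y ^+ m).
Proof.
move=> me; set s := \sum_(q < _) _.
have : s + s <= m.+1%:R * (x ^+ m + y ^+ m).
  rewrite {2}/s (reindex_inj rev_ord_inj) /= -big_split /=.
  apply: (@le_trans _ _ (\sum_(q < m.+1) (x ^+ m + y ^+ m))).
    apply: ler_sum => q _; have qm : (q <= m)%N by rewrite -ltnS.
    by rewrite subSS subKn //; apply: expr_mixed_le.
  by rewrite sumr_const card_ord mulr_natl.
lra.
Qed.

Lemma spectral_expr n (V : 'M[R]_n) d k : V *m V^T = 1%:M ->
  (V^T *m diag_mx d *m V) ^+ k = V^T *m diag_mx (\row_i d 0 i ^+ k) *m V.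
Proof.
move=> VV; elim: k => [|k ih].
  rewrite expr0 (_ : diag_mx _ = 1%:M) ?mulmx1 ?(mulmx1C VV) //.
  by apply/matrixP => i j; rewrite !mxE expr0.
rewrite exprS ih -mulmxE !mulmxA -(mulmxA _ V) VV mulmx1 -(mulmxA V^T) mulmx_diag.
by congr (_ *m diag_mx _ *m _); apply/rowP => i; rewrite !mxE exprS.
Qed.

Lemma trace_sandwich n (V U H : 'M[R]_n) (d e : 'rV[R]_n) : H^T = H ->
  \tr (H *m (V^T *m diag_mx d *m V) *m H *m (U^T *m diag_mx e *m U)) =
  \sum_j \sum_i (U *m H *m V^T) j i ^+ 2 * d 0 i * e 0 j.
Proof.
move=> Hs; rewrite !mulmxA mxtrace_mulC !mulmxA; set G := U *m H *m V^T.
have -> : G *m diag_mx d *m V *m H *m U^T = G *m diag_mx d *m G^T.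
  by rewrite /G !trmx_mul trmxK Hs !mulmxA.
apply: eq_bigr => j _; rewrite mul_mx_diag mxE mxE mulr_suml.
apply: eq_bigr => i _; rewrite mul_mx_diag !mxE; ring.
Qed.

(** The trace form of the inequality between geometric and arithmetic means:
   in eigenbases of [W] and [Y] it becomes the scalar inequality, weighted by
   squares. *)
Lemma trace_mixed_le n (H W Y : 'M[R]_n) m : ~~ odd m ->
  H^T = H -> W^T = W -> Y^T = Y ->
  \sum_(q < m.+1) \tr (H *m W ^+ q *m H *m Y ^+ (m - q)) <=
  m.+1%:R / 2 * (\tr (H *m H *m W ^+ m) + \tr (H *m H *m Y ^+ m)).
Proof.
move=> me Hs /real_spectral[V [d [VV WE]]] /real_spectral[U [e [UU YE]]].
have hq q s : \tr (H *m W ^+ q *m H *m Y ^+ s) =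
    \sum_j \sum_i (U *m H *m V^T) j i ^+ 2 * d 0 i ^+ q * e 0 j ^+ s.
  rewrite WE YE !spectral_expr // trace_sandwich //.
  by apply: eq_bigr => j _; apply: eq_bigr => i _; rewrite !mxE.
have -> : \tr (H *m H *m W ^+ m) = \tr (H *m W ^+ m *m H *m Y ^+ 0).
  by rewrite expr0 mulmx1 -mulmxA mxtrace_mulC.
have -> : \tr (H *m H *m Y ^+ m) = \tr (H *m W ^+ 0 *m H *m Y ^+ m).
  by rewrite expr0 mulmx1.
under eq_bigr do rewrite hq.
rewrite !hq exchange_big -big_split /= mulr_sumr; apply: ler_sum => j _.
rewrite exchange_big -big_split /= mulr_sumr; apply: ler_sum => i _.
set g := (U *m H *m V^T) j i.
have -> : \sum_(q < m.+1) g ^+ 2 * d 0 i ^+ q * e 0 j ^+ (m - q) =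
    g ^+ 2 * \sum_(q < m.+1) d 0 i ^+ q * e 0 j ^+ (m - q).
  by rewrite mulr_sumr; apply: eq_bigr => q _; rewrite mulrA.
rewrite !expr0 !mulr1 -mulrDr mulrCA ler_wpM2l ?sqr_ge0 //.
exact: sum_expr_mixed_le.
Qed.

Lemma subrXX_noncomm n (A B : 'M[R]_n) m :
  A ^+ m - B ^+ m = \sum_(q < m) A ^+ q *m (A - B) *m B ^+ (m.-1 - q).
Proof.
elim: m => [|m ih]; first by rewrite big_ord0 subrr.
rewrite big_ord_recr /= subnn expr0 mulmx1.
have -> : \sum_(i < m) A ^+ i *m (A - B) *m B ^+ (m - i) = (A ^+ m - B ^+ m) *m B.
  rewrite ih mulmx_suml; apply: eq_bigr => i _.
  case: m i {ih} => [[]//|m] i; have im : (i <= m)%N by rewrite -ltnS.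
  by rewrite (subSn im) /= exprSr -mulmxE !mulmxA.
by rewrite mulmxBl mulmxBr !exprSr -!mulmxE addrC addrA subrK.
Qed.

Lemma trmx_expr n (A : 'M[R]_n) k : (A ^+ k)^T = A^T ^+ k.
Proof.
elim: k => [|k ih]; first by rewrite !expr0 trmx1.
by rewrite exprS exprSr -!mulmxE trmx_mul ih.
Qed.

Lemma sym_even_diag_ge0 n (A : 'M[R]_n) k i : A^T = A -> 0 <= (A ^+ k.*2) i i.
Proof.
move=> As; rewrite -addnn exprD -mulmxE mxE sumr_ge0 // => j _.
have := trmx_expr A k; rewrite As.
by move=> /matrixP/(_ i j); rewrite mxE => ->; rewrite -expr2 sqr_ge0.
Qed.

Definition flip N (t : 'I_N) (e : {ffun 'I_N -> bool}) : {ffun 'I_N -> bool} :=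
  [ffun s => (s == t) (+) e s].

Lemma flipK N (t : 'I_N) : involutive (flip t).
Proof. by move=> e; apply/ffunP => s; rewrite !ffunE addbA addbb. Qed.

Section RademacherSum.
Variables (d N : nat) (H : 'I_N -> 'M[R]_d).
Hypothesis Hsym : forall t, (H t)^T = H t.

Definition rademacher (e : {ffun 'I_N -> bool}) : 'M[R]_d :=
  \sum_t (-1) ^+ e t *: H t.

Lemma rademacher_sym e : (rademacher e)^T = rademacher e.
Proof.
by rewrite /rademacher linear_sum /=; apply: eq_bigr => t _; rewrite linearZ /= Hsym.
Qed.

Lemma rademacher_flip t e :
  rademacher e - rademacher (flip t e) = (2 * (-1) ^+ e t) *: H t.
Proof.
rewrite /rademacher -sumrB (bigD1 t) //= big1 ?addr0 => [|s /negPf st].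
  by rewrite ffunE eqxx -scalerBl; congr (_ *: _); case: (e t) => /=; lra.
by rewrite ffunE st subrr.
Qed.

(** Flipping the sign of one summand turns the linear term in it into a
   difference of powers, whose telescoping exposes the square [H t *m H t]. *)
Lemma rademacher_linear_term t k :
  \sum_(e : {ffun 'I_N -> bool}) (-1) ^+ e t * \tr (H t *m rademacher e ^+ k.*2.+1) <=
  k.*2.+1%:R * \sum_e \tr (H t *m H t *m rademacher e ^+ k.*2).
Proof.
set f := fun e : {ffun 'I_N -> bool} => (-1) ^+ e t * \tr (H t *m rademacher e ^+ k.*2.+1).
have f2 : \sum_e f e + \sum_e f e =
    2 * \sum_e \sum_(q < k.*2.+1) \tr (H t *m rademacher e ^+ q *m H t *m
      rademacher (flip t e) ^+ (k.*2 - q)).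
  rewrite {2}(reindex_inj (inv_inj (flipK t))) -big_split mulr_sumr /=.
  apply: eq_bigr => e _; rewrite /f ffunE eqxx.
  have -> : (-1) ^+ (true (+) e t) = - (-1) ^+ e t :> R by case: (e t) => /=; lra.
  rewrite mulNr -mulrBr -raddfB -mulmxBr subrXX_noncomm rademacher_flip.
  rewrite mulmx_sumr raddf_sum /= !mulr_sumr; apply: eq_bigr => q _.
  rewrite -scalemxAr -scalemxAl -scalemxAr mxtraceZ !mulmxA.
  by rewrite !mulrA; congr (_ * _); case: (e t) => /=; lra.
suff : \sum_e f e + \sum_e f e <=
    2 * (k.*2.+1%:R * \sum_e \tr (H t *m H t *m rademacher e ^+ k.*2)) by lra.
rewrite f2 ler_pM2l //.
apply: (@le_trans _ _ (\sum_e k.*2.+1%:R / 2 *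
    (\tr (H t *m H t *m rademacher e ^+ k.*2) +
     \tr (H t *m H t *m rademacher (flip t e) ^+ k.*2)))).
  apply: ler_sum => e _; apply: trace_mixed_le; rewrite ?odd_double //.
  - exact: rademacher_sym.
  - exact: rademacher_sym.
rewrite -mulr_sumr big_split /=.
rewrite [X in _ + X](reindex_inj (inv_inj (flipK t))) /=.
under [X in _ + X]eq_bigr do rewrite flipK.
lra.
Qed.

Variables (v : 'rV[R]_d) (V : R).
Hypothesis Hsqr : \sum_t H t *m H t = diag_mx v.
Hypothesis vV : forall i, v 0 i <= V.

(** A discrete integration by parts lowers the exponent by two. *)
Lemma rademacher_moment_step k :
  \sum_e \tr (rademacher e ^+ k.+1.*2) <=
  k.*2.+1%:R * V * \sum_e \tr (rademacher e ^+ k.*2).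
Proof.
have -> : \sum_e \tr (rademacher e ^+ k.+1.*2) =
    \sum_t \sum_(e : {ffun 'I_N -> bool}) (-1) ^+ e t * \tr (H t *m rademacher e ^+ k.*2.+1).
  rewrite [RHS]exchange_big /=; apply: eq_bigr => e _.
  rewrite doubleS exprS -mulmxE {1}/rademacher mulmx_suml raddf_sum /=.
  by apply: eq_bigr => t _; rewrite -scalemxAl mxtraceZ.
apply: le_trans (ler_sum _ (fun t _ => rademacher_linear_term t k)) _.
rewrite -mulr_sumr -mulrA ler_wpM2l // exchange_big mulr_sumr /=.
apply: ler_sum => e _; rewrite -raddf_sum -mulmx_suml Hsqr mulr_sumr.
apply: ler_sum => i _; rewrite mul_diag_mx mxE ler_wpM2r //.
exact/sym_even_diag_ge0/rademacher_sym.
Qed.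

(** The noncommutative Khintchine inequality, in the case where the sum of the
   squares is diagonal. *)
Lemma rademacher_moment k : 0 <= V ->
  \sum_e \tr (rademacher e ^+ k.*2) <= (k.*2%:R * V) ^+ k * (2 ^+ N * d%:R).
Proof.
move=> V0; have base : \sum_e \tr (rademacher e ^+ 0) = 2 ^+ N * d%:R.
  under eq_bigr do rewrite expr0 mxtrace1.
  by rewrite sumr_const card_ffun card_bool card_ord -[LHS]mulr_natl natrX.
suff h l : (l <= k)%N -> \sum_e \tr (rademacher e ^+ l.*2) <=
    (k.*2%:R * V) ^+ l * (2 ^+ N * d%:R) by apply: h.
elim: l => [|l ih lk]; first by rewrite base expr0 mul1r.
apply: le_trans (rademacher_moment_step l) _.
rewrite exprS -[leRHS]mulrA.
apply: (@le_trans _ _ (k.*2%:R * V * \sum_e \tr (rademacher e ^+ l.*2))).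
  apply: ler_wpM2r.
    apply: sumr_ge0 => e _; apply: sumr_ge0 => i _.
    exact/sym_even_diag_ge0/rademacher_sym.
  by apply: ler_wpM2r => //; rewrite ler_nat (leq_trans (leqnSn _)) // -doubleS leq_double.
by rewrite -!mulrA !ler_wpM2l // ih // ltnW.
Qed.

End RademacherSum.

(** An even moment dominates the same power of every eigenvalue. *)
Lemma opbd_of_moment n (S : 'M[R]_n) u k : S^T = S -> 0 <= u ->
  \tr (S ^+ k.+1.*2) <= u ^+ k.+1.*2 -> opbd S u.
Proof.
move=> /real_spectral[V [d [VV SE]]] u0.
rewrite SE spectral_expr // mxtrace_mulC mulmxA VV mul1mx mxtrace_diag => h.
have du i : d 0 i ^+ 2 <= u ^+ 2.
  rewrite -(@ler_pXn2r _ k.+1) ?nnegrE ?sqr_ge0 // -!exprM mulnC muln2.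
  apply: le_trans h; rewrite (bigD1 i) //= mxE lerDl sumr_ge0 // => j _.
  by rewrite mxE exprn_even_ge0 // odd_double.
apply/opbd_row => x; rewrite mulmxA; set y := x *m V^T.
have -> : dot x x = dot y y.
  by rewrite /y [RHS]dot_adj trmxK -mulmxA (mulmx1C VV) mulmx1.
have -> : x *m (V^T *m diag_mx d) *m V = y *m diag_mx d *m V by rewrite /y !mulmxA.
rewrite dot_adj -mulmxA VV mulmx1 /dot mulr_sumr; apply: ler_sum => i _.
rewrite mul_mx_diag !mxE -/(y 0 i).
have := du i; have := sqr_ge0 (y 0 i); nra.
Qed.

(** A symmetric matrix with the operator norm of [A], to which the spectral
   theorem applies. *)
Definition dilation n p (A : 'M[R]_(n, p)) : 'M[R]_(n + p) :=
  block_mx 0 A A^T 0.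

Lemma dilation_opbd n p (A : 'M[R]_(n, p)) u : opbd (dilation A) u -> opbd A u.
Proof.
move=> h x y; have := h (row_mx x 0) (row_mx 0 y).
have dotr (a c : 'rV[R]_n) (b e : 'rV[R]_p) : dot (row_mx a b) (row_mx c e) = dot a c + dot b e.
  rewrite /dot big_split_ord /=; congr (_ + _); apply: eq_bigr => i _.
    by rewrite !row_mxEl.
  by rewrite !row_mxEr.
have d0 q (z : 'rV[R]_q) : dot 0 z = 0.
  by rewrite /dot big1 // => i _; rewrite mxE mul0r.
rewrite mul_row_block !mul0mx !mulmx0 add0r addr0 !dotr !d0 ?add0r.
by rewrite addr0.
Qed.

Definition dilation_moment n p k (A : 'M[R]_(n, p)) : R :=
  \tr (dilation A ^+ k.*2).

Lemma dilation_sym n p (A : 'M[R]_(n, p)) : (dilation A)^T = dilation A.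
Proof. by rewrite /dilation tr_block_mx !trmx0 trmxK. Qed.

Lemma dilation_moment_ge0 n p k (A : 'M[R]_(n, p)) : 0 <= dilation_moment k A.
Proof.
by apply: sumr_ge0 => i _; apply: sym_even_diag_ge0; exact: dilation_sym.
Qed.

Lemma opbd_of_dilation_moment n p k (A : 'M[R]_(n, p)) u : 0 <= u ->
  dilation_moment k.+1 A <= u ^+ k.+1.*2 -> opbd A u.
Proof.
move=> u0 h; apply: dilation_opbd; apply: opbd_of_moment u0 h.
exact: dilation_sym.
Qed.

(** For matrices with a single nonzero entry, the squares of the dilations add
   up to the diagonal matrix of the row sums and column sums of squares. *)
Lemma rademacher_dilation_moment n p N (i_ : 'I_N -> 'I_n) (j_ : 'I_N -> 'I_p)
    (z : 'I_N -> R) V k :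
  0 <= V ->
  (forall i, \sum_(t | i_ t == i) z t ^+ 2 <= V) ->
  (forall j, \sum_(t | j_ t == j) z t ^+ 2 <= V) ->
  \sum_(e : {ffun 'I_N -> bool}) dilation_moment k
     (\sum_t ((-1) ^+ e t * z t) *: delta_mx (i_ t) (j_ t)) <=
  (k.*2%:R * V) ^+ k * (2 ^+ N * (n + p)%:R).
Proof.
move=> V0 hr hc.
pose H t : 'M[R]_(n + p) := z t *: dilation (delta_mx (i_ t) (j_ t)).
have Hs t : (H t)^T = H t.
  by rewrite /H linearZ /= dilation_sym.
have HE e : rademacher H e =
    dilation (\sum_t ((-1) ^+ e t * z t) *: delta_mx (i_ t) (j_ t)).
  have bD (A B1 : 'M[R]_(n, p)) : dilation (A + B1) = dilation A + dilation B1.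
    by rewrite /dilation add_block_mx !addr0 linearD.
  have bZ (A : 'M[R]_(n, p)) a : dilation (a *: A) = a *: dilation A.
    by rewrite /dilation scale_block_mx !scaler0 linearZ.
  have b0 : dilation (0 : 'M[R]_(n, p)) = 0 by rewrite /dilation trmx0 block_mx0.
  rewrite (big_morph (@dilation n p) bD b0).
  by apply: eq_bigr => t _; rewrite bZ /H scalerA.
pose v : 'rV[R]_(n + p) := row_mx (\row_i \sum_(t | i_ t == i) z t ^+ 2)
  (\row_j \sum_(t | j_ t == j) z t ^+ 2).
have Hsq : \sum_t H t *m H t = diag_mx v.
  have dsum (m : nat) (f : 'I_N -> 'I_m) : \sum_t z t ^+ 2 *: delta_mx (f t) (f t) =
      diag_mx (\row_i \sum_(t | f t == i) z t ^+ 2) :> 'M[R]_m.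
    apply/matrixP => a b; rewrite !mxE summxE -sumrMnl [RHS]big_mkcond /=.
    apply: eq_bigr => t _; rewrite !mxE; have [->|ab] := eqVneq a b.
      by rewrite andbb [b == _]eq_sym; case: eqP; rewrite ?mulr1 ?mulr0 ?mulr1n.
    have -> : (a == f t) && (b == f t) = false.
      by apply/negP => /andP[/eqP e1 /eqP e2]; rewrite e1 e2 eqxx in ab.
    by rewrite mulr0; case: ifP.
  rewrite diag_mx_row -!dsum.
  under eq_bigr => t _.
    rewrite /H -scalemxAl -scalemxAr scalerA -expr2 /dilation mulmx_block.
    rewrite !mul0mx !mulmx0 !add0r !addr0 trmx_delta !mul_delta_mx scale_block_mx !scaler0.
  over.
  have bD (A A' : 'M[R]_n) (C C' : 'M[R]_p) :
    block_mx A 0 0 C + block_mx A' 0 0 C' = block_mx (A + A') 0 0 (C + C').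
    by rewrite add_block_mx !addr0.
  elim/big_ind3: _ => // [|? ? ? ? ? ? -> ->]; last by rewrite bD.
  by rewrite block_mx0.
have vV i : v 0 i <= V.
  by rewrite mxE; case: fintype.split => j; rewrite mxE.
under eq_bigr do rewrite /dilation_moment -HE.
exact: (rademacher_moment Hs Hsq vV k V0).
Qed.

End Khintchine.

(** * Deviation of the uniform sample from its mean *)

Section UniformSamples.
Local Open Scope set_scope.
Local Open Scope ring_scope.
Context {R : rcfType}.

(** The coordinates of a uniformly distributed tuple are uniform and
   independent; products of functions of single coordinates are averaged by
   expanding a product of sums. *)
Lemma sum_coordinate (I : finType) N (h : I -> R) (s : 'I_N) :
  #|I|%:R * \sum_(x : {ffun 'I_N -> I}) h (x s) = #|I|%:R ^+ N * \sum_i h i.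
Proof.
have := @bigA_distr_bigA R 0 1 *%R +%R 'I_N I (fun t i => if t == s then h i else 1).
have -> : \sum_(x : {ffun 'I_N -> I}) \prod_t (if t == s then h (x t) else 1) =
    \sum_(x : {ffun 'I_N -> I}) h (x s).
  apply: eq_bigr => x _; rewrite (bigD1 s) //= eqxx big1 ?mulr1 // => t /negPf.
  by move=> ->.
move=> <-; rewrite (bigD1 s) //= eqxx.
have -> : \prod_(t | t != s) \sum_i (if t == s then h i else 1) = \prod_(t | t != s) #|I|%:R.
  by apply: eq_bigr => t /negPf ->; rewrite sumr_const.
rewrite prodr_const cardC1 card_ord mulrCA [RHS]mulrC -exprS prednK //.
by case: N s => [[]|].
Qed.

Lemma sum_coordinates_uncorrelated (I : finType) N (g : I -> R) (s t : 'I_N) :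
  \sum_i g i = 0 -> s != t ->
  \sum_(x : {ffun 'I_N -> I}) g (x s) * g (x t) = 0.
Proof.
move=> g0 st.
have := @bigA_distr_bigA R 0 1 *%R +%R 'I_N I
  (fun r i => if (r == s) || (r == t) then g i else 1).
rewrite (bigD1 s) //= eqxx /= g0 mul0r => h0; rewrite [RHS]h0.
apply: eq_bigr => x _; rewrite [RHS](bigD1 s) //= eqxx /= (bigD1 t) 1?eq_sym //= eqxx orbT.
rewrite big1 ?mulr1 // => r /andP[/negPf -> /negPf ->] //.
Qed.

(** Centred functions of different coordinates are uncorrelated, which leaves
   the diagonal terms of the square. *)
Lemma sum_variance (I : finType) N (g : I -> R) : \sum_i g i = 0 ->
  #|I|%:R * \sum_(x : {ffun 'I_N -> I}) (\sum_t g (x t)) ^+ 2 =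
  N%:R * #|I|%:R ^+ N * \sum_i g i ^+ 2.
Proof.
move=> g0.
have -> : \sum_(x : {ffun 'I_N -> I}) (\sum_t g (x t)) ^+ 2 =
    \sum_t \sum_(x : {ffun 'I_N -> I}) g (x t) ^+ 2.
  rewrite [RHS]exchange_big /=.
  transitivity (\sum_(x : {ffun 'I_N -> I}) \sum_s \sum_t g (x s) * g (x t)).
    apply: eq_bigr => x _; rewrite expr2 mulr_suml; apply: eq_bigr => s _.
    by rewrite mulr_sumr.
  rewrite exchange_big [RHS]exchange_big /=; apply: eq_bigr => s _.
  rewrite exchange_big (bigD1 s) //= [X in _ + X]big1 ?addr0 // => t ts.
  by rewrite sum_coordinates_uncorrelated // eq_sym.
rewrite [LHS]mulr_sumr.
transitivity (\sum_(t < N) #|I|%:R ^+ N * \sum_i g i ^+ 2).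
  by apply: eq_bigr => t _; exact: (sum_coordinate (fun i => g i ^+ 2)).
by rewrite sumr_const card_ord -[LHS]mulr_natl mulrA.
Qed.

Lemma count_markov (J : finType) (f : J -> R) c (B : {set J}) :
  (forall x, 0 <= f x) -> (forall x, x \in B -> c <= f x) ->
  #|B|%:R * c <= \sum_x f x.
Proof.
move=> f0 fB; rewrite -sum1_card natr_sum mulr_suml [leRHS](bigID (mem B)) /=.
rewrite -[leLHS]addr0 lerD ?sumr_ge0 //; apply: ler_sum => x xB.
by rewrite mul1r fB.
Qed.

(** A boolean, so that signs and samples with this property can be counted. *)
Definition large n p (A : 'M[R]_(n, p)) (u : R) : bool := ~~ `[< opbd A u >].

(** Markov's inequality for the moment of order [k.+1.*2]. *)
Lemma rademacher_large n p N (i_ : 'I_N -> 'I_n) (j_ : 'I_N -> 'I_p)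
    (z : 'I_N -> R) V u k :
  0 <= V -> 0 <= u ->
  (forall i, \sum_(t | i_ t == i) z t ^+ 2 <= V) ->
  (forall j, \sum_(t | j_ t == j) z t ^+ 2 <= V) ->
  #|[set e : {ffun 'I_N -> bool} |
     large (\sum_t ((-1) ^+ e t * z t) *: delta_mx (i_ t) (j_ t)) u]|%:R *
    u ^+ k.+1.*2 <= (k.+1.*2%:R * V) ^+ k.+1 * (2 ^+ N * (n + p)%:R).
Proof.
move=> V0 u0 hr hc; apply: le_trans (rademacher_dilation_moment k.+1 V0 hr hc).
apply: count_markov => [e|e]; first exact: dilation_moment_ge0.
rewrite inE => /asboolPn h; rewrite leNgt; apply/negP => /ltW lt.
exact/h/(opbd_of_dilation_moment u0 lt).
Qed.

Section Symmetrization.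
Variables (n p N : nat) (M : 'M[R]_(n, p)).
Local Notation I := ('I_n * 'I_p)%type.
Local Notation Om := {ffun 'I_N -> I}.
Local Notation Eps := {ffun 'I_N -> bool}.

Definition sampled (x : Om) : 'M[R]_(n, p) :=
  \sum_t M (x t).1 (x t).2 *: delta_mx (x t).1 (x t).2.

Definition signed_sampled (e : Eps) (x : Om) : 'M[R]_(n, p) :=
  \sum_t ((-1) ^+ e t * M (x t).1 (x t).2) *: delta_mx (x t).1 (x t).2.

Definition sampling_mean : 'M[R]_(n, p) := (N%:R / (n * p)%:R) *: M.

Lemma bilinear_sampled (x : Om) a b :
  dot (a *m sampled x) b = \sum_t M (x t).1 (x t).2 * (a 0 (x t).1 * b 0 (x t).2).
Proof.
rewrite /sampled mulmx_sumr /dot.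
under eq_bigr => j _ do rewrite summxE mulr_suml.
rewrite exchange_big; apply: eq_bigr => t _ /=.
rewrite (bigD1 (x t).2) //= big1 ?addr0 => [|j /negPf jt]; last first.
  by rewrite -scalemxAr !mxE big1 ?mulr0 ?mul0r // => i _; rewrite mxE jt andbF mulr0.
rewrite -scalemxAr !mxE (bigD1 (x t).1) //= big1 => [|i /negPf it].
  by rewrite mxE !eqxx mulr1 addr0 mulrA.
by rewrite mxE it mulr0.
Qed.

(** Chebyshev's inequality for a fixed bilinear form: an independent copy of
   the sample is with probability one half close to the mean in the direction
   in which the sample itself deviates. *)
Lemma half_concentrated (c u : R) a b : (0 < n)%N -> (0 < p)%N -> 0 < u ->
  (forall i j, `|M i j| <= c) -> N%:R * c ^+ 2 / (n * p)%:R <= 2 * u ^+ 2 ->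
  0 < dot a a * dot b b ->
  2 * #|[set x : Om | (2 * u) ^+ 2 * (dot a a * dot b b) <
     dot (a *m (sampled x - sampling_mean)) b ^+ 2]|%:R <= #|Om|%:R :> R.
Proof.
move=> n0 p0 u0 Mc Nu q0; set q := dot a a * dot b b in q0 *.
set B := [set x | _].
pose h (i : I) := M i.1 i.2 * (a 0 i.1 * b 0 i.2).
pose m := (\sum_i h i) / (n * p)%:R.
pose g i := h i - m.
have np0 : (0 : R) < (n * p)%:R by rewrite ltr0n muln_gt0 n0.
have cI : #|{: I}| = (n * p)%N by rewrite card_prod !card_ord.
have g0 : \sum_i g i = 0.
  rewrite sumrB sumr_const cI -mulr_natl /m mulrC divfK ?subrr ?gt_eqF //.
have mE : dot (a *m sampling_mean) b = N%:R * m.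
  have key : dot (a *m M) b = \sum_i h i.
    rewrite -(pair_bigA _ (fun i j => M i j * (a 0 i * b 0 j))) /= [RHS]exchange_big.
    by apply: eq_bigr => j _; rewrite mxE mulr_suml; apply: eq_bigr => i _; ring.
  by rewrite /sampling_mean -scalemxAr dotZl key /m mulrAC mulrA.
have ZE (x : Om) : dot (a *m (sampled x - sampling_mean)) b = \sum_t g (x t).
  rewrite mulmxBr -scaleN1r dotDl dotZl bilinear_sampled mE sumrB sumr_const card_ord.
  by rewrite mulN1r mulr_natl.
have var := sum_variance N g0.
have g2 : \sum_i g i ^+ 2 <= c ^+ 2 * q.
  have -> : \sum_i g i ^+ 2 = \sum_i h i ^+ 2 - (n * p)%:R * m ^+ 2.
    transitivity (\sum_i (h i ^+ 2 - 2 * m * h i + m ^+ 2)).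
      by apply: eq_bigr => i _; rewrite /g; ring.
    rewrite big_split sumrB /= sumr_const cI -mulr_sumr -[m ^+ 2 *+ _]mulr_natl.
    have -> : \sum_i h i = (n * p)%:R * m by rewrite /m mulrC divfK // gt_eqF.
    ring.
  rewrite lerBlDr -[leLHS]addr0; apply: lerD; last by rewrite mulr_ge0 ?sqr_ge0 ?ltW.
  rewrite /q /dot big_distrlr /= mulr_sumr -(pair_bigA _ (fun i j => (M i j * (a 0 i * b 0 j)) ^+ 2)) /=.
  apply: ler_sum => i _; rewrite mulr_sumr; apply: ler_sum => j _.
  have Mc2 : M i j ^+ 2 <= c ^+ 2.
    rewrite -(real_normK (num_real (M i j))) ler_sqr ?nnegrE //.
    exact: le_trans (Mc i j).
  have := ler_wpM2r (sqr_ge0 (a 0 i * b 0 j)) Mc2; rewrite -!expr2 -exprMn.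
  by rewrite [(a 0 i * _) ^+ 2]exprMn.
have := @count_markov _ (fun x : Om => (\sum_t g (x t)) ^+ 2) ((2 * u) ^+ 2 * q) B
  (fun x => sqr_ge0 _).
have hB x : x \in B -> (2 * u) ^+ 2 * q <= (\sum_t g (x t)) ^+ 2.
  by rewrite inE ZE => /ltW.
move=> /(_ hB) mk.
rewrite card_ffun card_ord natrX cI in var *.
have uq : 0 < 2 * u ^+ 2 * q by apply: mulr_gt0 => //; rewrite pmulr_rgt0 ?exprn_gt0.
rewrite -(ler_pM2r uq); apply: (@le_trans _ _ (\sum_(x : Om) (\sum_t g (x t)) ^+ 2)).
  by apply: le_trans mk; rewrite le_eqVlt; apply/orP; left; apply/eqP; ring.
rewrite -(ler_pM2l np0) var.
apply: (@le_trans _ _ (N%:R * (n * p)%:R ^+ N * (c ^+ 2 * q))).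
  by rewrite ler_wpM2l // mulr_ge0 ?exprn_ge0 ?ler0n.
rewrite ler_pdivrMr // in Nu.
have : 0 <= (n * p)%:R ^+ N * q by rewrite mulr_ge0 ?exprn_ge0 // ltW.
move=> /ler_wpM2l/(_ _ _ Nu); lra.
Qed.

Definition swap (e : Eps) (xy : Om * Om) : Om * Om :=
  ([ffun t => if e t then xy.2 t else xy.1 t],
   [ffun t => if e t then xy.1 t else xy.2 t]).

Lemma swapK e : involutive (swap e).
Proof.
by case=> x y; congr pair; apply/ffunP => t; rewrite !ffunE /=; case: (e t).
Qed.

Lemma sampled_swap e xy :
  sampled (swap e xy).1 - sampled (swap e xy).2 =
  signed_sampled e xy.1 - signed_sampled e xy.2.
Proof.
rewrite -!sumrB; apply: eq_bigr => t _; rewrite !ffunE /=.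
by case: (e t); rewrite ?expr0 ?expr1 ?mul1r // !mulN1r !scaleNr opprK addrC.
Qed.

Lemma largeD (A B : 'M[R]_(n, p)) u : 0 <= u ->
  large (A - B) (2 * u) -> large A u || large B u.
Proof.
move=> u0; apply: contraNT; rewrite negb_or !negbK => /andP[/asboolP hA /asboolP hB].
apply/asboolP; have -> : 2 * u = u + u by ring.
apply: opbdD => // x y; have := hB x y.
by rewrite mulmxN -scaleN1r dotZl mulN1r sqrrN.
Qed.

Lemma sum_bool_card (J : finType) (P : pred J) :
  \sum_x (P x)%:R = #|[set x | P x]|%:R :> R.
Proof.
rewrite -sum1_card natr_sum [RHS]big_mkcond; apply: eq_bigr => x _.
by rewrite inE; case: (P x).
Qed.

(** Symmetrization: the deviation of the sample is compared with that of an
   independent copy, and exchanging the two samples coordinatewise inserts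
   arbitrary signs. *)
Lemma symmetrization (c u tau : R) (G : {set Om}) :
  (0 < n)%N -> (0 < p)%N -> 0 < u -> 0 <= tau ->
  (forall i j, `|M i j| <= c) -> N%:R * c ^+ 2 / (n * p)%:R <= 2 * u ^+ 2 ->
  (forall x, x \in G ->
     #|[set e | large (signed_sampled e x) u]|%:R <= tau * 2 ^+ N) ->
  #|[set x | large (sampled x - sampling_mean) (4 * u)]|%:R <=
  4 * (#|~: G|%:R + tau * #|Om|%:R) :> R.
Proof.
move=> n0 p0 u0 tau0 Mc Nu hG.
set Bad := [set x | _].
set T := \sum_x \sum_y (large (sampled x - sampled y) (2 * u))%:R : R.
have om0 : 0 < #|Om|%:R :> R.
  rewrite card_ffun card_prod !card_ord natrX exprn_gt0 // ltr0n muln_gt0 n0 //.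
have lower : #|Bad|%:R * (#|Om|%:R / 2) <= T.
  apply: count_markov => [x|x]; first by apply: sumr_ge0.
  rewrite inE => /asboolPn h.
  (* if [y] deviates by at most [2 * u] in the direction in which [x] deviates
     by [4 * u], then the two differ by more than [2 * u] *)
  have [a [b hab]] : exists a b, (4 * u) ^+ 2 * (dot a a * dot b b) <
      dot (a *m (sampled x - sampling_mean)) b ^+ 2.
    apply: contrapT => hn; apply: h => a b; rewrite leNgt; apply/negP => lt.
    by apply: hn; exists a, b.
  set q := dot a a * dot b b in hab.
  have q0 : 0 < q.
    rewrite lt_def mulr_ge0 ?dot_ge0 // andbT; apply/negP => /eqP q0.
    move: hab; rewrite q0 mulr0 ltNge => /negP; apply.
    have d0 (m : nat) (z : 'rV[R]_m) : dot 0 z = 0.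
      by rewrite /dot big1 // => i _; rewrite mxE mul0r.
    by move/eqP: q0; rewrite mulf_eq0 !dot_eq0 => /orP[] /eqP ->;
      rewrite ?mul0mx ?d0 ?[dot _ 0]dotC ?d0 expr0n.
  have half := half_concentrated n0 p0 u0 Mc Nu q0.
  set C := [set y | _] in half.
  have -> : #|Om|%:R / 2 = #|Om|%:R - #|Om|%:R / 2 :> R by field.
  apply: (@le_trans _ _ (#|~: C|%:R : R)).
    rewrite -(cardsC C) natrD; move: half; rewrite -(cardsC C) natrD; lra.
  rewrite sum_bool_card ler_nat subset_leq_card //; apply/fintype.subsetP => y.
  rewrite !inE -leNgt => hy; apply/asboolPn => hxy; have := hxy a b.
  have -> : sampled x - sampled y = (sampled x - sampling_mean) - (sampled y - sampling_mean).
    by rewrite opprB addrA subrK.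
  rewrite mulmxBr -[_ - _ *m _]addrC -scaleN1r dotDl dotZl mulN1r -/q.
  move: hab hy; set X := dot (a *m (sampled x - _)) b; set Y := dot _ b => hX hY.
  rewrite leNgt => /negP; apply.
  rewrite -/q in hY; have := sqr_ge0 (X - Y - Y); lra.
(* the exchange of the coordinates marked by [e] is a bijection on pairs *)
have upper e : T <= 2 * #|Om|%:R *
    #|[set x | large (signed_sampled e x) u]|%:R.
  rewrite /T pair_bigA /= (reindex_inj (inv_inj (swapK e))) /=.
  apply: (@le_trans _ _ (\sum_(xy : Om * Om) ((large (signed_sampled e xy.1) u)%:R
      + (large (signed_sampled e xy.2) u)%:R))).
    apply: ler_sum => xy _; rewrite sampled_swap -natrD ler_nat.
    have := @largeD (signed_sampled e xy.1) (signed_sampled e xy.2) u (ltW u0).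
    case: (large _ (2 * u)) => // /(_ isT).
    by case: (large (signed_sampled e xy.1) u); case: (large (signed_sampled e xy.2) u).
  rewrite big_split /= -(pair_bigA _ (fun x y : Om => (large (signed_sampled e x) u)%:R)) /=.
  rewrite -(pair_bigA _ (fun x y : Om => (large (signed_sampled e y) u)%:R)) /=.
  rewrite [X in X + _]exchange_big /= !sumr_const !sum_bool_card.
  by rewrite -mulrA [_%:R * #|[set _ | _]|%:R]mulr_natl [leRHS]mulr_natl mulr2n.
have total : 2 ^+ N * T <= 2 * #|Om|%:R * (2 ^+ N * (#|~: G|%:R + tau * #|Om|%:R)).
  have cE : #|{: Eps}|%:R = 2 ^+ N :> R by rewrite card_ffun card_bool card_ord natrX.
  have -> : 2 ^+ N * T = \sum_(e : Eps) T by rewrite sumr_const -[RHS]mulr_natl cE.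
  apply: le_trans (ler_sum _ (fun e _ => upper e)) _.
  rewrite -mulr_sumr ler_wpM2l ?mulr_ge0 ?ler0n //.
  under eq_bigr do rewrite -sum_bool_card.
  rewrite exchange_big /= (bigID (mem G)) /= mulrDr addrC; apply: lerD.
    rewrite -sum1_card natr_sum mulr_sumr.
    rewrite [leRHS](eq_bigl (fun x => x \notin G)) => [|x]; last by rewrite inE.
    by apply: ler_sum => x _; rewrite mulr1 -cE sum_bool_card ler_nat max_card.
  apply: (@le_trans _ _ (\sum_(x in G) tau * 2 ^+ N)).
    by apply: ler_sum => x xG; rewrite sum_bool_card hG.
  rewrite sumr_const -[leLHS]mulr_natl mulrC [leRHS]mulrA [2 ^+ N * _]mulrC.
  by apply: ler_wpM2l; rewrite ?mulr_ge0 ?exprn_ge0 // ler_nat max_card.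
have N0 : 0 < 2 ^+ N :> R by rewrite exprn_gt0.
have h : T <= 2 * #|Om|%:R * (#|~: G|%:R + tau * #|Om|%:R).
  by rewrite -(ler_pM2l N0); apply: le_trans total _; rewrite mulrCA.
have := le_trans lower h; rewrite -(ler_pM2r om0 _ (4 * _)); lra.
Qed.

End Symmetrization.
End UniformSamples.

(** * Joint law of the positions and the noise *)

Section FiniteValued.
Context d (T : measurableType d) (R : realType) (P : probability T R).

Lemma finite_valued_seq (J : finType) (f : T -> J) (s : seq J) : uniq s ->
  (forall j, measurable (f @^-1` [set j])) ->
  measurable [set w | f w \in s] /\
  (P [set w | f w \in s] = \sum_(j <- s) P (f @^-1` [set j]))%E.
Proof.
move=> + mf; elim: s => [_|j s ih /= /andP[js us]].
  have -> : [set w | f w \in [::]] = set0 by rewrite predeqE => w; split.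
  by rewrite big_nil measure0.
have [ms Ps] := ih us.
have -> : [set w | f w \in j :: s] = f @^-1` [set j] `|` [set w | f w \in s].
  rewrite predeqE => w /=; rewrite inE; split.
    by move=> /orP[/eqP|]; [left|right].
  by move=> [->|->]; rewrite ?eqxx ?orbT.
split; first exact: measurableU.
have dis : f @^-1` [set j] `&` [set w | f w \in s] = set0.
  by rewrite predeqE => w; split=> // -[/= ->]; apply/negP.
by rewrite measureU // big_cons -Ps.
Qed.

(** Events about a variable with finitely many values are finite unions of its
   fibers, so that only the measurability of the latter has to be known. *)
Lemma finite_valued (J : finType) (f : T -> J) (S : {set J}) :
  (forall j, measurable (f @^-1` [set j])) ->
  measurable [set w | f w \in S] /\
  (P [set w | f w \in S] = \sum_(j in S) P (f @^-1` [set j]))%E.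
Proof.
move=> mf; have := finite_valued_seq (enum_uniq S) mf.
have -> : [set w | f w \in enum S] = [set w | f w \in S].
  by rewrite predeqE => w /=; rewrite mem_enum.
by rewrite big_enum.
Qed.

End FiniteValued.

Section Sample.
Context (R : realType) d (T : measurableType d) (P : probability T R).
Variables (n p N : nat) (M : 'M[R]_(n, p)) (sigma : R).
Variables (X : 'I_N -> T -> 'M[R]_(n, p)) (xi : 'I_N -> {RV P >-> R}).
Variable y : 'I_N -> T -> R.
Hypothesis sample : completion_sample M sigma X xi y.
Local Notation I := ('I_n * 'I_p)%type.

Lemma delta_mx_inj (i : I) (j : I) :
  delta_mx i.1 i.2 = delta_mx j.1 j.2 :> 'M[R]_(n, p) -> i = j.
Proof.
move=> /matrixP/(_ i.1 i.2); rewrite !mxE !eqxx /=.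
case: i j => [i1 i2] [j1 j2] /=.
case: eqVneq => [->|_ /eqP]; last by rewrite oner_eq0.
by case: eqVneq => [->|_ /eqP] //; rewrite oner_eq0.
Qed.

Lemma exists_position : exists pos : 'I_N -> T -> I,
  forall t w, X t w = delta_mx (pos t w).1 (pos t w).2.
Proof.
case: sample => hX _ _ _ _.
have h (tw : 'I_N * T) : exists i : I, X tw.1 tw.2 = delta_mx i.1 i.2.
  have [i [j ->]] := hX tw.1 tw.2; exists (i, j).
  by rewrite trmx_delta mul_delta_mx.
have [f hf] := choice h; exists (fun t w => f (t, w)) => t w.
exact: (hf (t, w)).
Qed.

Variable pos : 'I_N -> T -> I.
Hypothesis posE : forall t w, X t w = delta_mx (pos t w).1 (pos t w).2.

Lemma pos_preimage t (i : I) :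
  pos t @^-1` [set i] = X t @^-1` [set delta_mx i.1 i.2].
Proof.
rewrite predeqE => w /=; rewrite posE; split=> [->//|]; exact: delta_mx_inj.
Qed.

Lemma sampling_basis_delta (i : I) : sampling_basis (delta_mx i.1 i.2 : 'M[R]_(n, p)).
Proof. by exists i.1, i.2; rewrite trmx_delta mul_delta_mx. Qed.

Lemma measurable_pos t (i : I) : measurable (pos t @^-1` [set i]).
Proof.
case: sample => _ hX _ _ _; rewrite pos_preimage.
by have [] := hX t _ (sampling_basis_delta i).
Qed.

Definition gauss (B : set R) : R := fine (normal_prob 0 sigma B).

Lemma gaussE B : measurable B -> (gauss B)%:E = normal_prob 0 sigma B.
Proof. by move=> mB; rewrite /gauss fineK // fin_num_measure. Qed.

(** Mutual independence, applied to the preimages of single basis matrices and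
   of Borel sets. *)
Lemma joint_law (x : {ffun 'I_N -> I}) (B : 'I_N -> set R) :
  (forall t, measurable (B t)) ->
  (P [set w | forall t, pos t w = x t /\ B t (xi t w)] =
   (\prod_t ((n * p)%:R^-1 * gauss (B t)))%:E)%E.
Proof.
move=> mB; case: sample => _ hX hxi hind _.
pose A (k : 'I_N + 'I_N) : set T := match k with
  | inl t => X t @^-1` [set delta_mx (x t).1 (x t).2]
  | inr t => xi t @^-1` B t end.
have := hind [set: 'I_N + 'I_N]%SET A.
have hA k : k \in [set: 'I_N + 'I_N]%SET -> generated_events X xi k (A k).
  by case: k => t _ /=; [exists [set delta_mx (x t).1 (x t).2] | exists (B t)].
move=> /(_ hA); rewrite (_ : \bigcap_(i in _) A i = [set w | forall t, pos t w = x t /\ B t (xi t w)]); last first.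
  rewrite predeqE => w; split=> [h t|h [] t _ /=].
  - split; last by apply: (h (inr t)); rewrite /= inE.
    have e : (pos t @^-1` [set x t]) w.
      by rewrite pos_preimage; apply: (h (inl t)); rewrite /= inE.
    exact: e.
  - have e : (pos t @^-1` [set x t]) w by have [] := h t.
    by rewrite pos_preimage in e; exact: e.
  - by have [] := h t.
move=> ->; rewrite big_sumType /= !(eq_bigl _ _ (fun i => finset.in_setT _)) -big_split /= -prodEFin; apply: eq_bigr => t _.
by rewrite EFinM gaussE // hxi //; have [_ ->] := hX t _ (sampling_basis_delta (x t)).
Qed.

End Sample.

(** * Exponential moments of the squared noise *)

Section GaussianLevels.
Context (R : realType) (sigma : R).
Hypothesis sigma0 : 0 < sigma.
Local Notation mu := (@lebesgue_measure R).

(** The exponential factor doubles the variance in the exponent of the density;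
   the square root of 2 is the ratio of the two normalizing constants. *)
Lemma gaussian_square_mgf :
  (\int[mu]_x (expR (x ^+ 2 / (4 * sigma ^+ 2)) * normal_pdf 0 sigma x)%:E =
   (Num.sqrt 2)%:E)%E.
Proof.
have s2 : 0 < Num.sqrt 2 :> R by rewrite sqrtr_gt0.
have s0 : sigma != 0 by rewrite gt_eqF.
have ss0 : Num.sqrt 2 * sigma != 0 by rewrite mulf_neq0 // gt_eqF.
transitivity (\int[mu]_x ((Num.sqrt 2)%:E * (normal_pdf 0 (Num.sqrt 2 * sigma) x)%:E))%E; last first.
  rewrite ge0_integralZl //.
  - by rewrite integral_normal_pdf mule1.
  - by apply/measurable_EFinP; exact: measurable_normal_pdf.
  - by move=> x _; rewrite lee_fin normal_pdf_ge0.
apply: eq_integral => x _; rewrite -EFinM; congr (_%:E).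
rewrite !normal_pdfE // /normal_peak /normal_fun subr0 exprMn sqr_sqrtr //.
have -> : 2 * sigma ^+ 2 * pi *+ 2 = 2 * (sigma ^+ 2 * pi *+ 2) by rewrite mulrnAr mulrA.
rewrite [in RHS]sqrtrM // (invfM (Num.sqrt 2)) -[in RHS]mulrA mulVKf ?gt_eqF // mulrCA; congr (_ * _).
rewrite -expRD; congr expR; field.
by rewrite s0.
Qed.

(** The step function [g \o lev] lies below [f], so the same holds for their
   Gaussian means; the mean of the step function is a finite sum. *)
Lemma weighted_levels (L : finType) (lev : R -> L) (g : L -> R) (f : R -> R) :
  (forall l, measurable (lev @^-1` [set l])) -> (forall l, 0 <= g l) ->
  measurable_fun setT f -> (forall x, g (lev x) <= f x) ->
  ((\sum_l g l * gauss sigma (lev @^-1` [set l]))%:E <=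
   \int[mu]_x (f x * normal_pdf 0 sigma x)%:E)%E.
Proof.
move=> ml g0 mf gf.
have mfp : measurable_fun setT (fun x => (f x * normal_pdf 0 sigma x)%:E).
  by apply/measurable_EFinP; apply: measurable_funM => //; exact: measurable_normal_pdf.
have tl : trivIset [set` enum L] (fun l => lev @^-1` [set l]).
  by move=> i j _ _ [x [/= <- <-]].
have cover : \big[setU/set0]_(l <- enum L) (lev @^-1` [set l]) = setT.
  rewrite predeqE => x; split => // _; rewrite -bigcup_seq; exists (lev x) => //=.
  by rewrite mem_enum.
rewrite -cover ge0_integral_bigsetU //; first last.
- by move=> x _; rewrite lee_fin mulr_ge0 ?normal_pdf_ge0 // (le_trans (g0 (lev x))).
- by rewrite cover.
- exact: enum_uniq.
rewrite big_enum /= -sumEFin; apply: lee_sum => l _.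
rewrite EFinM gaussE // /normal_prob -ge0_integralZl //; first last.
- by rewrite lee_fin.
- by move=> x _; rewrite lee_fin normal_pdf_ge0.
- by apply/measurable_EFinP; apply: measurable_funTS; exact: measurable_normal_pdf.
  exact: ml.
apply: ge0_le_integral => //.
- exact: ml.
- by move=> x _; rewrite -EFinM lee_fin mulr_ge0 ?normal_pdf_ge0.
- apply: measurable_funTS; apply/measurable_EFinP; apply: measurable_funM => //.
  exact: measurable_normal_pdf.
- exact: (measurable_funTS mfp).
- move=> x /= <-; rewrite -EFinM lee_fin ler_wpM2r ?normal_pdf_ge0 //.
Qed.

(** The squared noise in units of [4 * sigma ^+ 2], rounded down and truncated.
   With finitely many levels the relevant part of the sample becomes a discrete
   random variable, whose exponential moments are finite sums. *)
Definition level Q (z : R) : 'I_Q.+1 := inord (minn (Num.truncn (z ^+ 2 / (4 * sigma ^+ 2))) Q).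

Lemma levelE Q z : level Q z = minn (Num.truncn (z ^+ 2 / (4 * sigma ^+ 2))) Q :> nat.
Proof. by rewrite /level inordK // ltnS geq_minr. Qed.

Lemma measurable_level Q l : measurable (@level Q @^-1` [set l]).
Proof.
pose f (z : R) := z ^+ 2 / (4 * sigma ^+ 2).
have f0 z : 0 <= f z by rewrite divr_ge0 ?sqr_ge0 // mulr_ge0 ?sqr_ge0.
have mf : measurable_fun setT f by apply: measurable_funM => //; exact: measurable_funX.
have -> : @level Q @^-1` [set l] =
    \bigcup_(k in [set k : nat | minn k Q = l]) (f @^-1` `[k%:R, k.+1%:R[).
  rewrite predeqE => z; split => [/(congr1 val) /=|[k /= kl]].
    rewrite levelE => h; exists (Num.truncn (f z)) => //=.
    by rewrite in_itv /= truncn_itv.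
  rewrite in_itv /= => /truncn_def kE; apply: val_inj => /=.
  by rewrite levelE -/(f z) kE.
apply: bigcup_measurable => k _; rewrite -[X in measurable X]setTI; exact: mf.
Qed.

Definition mgf_bound : R := expR 2 * Num.sqrt 2.

(** The summand 2 makes up for the rounding and counts the observation. *)
Lemma level_mgf Q :
  \sum_(l < Q.+1) expR (2 + l%:R) * gauss sigma (@level Q @^-1` [set l]) <= mgf_bound.
Proof.
rewrite /mgf_bound -lee_fin.
under eq_bigr => l _ do rewrite expRD -mulrA.
rewrite -mulr_sumr lee_fin ler_wpM2l ?expR_ge0 // -lee_fin -gaussian_square_mgf.
apply: (@weighted_levels _ (@level Q) (fun l => expR l%:R)).
- exact: measurable_level.
- by move=> l; rewrite expR_ge0.
- apply: measurableT_comp => //; apply: measurable_funM => //; exact: measurable_funX.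
- move=> x; rewrite ler_expR levelE; apply: (@le_trans _ _ (Num.truncn (x ^+ 2 / (4 * sigma ^+ 2)))%:R).
    by rewrite ler_nat geq_minl.
  by rewrite truncn_le divr_ge0 ?sqr_ge0 // mulr_ge0 ?sqr_ge0.
Qed.

Lemma level_total Q :
  \sum_(l < Q.+1) gauss sigma (@level Q @^-1` [set l]) <= 1.
Proof.
rewrite -lee_fin.
have -> : (1%:E = \int[mu]_x (cst 1 x * normal_pdf 0 sigma x)%:E)%E.
  by under eq_integral do rewrite mul1r; rewrite integral_normal_pdf.
under eq_bigr => l _ do rewrite -[gauss _ _]mul1r.
apply: (@weighted_levels _ (@level Q) (fun=> 1)) => //; exact: measurable_level.
Qed.

End GaussianLevels.

(** * Occupancy of the rows and columns *)

Section UnionBound.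
Context d (T : measurableType d) (R : realType) (P : probability T R).

Lemma union_bound (J : eqType) (s : seq J) (E : J -> set T) :
  (forall j, measurable (E j)) ->
  measurable [set w | exists2 j, j \in s & E j w] /\
  (P [set w | exists2 j, j \in s & E j w] <= \sum_(j <- s) P (E j))%E.
Proof.
move=> mE; elim: s => [|j s [ms Ps]].
  have -> : [set w | exists2 j, j \in [::] & E j w] = set0.
    by rewrite predeqE => w; split=> // -[].
  by rewrite big_nil measure0.
have -> : [set w | exists2 i, i \in j :: s & E i w] =
    E j `|` [set w | exists2 i, i \in s & E i w].
  rewrite predeqE => w; split=> [[k]|[Ej|[i si Ei]]].
  - by rewrite inE => /orP[/eqP -> ?|sk Ek]; [left|right; exists k].
  - by exists j => //; rewrite inE eqxx.
  - by exists i => //; rewrite inE si orbT.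
split; first exact: measurableU.
rewrite big_cons; apply: le_trans (leeD2l _ Ps).
exact: measureU2.
Qed.

End UnionBound.

Section Chernoff.
Context (R : realType) d (T : measurableType d) (P : probability T R).
Variables (n p N : nat) (M : 'M[R]_(n, p)) (sigma : R).
Variables (X : 'I_N -> T -> 'M[R]_(n, p)) (xi : 'I_N -> {RV P >-> R}).
Variable y : 'I_N -> T -> R.
Hypothesis sample : completion_sample M sigma X xi y.
Hypothesis sigma0 : 0 < sigma.
Local Notation I := ('I_n * 'I_p)%type.
Variable pos : 'I_N -> T -> I.
Hypothesis posE : forall t w, X t w = delta_mx (pos t w).1 (pos t w).2.

Lemma configuration_fiber (L : finType) (lev : R -> L) (c : {ffun 'I_N -> I * L}) :
  (fun w => [ffun t => (pos t w, lev (xi t w))]) @^-1` [set c] =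
  [set w | forall t, pos t w = [ffun t => (c t).1] t /\
     (lev @^-1` [set (c t).2]) (xi t w)].
Proof.
rewrite predeqE => w; split=> [/= <- t|/= h]; first by rewrite !ffunE.
by apply/ffunP => t; rewrite ffunE; have := h t; rewrite ffunE => -[-> ->]; case: (c t).
Qed.

Lemma measurable_positions_levels (x : {ffun 'I_N -> I}) (B : 'I_N -> set R) :
  (forall t, measurable (B t)) ->
  measurable [set w | forall t, pos t w = x t /\ B t (xi t w)].
Proof.
move=> mB.
have -> : [set w | forall t, pos t w = x t /\ B t (xi t w)] =
    \bigcap_(t in [set: 'I_N]) ((pos t @^-1` [set x t]) `&` (xi t @^-1` B t)).
  by rewrite predeqE => w; split=> [h t _|h t]; [exact: h|have := h t Logic.I].
apply: fin_bigcap_measurable => // t _; apply: measurableI.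
  exact: (measurable_pos sample posE).
by rewrite -[X in measurable X]setTI; exact: measurable_funP.
Qed.

Lemma configuration_law (L : finType) (lev : R -> L) (S : {set {ffun 'I_N -> I * L}}) :
  (forall l, measurable (lev @^-1` [set l])) ->
  measurable [set w | [ffun t => (pos t w, lev (xi t w))] \in S] /\
  (P [set w | [ffun t => (pos t w, lev (xi t w))] \in S] =
   (\sum_(c in S) \prod_t ((n * p)%:R^-1 * gauss sigma (lev @^-1` [set (c t).2])))%:E)%E.
Proof.
move=> ml.
have mf c : measurable ((fun w => [ffun t => (pos t w, lev (xi t w))]) @^-1` [set c]).
  by rewrite configuration_fiber; apply: (@measurable_positions_levels _ (fun t => lev @^-1` [set (c t).2])).
have [mS PS] := finite_valued P S mf; split => //.
rewrite PS -sumEFin; apply: eq_bigr => c _.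
by rewrite configuration_fiber (joint_law sample posE _ (fun t => ml (c t).2)).
Qed.

(** The exponential of the sum is a product over the independent observations,
   so its mean is a power of the exponential moment of a single one. *)
Lemma chernoff (L : finType) (lev : R -> L) (h : I * L -> R) v :
  (forall l, measurable (lev @^-1` [set l])) ->
  measurable [set w | v <= \sum_t h (pos t w, lev (xi t w))] /\
  (P [set w | v <= \sum_t h (pos t w, lev (xi t w))]%R <=
   (expR (- v) * (\sum_(il : I * L) (n * p)%:R^-1 *
     gauss sigma (lev @^-1` [set il.2]) * expR (h il)) ^+ N)%:E)%E.
Proof.
move=> ml.
have := configuration_law [set c : {ffun 'I_N -> I * L} | v <= \sum_t h (c t)]%SET ml.
have -> : [set w | [ffun t => (pos t w, lev (xi t w))] \in
    [set c : {ffun 'I_N -> I * L} | v <= \sum_t h (c t)]%SET] =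
    [set w | v <= \sum_t h (pos t w, lev (xi t w))].
  rewrite predeqE => w /=; rewrite inE; under eq_bigr do rewrite ffunE.
  by [].
move=> [mS ->]; split => //; rewrite lee_fin.
have g0 (B : set R) : 0 <= gauss sigma B by rewrite /gauss fine_ge0.
have np0 : 0 <= (n * p)%:R^-1 :> R by rewrite invr_ge0.
have -> : (\sum_(il : I * L) (n * p)%:R^-1 *
     gauss sigma (lev @^-1` [set il.2]) * expR (h il)) ^+ N =
  \sum_(c : {ffun 'I_N -> I * L}) \prod_t ((n * p)%:R^-1 *
     gauss sigma (lev @^-1` [set (c t).2]) * expR (h (c t))).
  have := @bigA_distr_bigA R 0 1 *%R +%R 'I_N (I * L)%type (fun t il => (n * p)%:R^-1 *
     gauss sigma (lev @^-1` [set il.2]) * expR (h il)).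
  by rewrite prodr_const card_ord.
rewrite mulr_sumr big_mkcond; apply: ler_sum => c _.
have pi0 : 0 <= \prod_t ((n * p)%:R^-1 * gauss sigma (lev @^-1` [set (c t).2])).
  by apply: prodr_ge0 => t _; rewrite mulr_ge0.
rewrite [X in _ <= expR _ * X]big_split /= -expR_sum mulrCA -expRD.
rewrite inE; case: ifP => vc; last by rewrite mulr_ge0 ?expR_ge0.
rewrite -[leLHS]mulr1 ler_wpM2l // -expR0 ler_expR addrC subr_ge0 //.
Qed.

Definition hit (j : 'I_n + 'I_p) (i : I) : bool :=
  match j with inl a => i.1 == a | inr b => i.2 == b end.

Local Notation m := (minn n p)%:R.
Local Notation K := (mgf_bound R).

(** A given row or column is hit by each observation with probability at most
   [1 / m], so that it receives about [N / m] of them, each of weight 1 plus its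
   squared noise; the factor is what Chernoff's bound with exponent 1 asks for. *)
Definition occupancy : R := (K + 1) * (N%:R / m).

(** The level at which the noise is truncated exceeds [occupancy], so that a
   truncated observation suffices to make a row or a column overloaded. *)
Definition overloaded (j : 'I_n + 'I_p) : set T :=
  [set w | occupancy <= \sum_t (if hit j (pos t w)
     then 2 + (level sigma (Num.truncn occupancy).+1 (xi t w))%:R else 0)].

Lemma card_hit j : (#|[pred i | hit j i]| * minn n p <= n * p)%N.
Proof.
case: j => [a|b] /=.
  have -> : #|[pred i : I | i.1 == a]| = #|finset.setX [set a]%SET [set: 'I_p]%SET|.
    by apply: eq_card => i; rewrite !inE andbT.
  by rewrite cardsX cards1 cardsT card_ord mul1n mulnC leq_mul2r geq_minl orbT.
have -> : #|[pred i : I | i.2 == b]| = #|finset.setX [set: 'I_n]%SET [set b]%SET|.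
  by apply: eq_card => i; rewrite !inE.
by rewrite cardsX cards1 cardsT card_ord muln1 leq_mul2l geq_minr orbT.
Qed.

Lemma overloaded_prob j : (0 < n)%N -> (0 < p)%N ->
  measurable (overloaded j) /\
  (P (overloaded j) <= (expR (- (N%:R / m)))%:E)%E.
Proof.
move=> n0 p0; set Q := (Num.truncn occupancy).+1.
have m0 : 0 < m :> R by rewrite ltr0n leq_min n0.
have np0 : 0 < (n * p)%:R :> R by rewrite ltr0n muln_gt0 n0.
have K0 : 0 <= K by rewrite mulr_ge0 ?expR_ge0.
pose h (il : I * 'I_Q.+1) : R := if hit j il.1 then 2 + (il.2)%:R else 0.
have [mE PE] := chernoff h occupancy (@measurable_level R sigma Q).
split => //; apply: le_trans PE _; rewrite lee_fin.
set S := \sum_il _.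
have S0 : 0 <= S.
  apply: sumr_ge0 => il _; rewrite !mulr_ge0 ?expR_ge0 ?invr_ge0 //.
  by rewrite /gauss fine_ge0.
have S1 : S <= expR (K / m).
  apply: le_trans (expR_ge1Dx _).
  rewrite /S -(pair_bigA _ (fun i l => (n * p)%:R^-1 *
     gauss sigma (level sigma Q @^-1` [set l]) * expR (h (i, l)))) /=.
  apply: (@le_trans _ _ (\sum_(i : I) (n * p)%:R^-1 * (if hit j i then 1 + K else 1))).
    apply: ler_sum => i _; rewrite /h /=.
    under eq_bigr do rewrite -mulrA.
    rewrite -mulr_sumr ler_wpM2l ?invr_ge0 //; case: ifP => _.
      apply: le_trans (_ : K <= _); last by rewrite lerDr.
      by under eq_bigr do rewrite mulrC; exact: level_mgf.
    by under eq_bigr do rewrite expR0 mulr1; exact: level_total.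
  rewrite -mulr_sumr.
  have -> : \sum_(i : I) (if hit j i then 1 + K else 1) =
      (n * p)%:R + K * #|[pred i | hit j i]|%:R.
    transitivity (\sum_(i : I) (1 + K * (hit j i)%:R)).
      by apply: eq_bigr => i _; case: ifP; rewrite ?mulr1 ?mulr0 ?addr0.
    rewrite big_split /= sumr_const card_prod !card_ord -mulr_sumr; congr (_ + _ * _).
    rewrite -sum1_card natr_sum [RHS]big_mkcond; apply: eq_bigr => i _.
    by rewrite inE; case: (hit j i).
  rewrite mulrDr mulVf ?gt_eqF // lerD2l mulrC -mulrA ler_wpM2l //.
  rewrite ler_pdivrMr // mulrC ler_pdivlMr // -natrM ler_nat.
  exact: card_hit.
apply: (@le_trans _ _ (expR (- occupancy) * expR (K / m) ^+ N)).
  by rewrite ler_wpM2l ?expR_ge0 // lerXn2r // nnegrE expR_ge0.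
rewrite -expRM_natl -expRD ler_expR /occupancy le_eqVlt; apply/orP; left; apply/eqP.
by field; rewrite gt_eqF.
Qed.

(** As long as [j] is not overloaded no observation in it reaches the truncation,
   and the levels bound the squares from above up to the rounding. *)
Lemma not_overloaded j w : ~ overloaded j w ->
  \sum_(t | hit j (pos t w)) (1 + xi t w ^+ 2 / (4 * sigma ^+ 2)) <= occupancy.
Proof.
move=> /negP; rewrite -ltNge => lt; apply: le_trans (ltW lt).
rewrite big_mkcond; apply: ler_sum => t _; case: ifP => // ht.
set f := _ / _; have f0 : 0 <= f by rewrite divr_ge0 ?sqr_ge0 // mulr_ge0 ?sqr_ge0.
set Q := (Num.truncn occupancy).+1 in lt *.
have levt : (level sigma Q (xi t w))%:R < Q%:R :> R.
  apply: (@lt_trans _ _ occupancy); last exact: truncnS_gt.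
  apply: le_lt_trans lt; rewrite (bigD1 t) //= ht.
  apply: (@le_trans _ _ (2 + (level sigma Q (xi t w))%:R)); first by rewrite lerDr.
  by rewrite lerDl; apply: sumr_ge0 => s _; case: ifP.
rewrite ltr_nat levelE -/f in levt *.
have -> : minn (Num.truncn f) Q = Num.truncn f.
  by apply/minn_idPl; move: levt; rewrite gtn_min ltnn orbF => /ltnW.
by have /ltW := truncnS_gt f; rewrite -natr1; lra.
Qed.

Definition some_overloaded : set T :=
  [set w | exists2 j, j \in index_enum ('I_n + 'I_p)%type & overloaded j w].

Lemma some_overloaded_prob : (0 < n)%N -> (0 < p)%N ->
  measurable some_overloaded /\
  (P some_overloaded <= ((n + p)%:R * expR (- (N%:R / m)))%:E)%E.
Proof.
move=> n0 p0; have mE j := (overloaded_prob j n0 p0).1.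
have [mU PU] := union_bound P (index_enum ('I_n + 'I_p)%type) mE; split => //.
apply: le_trans PU _.
apply: (@le_trans _ _ (\sum_(j : 'I_n + 'I_p) (expR (- (N%:R / m)))%:E)%E).
  by apply: lee_sum => j _; have [] := overloaded_prob j n0 p0.
by rewrite sumEFin lee_fin sumr_const card_sum !card_ord -[leLHS]mulr_natl.
Qed.

End Chernoff.

(** * Sign symmetry of the noise *)

Section SignSymmetry.
Context (R : realType).

Lemma gauss_symmetric sigma (B : set R) : 0 < sigma -> measurable B ->
  gauss sigma (-%R @^-1` B) = gauss sigma B.
Proof.
move=> s0 mB; congr fine; rewrite /normal_prob.
have mpdf : measurable_fun setT (fun x : R => (normal_pdf 0 sigma x)%:E).
  by apply/measurable_EFinP; exact: measurable_normal_pdf.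
transitivity (\int[lebesgue_measure]_(x in (-%R : _ -> measurableTypeR R) @^-1` B)
   ((fun x : R => (normal_pdf 0 sigma x)%:E) \o (-%R : _ -> measurableTypeR R)) x)%E.
  apply: eq_integral => x _ /=; congr (_%:E).
  by rewrite !normal_pdfE ?gt_eqF // /normal_fun !subr0 sqrrN.
rewrite -ge0_integral_pushforward //=.
- by apply: eq_measure_integral => //= A mA AS; exact: lebesgue_measureN.
- exact: measurable_funS mpdf.
- by move=> x _; rewrite lee_fin normal_pdf_ge0.
Qed.

Definition signs N (e : {ffun 'I_N -> bool}) (z : N.-tuple R) : N.-tuple R :=
  [tuple (-1) ^+ e t * tnth z t | t < N].

(** Rectangles are stable under intersection, as the induction on Dynkin systems
   requires of a generating family. *)
Lemma tuple_rectangles N :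
  @measurable _ (N.-tuple R) =
  <<s [set A | exists2 B : 'I_N -> set R, (forall t, measurable (B t)) &
        A = [set z | forall t, B t (tnth z t)]] >>.
Proof.
apply/seteqP; split.
  apply: smallest_sub; first exact: smallest_sigma_algebra.
  rewrite -bigcup_seq => A [t _ [B mB <-]]; apply: sub_sigma_algebra.
  exists (fun s => if s == t then B else setT).
    by move=> s; case: ifP.
  rewrite setTI predeqE => z; split=> [Bz s|/(_ t)]; last by rewrite eqxx.
  by case: eqP => [->|].
apply: smallest_sub; first exact: sigma_algebra_measurable.
move=> A [B mB ->].
have -> : [set z : N.-tuple R | forall t, B t (tnth z t)] =
    \bigcap_(t in [set: 'I_N]) ((@tnth _ R ^~ t) @^-1` B t).
  by rewrite predeqE => z; split=> [h t _|h t]; [exact: h|exact: (h t Logic.I)].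
apply: fin_bigcap_measurable => // t _; rewrite -[X in measurable X]setTI.
exact: measurable_tnth.
Qed.

End SignSymmetry.

Section SignFlip.
Context (R : realType) d (T : measurableType d) (P : probability T R).
Variables (n p N : nat) (M : 'M[R]_(n, p)) (sigma : R).
Variables (X : 'I_N -> T -> 'M[R]_(n, p)) (xi : 'I_N -> {RV P >-> R}).
Variable y : 'I_N -> T -> R.
Hypothesis sample : completion_sample M sigma X xi y.
Local Notation I := ('I_n * 'I_p)%type.
Variable pos : 'I_N -> T -> I.
Hypothesis posE : forall t w, X t w = delta_mx (pos t w).1 (pos t w).2.

Definition noise (w : T) : N.-tuple R := [tuple xi t w | t < N].

Lemma measurable_signed_noise e : measurable_fun setT (signs e \o noise).
Proof.
apply/measurable_fun_tnthP => t.
have -> : @tnth N R ^~ t \o (signs e \o noise) = fun w => (-1) ^+ e t * xi t w.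
  by apply/funext => w /=; rewrite !tnth_mktuple.
by apply: measurable_funM => //; exact: measurable_funP.
Qed.

Definition at_positions (x : {ffun 'I_N -> I}) : set T :=
  [set w | forall t, pos t w = x t].

Lemma measurable_at_positions x : measurable (at_positions x).
Proof.
have := measurable_positions_levels sample posE x (fun t => @measurableT _ R).
by congr measurable; rewrite predeqE => w; split=> [h t|h t]; [have [] := h t|split].
Qed.

(** Given the sampled positions, the law of the noise is invariant under sign
   changes: both laws agree on rectangles, hence on all Borel sets. *)
Lemma sign_flip x e (A : set (N.-tuple R)) : 0 < sigma -> measurable A ->
  P ((signs e \o noise) @^-1` A `&` at_positions x) =
  P (noise @^-1` A `&` at_positions x).
Proof.
move=> sigma0 mA; have mx := measurable_at_positions x.
have noise0 : noise = signs [ffun=> false] \o noise.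
  apply/funext => w /=; apply: eq_from_tnth => t.
  by rewrite !tnth_mktuple ffunE expr0 mul1r.
rewrite [in RHS]noise0; move: ([ffun=> false]) => e' in noise0 *.
have mpre e1 B : measurable B -> measurable ((signs e1 \o noise) @^-1` B `&` at_positions x).
  move=> mB; apply: measurableI => //; rewrite -[X in measurable X]setTI.
  exact: measurable_signed_noise.
pose Q (A : set (N.-tuple R)) := P ((signs e \o noise) @^-1` A `&` at_positions x) =
  P ((signs e' \o noise) @^-1` A `&` at_positions x).
move: mA; rewrite tuple_rectangles; move: A.
apply: (dynkin_induction (P := Q) (@tuple_rectangles R N)); rewrite /Q.
- move=> _ _ [B mB ->] [C mC ->]; exists (fun t => B t `&` C t).
    by move=> t; apply: measurableI.
  by rewrite predeqE => z; split=> [[h k] t|h]; [split|split=> t; have [] := h t].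
- by rewrite !preimage_setT.
- move=> _ [B mB ->].
  have rect e1 : P ((signs e1 \o noise) @^-1` [set z | forall t, B t (tnth z t)]
       `&` at_positions x) = (\prod_t ((n * p)%:R^-1 * gauss sigma (B t)))%:E.
    pose C t := if e1 t then -%R @^-1` B t else B t.
    have mC t : measurable (C t).
      rewrite /C; case: ifP => // _; rewrite -[X in measurable X]setTI.
      exact: oppr_measurable.
    transitivity (P [set w | forall t, pos t w = x t /\ C t (xi t w)]).
      congr (P _); rewrite predeqE => w; split=> [[h k] t|h].
        split; first exact: k.
        have := h t; rewrite !tnth_mktuple /C.
        by case: (e1 t); rewrite ?expr1 ?mulN1r ?expr0 ?mul1r.
      split=> t; last by have [] := h t.
      have [_] := h t; rewrite !tnth_mktuple /C.
      by case: (e1 t); rewrite ?expr1 ?mulN1r ?expr0 ?mul1r.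
    rewrite (joint_law sample posE) //; congr (_%:E); apply: eq_bigr => t _.
    by congr (_ * _); rewrite /C; case: (e1 t) => //; exact: gauss_symmetric.
  by rewrite !rect.
- move=> B mB hB.
  have cpl e1 : (signs e1 \o noise) @^-1` (~` B) `&` at_positions x =
      at_positions x `\` ((signs e1 \o noise) @^-1` B `&` at_positions x).
    by rewrite predeqE => w; split=> [[h k]|[h k]]; split => //; [case|move=> ?; apply: k].
  rewrite !cpl !measureD ?mpre // -?ge0_fin_numE ?fin_num_measure //.
  have eI e1 : at_positions x `&` ((signs e1 \o noise) @^-1` B `&` at_positions x) =
     (signs e1 \o noise) @^-1` B `&` at_positions x.
    by rewrite setICA setIid.
  - by rewrite !eI; congr (_ - _)%E; exact: hB.
  - exact: mpre.
  - exact: mpre.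
- move=> F mF tF hF; rewrite !preimage_bigcup !setI_bigcupl.
  have tr e1 : trivIset setT (fun k => (signs e1 \o noise) @^-1` F k `&` at_positions x).
    move=> i j _ _ [w [[Fi _] [Fj _]]]; apply: (tF i j) => //.
    by exists (signs e1 (noise w)).
  rewrite !measure_bigcup //; last 2 first.
  - by move=> k _; apply: mpre.
  - by move=> k _; apply: mpre.
  by apply: eq_eseriesr => k _; exact: hF.
Qed.

End SignFlip.

(** * Moments of the noise matrix *)

Section Counting.
Context d (T : measurableType d) (R : realType) (P : probability T R).

(** Integrate over [D] the number of the events that take place. *)
Lemma sum_prob_le (J : finType) (E : J -> set T) (D : set T) (c : R) :
  measurable D -> (forall j, measurable (E j)) -> (forall j, E j `<=` D) -> 0 <= c ->
  (forall w, D w -> \sum_j (\1_(E j) w) <= c) ->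
  (\sum_j P (E j) <= c%:E * P D)%E.
Proof.
move=> mD mE ED c0 hc.
have -> : (\sum_j P (E j) = \sum_j \int[P]_(w in D) (\1_(E j) w)%:E)%E.
  by apply: eq_bigr => j _; rewrite integral_indic // setIidl.
rewrite -ge0_integral_sum //; last first.
  by move=> j; apply/measurable_EFinP; apply: measurable_funTS; exact: measurable_indic.
rewrite -integral_cst //; apply: ge0_le_integral => //.
- by move=> w _; apply: sume_ge0 => j _; rewrite lee_fin.
- apply: emeasurable_sum => j; apply/measurable_EFinP; apply: measurable_funTS.
  exact: measurable_indic.
- by move=> w Dw; rewrite sumEFin lee_fin hc.
Qed.

End Counting.

Section MeasurableMatrices.
Context d (T : measurableType d) (R : realType).

Definition measurable_mx a b (F : T -> 'M[R]_(a, b)) : Prop :=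
  forall i j, measurable_fun setT (fun w => F w i j).

Lemma measurable_mx_mul a b c (F : T -> 'M[R]_(a, b)) (G : T -> 'M[R]_(b, c)) :
  measurable_mx F -> measurable_mx G -> measurable_mx (fun w => F w *m G w).
Proof.
move=> mF mG i j; under eq_fun do rewrite mxE.
by apply: measurable_sum => k; apply: measurable_funM.
Qed.

Lemma measurable_mx_expr a (F : T -> 'M[R]_a) k :
  measurable_mx F -> measurable_mx (fun w => F w ^+ k).
Proof.
move=> mF; elim: k => [|k ih]; first by move=> i j; exact: measurable_cst.
have := measurable_mx_mul mF ih.
by congr measurable_mx; apply/funext => w; rewrite mulmxE -exprS.
Qed.

Lemma measurable_dilation_moment a b k (F : T -> 'M[R]_(a, b)) :
  measurable_mx F -> measurable_fun setT (fun w => dilation_moment k (F w)).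
Proof.
move=> mF; apply: measurable_sum => i; apply: measurable_mx_expr => {i} i j.
case: (split_ordP i) => i' ->; case: (split_ordP j) => j' ->.
- under eq_fun do rewrite /dilation block_mxEul mxE.
  exact: measurable_cst.
- under eq_fun do rewrite /dilation block_mxEur.
  exact: mF.
- under eq_fun do rewrite /dilation block_mxEdl mxE.
  exact: mF.
- under eq_fun do rewrite /dilation block_mxEdr mxE.
  exact: measurable_cst.
Qed.

End MeasurableMatrices.

Section SignTail.
Context (R : realType) d (T : measurableType d) (P : probability T R).
Variables (n p N : nat) (M : 'M[R]_(n, p)) (sigma : R).
Variables (X : 'I_N -> T -> 'M[R]_(n, p)) (xi : 'I_N -> {RV P >-> R}).
Variable y : 'I_N -> T -> R.
Hypothesis sample : completion_sample M sigma X xi y.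
Hypothesis sigma0 : 0 < sigma.
Local Notation I := ('I_n * 'I_p)%type.
Variable pos : 'I_N -> T -> I.
Hypothesis posE : forall t w, X t w = delta_mx (pos t w).1 (pos t w).2.

Variables (V u : R) (k : nat).
Hypothesis V0 : 0 <= V.
Hypothesis u0 : 0 < u.

Definition weighted (x : {ffun 'I_N -> I}) (z : N.-tuple R) : 'M[R]_(n, p) :=
  \sum_t tnth z t *: delta_mx (x t).1 (x t).2.

(** The constraints on the rows and columns depend on the squares of the noise
   only. For given squares the moment can thus be averaged over the signs. *)
Definition unlikely_noise (x : {ffun 'I_N -> I}) : set (N.-tuple R) :=
  [set z | u ^+ k.+1.*2 < dilation_moment k.+1 (weighted x z)] `&`
  ([set z | forall i, \sum_(t | (x t).1 == i) tnth z t ^+ 2 <= V] `&`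
   [set z | forall j, \sum_(t | (x t).2 == j) tnth z t ^+ 2 <= V]).

Lemma measurable_unlikely_noise x : measurable (unlikely_noise x).
Proof.
have mt t : measurable_fun setT (fun z : N.-tuple R => tnth z t).
  exact: measurable_tnth.
have msq (Q : pred 'I_N) :
    measurable [set z : N.-tuple R | \sum_(t | Q t) tnth z t ^+ 2 <= V].
  have mf : measurable_fun setT (fun z : N.-tuple R => \sum_(t | Q t) tnth z t ^+ 2).
    under eq_fun do rewrite big_mkcond; apply: measurable_sum => t.
    by case: (Q t) => //; apply: measurable_funX.
  have := mf measurableT [set` `]-oo, V]] (measurable_itv _).
  by rewrite setTI; congr measurable; rewrite predeqE => z; rewrite /= in_itv.
have mall (J : finType) (Q : J -> pred 'I_N) :
    measurable [set z : N.-tuple R | forall i, \sum_(t | Q i t) tnth z t ^+ 2 <= V].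
  have -> : [set z : N.-tuple R | forall i, \sum_(t | Q i t) tnth z t ^+ 2 <= V] =
     \bigcap_(i in [set: J]) [set z : N.-tuple R | \sum_(t | Q i t) tnth z t ^+ 2 <= V].
    by rewrite predeqE => z; split=> [h i _|h i]; [exact: h|exact: (h i Logic.I)].
  by apply: fin_bigcap_measurable => // i _; exact: msq.
apply: measurableI; last by apply: measurableI; apply: mall.
have mw : measurable_mx (fun z : N.-tuple R => weighted x z).
  move=> i j; under eq_fun do rewrite summxE; apply: measurable_sum => t.
  under eq_fun do rewrite mxE.
  by apply: measurable_funM.
have mm := measurable_dilation_moment k.+1 mw.
have := mm measurableT [set` `]u ^+ k.+1.*2, +oo[] (measurable_itv _).
by rewrite setTI; congr measurable; rewrite predeqE => z; rewrite /= in_itv /= andbT.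
Qed.

(** The quotient of the noncommutative Khintchine bound and the threshold. *)
Definition moment_tail : R :=
  (k.+1.*2%:R * V) ^+ k.+1 * (n + p)%:R / u ^+ k.+1.*2.

Lemma moment_tail_ge0 : 0 <= moment_tail.
Proof. by rewrite /moment_tail !mulr_ge0 ?invr_ge0 ?exprn_ge0 ?mulr_ge0 // ltW. Qed.

Lemma count_unlikely_signs x z :
  \sum_(e : {ffun 'I_N -> bool}) \1_(unlikely_noise x) (signs e z) <=
  moment_tail * 2 ^+ N.
Proof.
have tn e t : tnth (signs e z) t = (-1) ^+ e t * tnth z t by rewrite tnth_mktuple.
have sq e t : tnth (signs e z) t ^+ 2 = tnth z t ^+ 2.
  by rewrite tn exprMn sqrr_sign mul1r.
have [hz|hz] := pselect ((forall i, \sum_(t | (x t).1 == i) tnth z t ^+ 2 <= V) /\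
   (forall j, \sum_(t | (x t).2 == j) tnth z t ^+ 2 <= V)); last first.
  rewrite big1 => [|e _]; first by apply: mulr_ge0; rewrite ?moment_tail_ge0 ?exprn_ge0.
  rewrite indicE memNset // => -[_ [h1 h2]]; apply: hz; split=> i.
    by have := h1 i; under eq_bigr do rewrite sq.
  by have := h2 i; under eq_bigr do rewrite sq.
have [h1 h2] := hz.
have uk : 0 < u ^+ k.+1.*2 by rewrite exprn_gt0.
have -> : moment_tail * 2 ^+ N =
   ((k.+1.*2%:R * V) ^+ k.+1 * (2 ^+ N * (n + p)%:R)) / u ^+ k.+1.*2.
  by rewrite /moment_tail; field; rewrite gt_eqF.
rewrite ler_pdivlMr //; apply: le_trans (rademacher_dilation_moment k.+1 V0 h1 h2).
rewrite mulr_suml; apply: ler_sum => e _.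
have -> : \sum_t ((-1) ^+ e t * tnth z t) *: delta_mx (x t).1 (x t).2 =
    weighted x (signs e z) by apply: eq_bigr => t _; rewrite tn.
rewrite indicE; case: (boolP (_ \in _)) => [|_].
  by rewrite inE mul1r => -[/ltW].
by rewrite mul0r dilation_moment_ge0.
Qed.

(** By sign symmetry all sign patterns are equally likely, given the positions,
   and only a small proportion of them makes the moment large. *)
Lemma unlikely_noise_at x :
  (P (noise xi @^-1` unlikely_noise x `&` at_positions pos x) <=
   moment_tail%:E * P (at_positions pos x))%E.
Proof.
have mA := measurable_unlikely_noise x.
have mX := measurable_at_positions sample posE x.
have mE (e : {ffun 'I_N -> bool}) : measurable ((signs e \o noise xi) @^-1` unlikely_noise x `&` at_positions pos x).
  apply: measurableI => //; rewrite -[X in measurable X]setTI.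
  exact: measurable_signed_noise.
have h : (\sum_(e : {ffun 'I_N -> bool})
      P ((signs e \o noise xi) @^-1` unlikely_noise x `&` at_positions pos x) <=
    (moment_tail * 2 ^+ N)%:E * P (at_positions pos x))%E.
  apply: sum_prob_le => //.
  - by apply: mulr_ge0; rewrite ?moment_tail_ge0 ?exprn_ge0.
  - move=> w xw; apply: le_trans (count_unlikely_signs x (noise xi w)).
    apply: ler_sum => e _; rewrite !indicE ler_nat; case: (boolP (w \in _)) => //.
    by rewrite inE => -[h _]; rewrite mem_set.
have N0 : (0 < (2 ^+ N)%:E :> \bar R)%E by rewrite lte_fin exprn_gt0.
rewrite -(lee_pmul2l _ N0) // muleA -EFinM [2 ^+ N * _]mulrC; apply: le_trans h.
under [leRHS]eq_bigr => e _ do rewrite (sign_flip sample posE x e sigma0 mA).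
have mB : measurable (noise xi @^-1` unlikely_noise x `&` at_positions pos x).
  have := mE [ffun=> false]; rewrite (_ : signs _ \o _ = noise xi) //.
  apply/funext => w; apply: eq_from_tnth => t.
  by rewrite /= !tnth_mktuple ffunE expr0 mul1r.
have /fineK <- : P (noise xi @^-1` unlikely_noise x `&` at_positions pos x) \is a fin_num.
  exact: fin_num_measure.
by rewrite sumEFin -EFinM lee_fin sumr_const card_ffun card_bool card_ord -[leRHS]mulr_natl natrX.
Qed.

(** A noise matrix whose rows and columns carry little mass has a large moment
   only with small probability. *)
Lemma unlikely_noise_prob :
  let E := [set w | unlikely_noise [ffun t => pos t w] (noise xi w)] in
  measurable E /\ (P E <= moment_tail%:E)%E.
Proof.
move=> E; pose A x := noise xi @^-1` unlikely_noise x `&` at_positions pos x.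
have posx w x : at_positions pos x w <-> [ffun t => pos t w] = x.
  by split=> [h|<- t]; [apply/ffunP => t; rewrite ffunE h|rewrite ffunE].
have mA x : measurable (A x).
  apply: measurableI; last exact: (measurable_at_positions sample posE).
  rewrite -[X in measurable X]setTI; apply: (_ : measurable_fun setT (noise xi)) => //.
    apply/measurable_fun_tnthP => t.
    have -> : @tnth N R ^~ t \o noise xi = xi t by apply/funext => w /=; rewrite tnth_mktuple.
    exact: measurable_funP.
  exact: measurable_unlikely_noise.
have [mU PU] := union_bound P (index_enum {ffun 'I_N -> I}) mA.
have EU : E = [set w | exists2 x, x \in index_enum {ffun 'I_N -> I} & A x w].
  rewrite predeqE => w; split=> [Ew|[x _ [Aw /posx xw]]].
    by exists [ffun t => pos t w]; rewrite ?mem_index_enum //; split => //; apply/posx.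
  by rewrite /E /= xw.
rewrite EU; split => //; apply: le_trans PU _.
apply: le_trans (_ : \sum_x (moment_tail%:E * P (at_positions pos x)) <= _)%E.
  by apply: lee_sum => x _; exact: unlikely_noise_at.
rewrite -ge0_sume_distrr => [|x _]; last exact: measure_ge0.
rewrite -[leRHS]mule1; apply: lee_wpmul2l; first by rewrite lee_fin moment_tail_ge0.
have mp x : measurable ((fun w => [ffun t => pos t w]) @^-1` [set x]).
  by have := measurable_at_positions sample posE x; congr measurable; rewrite predeqE => w; split => /posx.
have [mtot tot] := finite_valued P [set: {ffun 'I_N -> I}]%SET mp.
rewrite (eq_bigr (fun x => P ((fun w => [ffun t => pos t w]) @^-1` [set x]))) => [|x _]; last first.
  by congr (P _); rewrite predeqE => w; split => /posx.
rewrite -(eq_bigl _ _ (fun x => finset.in_setT x)) -tot; exact: (probability_le1 P mtot).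
Qed.

End SignTail.

(** * Operator norm of the deviation of the data *)

Section NoiseBound.
Context (R : realType) d (T : measurableType d) (P : probability T R).
Variables (n p N : nat) (M : 'M[R]_(n, p)) (sigma : R).
Variables (X : 'I_N -> T -> 'M[R]_(n, p)) (xi : 'I_N -> {RV P >-> R}).
Variable y : 'I_N -> T -> R.
Hypothesis sample : completion_sample M sigma X xi y.
Hypothesis sigma0 : 0 < sigma.
Local Notation I := ('I_n * 'I_p)%type.
Variable pos : 'I_N -> T -> I.
Hypothesis posE : forall t w, X t w = delta_mx (pos t w).1 (pos t w).2.

Definition positions (w : T) : {ffun 'I_N -> I} := [ffun t => pos t w].

Lemma positions_law (S : {set {ffun 'I_N -> I}}) :
  measurable [set w | positions w \in S] /\
  (P [set w | positions w \in S] = (#|S|%:R / (n * p)%:R ^+ N)%:E)%E.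
Proof.
have fib x : positions @^-1` [set x] = at_positions pos x.
  rewrite predeqE => w; split=> [<- t|h]; first by rewrite ffunE.
  by apply/ffunP => t; rewrite ffunE h.
have mf x : measurable (positions @^-1` [set x]).
  by rewrite fib; exact: (measurable_at_positions sample posE).
have [mS PS] := finite_valued P S mf; split => //; rewrite PS.
rewrite (eq_bigr (fun=> ((n * p)%:R ^- N)%:E)) => [|x _].
  by rewrite sumEFin; congr (_%:E); rewrite sumr_const -[LHS]mulr_natl.
rewrite fib; transitivity (P [set w | forall t, pos t w = x t /\ setT (xi t w)]).
  by congr (P _); rewrite predeqE => w; split=> h t; [split|have [] := h t].
have -> := joint_law sample posE x (B := fun=> setT) (fun=> measurableT).
congr (_%:E).
rewrite (eq_bigr (fun=> (n * p)%:R^-1)) => [|t _].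
  by rewrite prodr_const card_ord exprVn.
by rewrite /gauss probability_setT mulr1.
Qed.

Lemma inner_delta (i : I) : inner (delta_mx i.1 i.2) M = M i.1 i.2.
Proof.
rewrite -[inner _ _]/(ip _ _) ipE (bigD1 i.1) //= (bigD1 i.2) //= mxE !eqxx mul1r.
rewrite big1 => [|j /negPf ji]; last by rewrite mxE ji andbF mul0r.
rewrite addr0 big1 ?addr0 // => k /negPf ki.
by rewrite big1 // => j _; rewrite mxE ki mul0r.
Qed.

(** The deviation of the data from its mean has two sources: the random choice
   of the entries, and the noise. *)
Lemma data_decomposition w :
  \sum_t y t w *: X t w - (N%:R / (n * p)%:R) *: M =
  (sampled M (positions w) - sampling_mean N M) +
    weighted (positions w) (noise xi w).
Proof.
rewrite /sampling_mean addrAC; congr (_ - _); rewrite -big_split /=.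
apply: eq_bigr => t _; case: sample => _ _ _ _ ->.
by rewrite posE inner_delta scalerDl ffunE tnth_mktuple.
Qed.

Variable a : R.
Hypothesis Ma : forall i j, `|M i j| <= a.
Hypotheses (n0 : (0 < n)%N) (p0 : (0 < p)%N) (N0 : (0 < N)%N).
Hypothesis lnd : 2 <= ln (n + p)%:R :> R.
Hypothesis Nlarge : (minn n p)%:R * ln (n + p)%:R ^+ 2 <= N%:R :> R.
Local Notation D := (n + p)%:R.
Local Notation occ := (occupancy R n p N).

(** Outside of overloaded rows and columns it bounds the sum of the squares of
   the observed entries, and also the sum of the squares of the noise. *)
Definition mass_bound : R := (a ^+ 2 + 4 * sigma ^+ 2) * occ.

Definition noise_level : R := 2 * expR 1 * Num.sqrt (ln D * mass_bound).

(** At the logarithm of the dimension the trace exceeds the operator norm by a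
   constant factor only, after taking roots. *)
Definition moment_order : nat := Num.truncn (ln D : R).

Lemma min_dim_gt0 : 0 < (minn n p)%:R :> R.
Proof. by rewrite ltr0n leq_min n0. Qed.

Lemma dim_gt0 : 0 < D :> R.
Proof. by rewrite ltr0n addn_gt0 n0. Qed.

Lemma occupancy_gt0 : 0 < occ.
Proof.
rewrite /occupancy mulr_gt0 ?divr_gt0 ?min_dim_gt0 ?ltr0n //.
by rewrite ltr_wpDl // mulr_ge0 ?expR_ge0.
Qed.

Lemma mass_bound_gt0 : 0 < mass_bound.
Proof.
apply: mulr_gt0 occupancy_gt0; rewrite ltr_wpDl ?sqr_ge0 // mulr_gt0 // exprn_gt0 //.
Qed.

Lemma noise_level_gt0 : 0 < noise_level.
Proof.
rewrite /noise_level mulr_gt0 ?mulr_gt0 ?expR_gt0 // sqrtr_gt0.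
by apply: mulr_gt0 mass_bound_gt0; apply: lt_le_trans lnd.
Qed.

Lemma noise_level_sqr : noise_level ^+ 2 = 4 * expR 2 * (ln D * mass_bound).
Proof.
rewrite /noise_level !exprMn sqr_sqrtr; last first.
  by apply: mulr_ge0 (ltW mass_bound_gt0); apply: le_trans lnd.
by rewrite -expRM_natl mulr1 -natrX.
Qed.

(** Each factor of the tail is at most [expR (- 2)] for this noise level; their
   product falls below [D ^- 2], and the trace loses one factor [D]. *)
Lemma moment_tail_small :
  moment_tail n p mass_bound noise_level moment_order <= D^-1.
Proof.
have V0 := mass_bound_gt0; have ln0 : 0 < ln D :> R by apply: lt_le_trans lnd.
have u2 : noise_level ^+ moment_order.+1.*2 = (noise_level ^+ 2) ^+ moment_order.+1.
  by rewrite -exprM mul2n.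
rewrite /moment_tail u2 noise_level_sqr mulrAC -expr_div_n.
have De : D = expR (ln D) :> R by rewrite lnK // posrE dim_gt0.
have klt : ln D < moment_order.+1%:R :> R by rewrite truncnS_gt.
have kle : moment_order.+1%:R <= 2 * ln D :> R.
  have : moment_order%:R <= ln D :> R by rewrite truncn_le ltW.
  rewrite -(natr1 moment_order) mulr_natl mulr2n => h; apply: lerD => //.
  by apply: le_trans lnd; rewrite ler1n.
have base0 : 0 <= moment_order.+1.*2%:R * mass_bound / (4 * expR 2 * (ln D * mass_bound)).
  apply: divr_ge0; first by rewrite mulr_ge0 // ltW.
  by apply: mulr_ge0; [rewrite mulr_ge0 // expR_ge0 | apply/ltW/mulr_gt0].
have base : moment_order.+1.*2%:R * mass_bound / (4 * expR 2 * (ln D * mass_bound)) <= expR (- 2).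
  rewrite ler_pdivrMr; last first.
    by apply: mulr_gt0; [rewrite mulr_gt0 // expR_gt0 | exact: mulr_gt0].
  have -> : expR (- 2) * (4 * expR 2 * (ln D * mass_bound)) = 2 * (2 * ln D) * mass_bound.
    by rewrite expRN; field; rewrite gt_eqF ?expR_gt0.
  by rewrite ler_wpM2r ?(ltW V0) // -muln2 mulnC natrM ler_wpM2l.
apply: (@le_trans _ _ (expR (- 2) ^+ moment_order.+1 * D)).
  by rewrite ler_wpM2r ?(ltW dim_gt0) // lerXn2r // nnegrE expR_ge0.
rewrite -expRM_natl De -expRN -expRD ler_expR.
rewrite mulrN -lerBrDr -opprD lerN2 -mulr2n -[ln _ *+ 2]mulr_natr.
by rewrite ler_wpM2r // ltW.
Qed.

(** Chosen for [noise_level_tuning]: half of the tuning parameter is five noise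
   levels, four for the choice of the entries and one for the noise. *)
Definition noise_constant : R := 20 * expR 1 *
  Num.sqrt ((mgf_bound R + 1) * (a ^+ 2 + 4 * sigma ^+ 2)).

Lemma noise_level_tuning :
  N%:R^-1 * (5 * noise_level) = tuning noise_constant n p N / 2.
Proof.
have m0 := min_dim_gt0; have N0' : 0 < N%:R :> R by rewrite ltr0n.
have ln0 : 0 <= ln D :> R by apply: le_trans lnd.
set c := (mgf_bound R + 1) * (a ^+ 2 + 4 * sigma ^+ 2).
have c0 : 0 <= c.
  apply: mulr_ge0; apply: addr_ge0 => //; rewrite ?sqr_ge0 //.
    by rewrite mulr_ge0 ?expR_ge0.
  by rewrite pmulr_rge0 ?sqr_ge0.
have E : ln D * mass_bound = N%:R ^+ 2 * (c * (ln D / (N%:R * (minn n p)%:R))).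
  by rewrite /mass_bound /occupancy /c; field; rewrite !gt_eqF.
rewrite /noise_level /tuning /noise_constant E sqrtrM ?sqr_ge0 // sqrtr_sqr gtr0_norm //.
rewrite -/c (sqrtrM _ c0).
by field; rewrite gt_eqF.
Qed.

Definition light_positions : {set {ffun 'I_N -> I}} :=
  [set x : {ffun 'I_N -> I} |
    [forall i, (\sum_(t | (x t).1 == i) 1 <= occ)%R] &&
    [forall j, (\sum_(t | (x t).2 == j) 1 <= occ)%R]].

Lemma light_positions_large x : x \in light_positions ->
  #|[set e | large (signed_sampled M e x) noise_level]%SET|%:R <= D^-1 * 2 ^+ N :> R.
Proof.
rewrite inE => /andP[/forallP h1 /forallP h2].
have sq (Q : pred 'I_N) : \sum_(t | Q t) 1 <= occ ->
    \sum_(t | Q t) M (x t).1 (x t).2 ^+ 2 <= mass_bound.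
  move=> hQ; apply: (@le_trans _ _ (a ^+ 2 * \sum_(t | Q t) 1)).
    rewrite mulr_sumr; apply: ler_sum => t _; rewrite mulr1.
    rewrite -(real_normK (num_real (M _ _))) ler_sqr ?nnegrE //.
    exact: le_trans (Ma (x t).1 (x t).2).
  apply: (@le_trans _ _ (a ^+ 2 * occ)); first by rewrite ler_wpM2l ?sqr_ge0.
  rewrite /mass_bound ler_wpM2r ?(ltW occupancy_gt0) // lerDl pmulr_rge0 //.
  exact: sqr_ge0.
have := rademacher_large moment_order (ltW mass_bound_gt0) (ltW noise_level_gt0)
  (fun i => sq _ (h1 i)) (fun j => sq _ (h2 j)).
have uk : 0 < noise_level ^+ moment_order.+1.*2 by rewrite exprn_gt0 // noise_level_gt0.
rewrite -ler_pdivlMr // => h; apply: le_trans h _.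
have := moment_tail_small; rewrite /moment_tail.
have N2 : 0 <= 2 ^+ N :> R by rewrite exprn_ge0.
move=> /(ler_wpM2r N2); apply: le_trans.
rewrite le_eqVlt; apply/orP; left; apply/eqP; by rewrite [2 ^+ N * _]mulrC mulrA mulrAC.
Qed.

(** The smallness of the variance that symmetrization asks for. *)
Lemma small_mean : N%:R * a ^+ 2 / (n * p)%:R <= 2 * noise_level ^+ 2.
Proof.
have m0 := min_dim_gt0; have V0 := mass_bound_gt0.
apply: (@le_trans _ _ mass_bound).
  apply: (@le_trans _ _ (a ^+ 2 * occ)); last first.
    rewrite /mass_bound ler_wpM2r ?(ltW occupancy_gt0) // lerDl pmulr_rge0 //.
    exact: sqr_ge0.
  rewrite [N%:R * _]mulrC -mulrA ler_wpM2l ?sqr_ge0 // /occupancy.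
  rewrite -[leLHS]mul1r; apply: ler_pM => //.
    by rewrite lerDr mulr_ge0 ?expR_ge0.
  rewrite ler_wpM2l // lef_pV2 ?posrE ?ltr0n ?muln_gt0 ?leq_min ?n0 ?p0 //.
  by rewrite ler_nat (leq_trans (geq_minl n p)) // leq_pmulr.
rewrite noise_level_sqr.
have e1 : 1 <= expR 2 :> R by apply: le_trans (expR_ge1Dx _); rewrite lerDl.
have l1 : 1 <= ln D :> R by apply: le_trans lnd; rewrite ler1n.
have l0 : 0 <= ln D * mass_bound by rewrite mulr_ge0 ?(ltW V0) // (le_trans ler01).
apply: (@le_trans _ _ (ln D * mass_bound)).
  by rewrite -[leLHS]mul1r ler_wpM2r ?(ltW V0).
rewrite mulrA -[leLHS]mul1r ler_wpM2r //.
apply: (le_trans e1); rewrite mulrA -[leLHS]mul1r ler_wpM2r ?expR_ge0 //.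
by rewrite -natrM ler1n.
Qed.

Definition deviating_positions : {set {ffun 'I_N -> I}} :=
  [set x | large (sampled M x - sampling_mean N M) (4 * noise_level)].

Definition noise_failure : set T :=
  ([set w | positions w \in deviating_positions] `|`
   [set w | unlikely_noise mass_bound noise_level moment_order
      [ffun t => pos t w] (noise xi w)]) `|` some_overloaded sigma xi pos.

(** Here the sample size matters: it makes [N / minn n p] at least twice the
   logarithm of the number [n + p] of rows and columns. *)
Lemma overload_prob_le : (P (some_overloaded sigma xi pos) <= (D^-1)%:E)%E.
Proof.
have m0 := min_dim_gt0.
have [_ PU] := some_overloaded_prob sample sigma0 posE n0 p0.
apply: le_trans PU _; rewrite lee_fin.
have De : D = expR (ln D) :> R by rewrite lnK // posrE dim_gt0.
rewrite De -expRN -expRD ler_expR -lerBrDl -opprD lerN2 ler_pdivlMr //.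
apply: le_trans Nlarge; rewrite mulrC ler_wpM2l ?(ltW m0) //.
by rewrite -mulr2n -[_ *+ 2]mulr_natl expr2 ler_wpM2r // (le_trans _ lnd).
Qed.

Lemma not_overloaded_light w : ~ some_overloaded sigma xi pos w ->
  positions w \in light_positions.
Proof.
move=> h; have hj j : \sum_(t | hit j (pos t w)) 1 <= occ.
  have /not_overloaded : ~ overloaded sigma xi pos j w.
    by move=> hj; apply: h; exists j; rewrite ?mem_index_enum.
  apply: le_trans; apply: ler_sum => t _; rewrite lerDl divr_ge0 ?sqr_ge0 //.
  by rewrite pmulr_rge0 // sqr_ge0.
rewrite inE; apply/andP; split; apply/forallP => i.
  by have := hj (inl i); under [X in _ -> X <= _]eq_bigl do rewrite ffunE.
by have := hj (inr i); under [X in _ -> X <= _]eq_bigl do rewrite ffunE.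
Qed.

(** Symmetrization costs a factor 4, applied to the probability of an overload
   and to the proportion of bad signs at positions without overload. *)
Lemma deviating_prob_le :
  (P [set w | positions w \in deviating_positions] <= (8 * D^-1)%:E)%E.
Proof.
have [_ ->] := positions_law deviating_positions; rewrite lee_fin.
have np0 : 0 < (n * p)%:R ^+ N :> R by rewrite exprn_gt0 // ltr0n muln_gt0 n0.
have tau0 : 0 <= D^-1 :> R by rewrite invr_ge0.
have := symmetrization n0 p0 noise_level_gt0 tau0 Ma small_mean light_positions_large.
rewrite -/deviating_positions => h.
have cO : #|{: {ffun 'I_N -> I}}|%:R = (n * p)%:R ^+ N :> R.
  by rewrite card_ffun card_prod !card_ord natrX.
have heavy : #|~: light_positions|%:R <= D^-1 * (n * p)%:R ^+ N :> R.
  rewrite -ler_pdivrMr // -lee_fin.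
  have [mS <-] := positions_law (~: light_positions).
  apply: le_trans overload_prob_le; apply: le_measure; rewrite ?inE //.
    by have [] := some_overloaded_prob sample sigma0 posE n0 p0.
  move=> w /=; rewrite inE => hw; apply: contrapT => /not_overloaded_light.
  by rewrite (negbTE hw).
rewrite ler_pdivrMr //; apply: le_trans h _; rewrite cO; lra.
Qed.

Lemma noise_failure_prob :
  measurable noise_failure /\ (P noise_failure <= (10 * D^-1)%:E)%E.
Proof.
have [m1 _] := positions_law deviating_positions.
have [m2 P2] := unlikely_noise_prob sample sigma0 posE moment_order (ltW mass_bound_gt0) noise_level_gt0.
have [m3 _] := some_overloaded_prob sample sigma0 posE n0 p0.
split; first by do 2?apply: measurableU.
have := moment_tail_small; rewrite -lee_fin => /(le_trans P2) P2'.
apply: le_trans (measureU2 _ _ _) _ => //; first exact: measurableU.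
have -> : 10 * D^-1 = (8 * D^-1 + D^-1) + D^-1 :> R by ring.
rewrite !EFinD; apply: leeD overload_prob_le.
apply: le_trans (measureU2 _ _ _) _ => //.
by apply: leeD deviating_prob_le P2'.
Qed.

Lemma noise_operator_bound w : ~ noise_failure w ->
  opbd (N%:R^-1 *: (\sum_t y t w *: X t w) - (n * p)%:R^-1 *: M)
    (tuning noise_constant n p N / 2).
Proof.
move=> h; have N0' : N%:R != 0 :> R by rewrite pnatr_eq0 -lt0n.
have -> : N%:R^-1 *: (\sum_t y t w *: X t w) - (n * p)%:R^-1 *: M =
    N%:R^-1 *: (\sum_t y t w *: X t w - (N%:R / (n * p)%:R) *: M).
  by rewrite scalerBr scalerA mulKf.
rewrite -noise_level_tuning data_decomposition; apply: opbdZ.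
have u0 := noise_level_gt0.
have -> : 5 * noise_level = 4 * noise_level + noise_level by ring.
apply: opbdD; rewrite ?mulr_ge0 ?(ltW u0) //.
  apply: contrapT => hd; apply: h; left; left; rewrite /= inE.
  by apply/asboolPn.
apply: (@opbd_of_dilation_moment _ _ _ moment_order); first exact: ltW.
rewrite leNgt; apply/negP => hm.
have mass j : \sum_(t | hit j (pos t w)) xi t w ^+ 2 <= mass_bound.
  have /not_overloaded hj : ~ overloaded sigma xi pos j w.
    by move=> hj; apply: h; right; exists j; rewrite ?mem_index_enum.
  apply: (@le_trans _ _ (4 * sigma ^+ 2 * occ)); last first.
    by rewrite /mass_bound ler_wpM2r ?(ltW occupancy_gt0) // lerDr sqr_ge0.
  have s4 : 0 < 4 * sigma ^+ 2 by rewrite pmulr_rgt0 // exprn_gt0.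
  apply: (@le_trans _ _ (4 * sigma ^+ 2 *
      \sum_(t | hit j (pos t w)) (1 + xi t w ^+ 2 / (4 * sigma ^+ 2)))); last first.
    by rewrite ler_wpM2l ?(ltW s4).
  rewrite mulr_sumr; apply: ler_sum => t _; rewrite mulrDr [_ * (_ / _)]mulrC divfK ?gt_eqF //.
  by rewrite lerDr mulr1 ltW.
apply: h; left; right; split; first exact: hm.
split=> i /=.
  have := mass (inl i); rewrite /=.
  under eq_bigr do rewrite -(tnth_mktuple (fun t => xi t w)).
  by under eq_bigl do rewrite -(ffunE (fun t => pos t w)).
have := mass (inr i); rewrite /=.
under eq_bigr do rewrite -(tnth_mktuple (fun t => xi t w)).
by under eq_bigl do rewrite -(ffunE (fun t => pos t w)).
Qed.

End NoiseBound.

(** * Taylor's inequality along the lines of the cube *)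

Section LineRestriction.
Context (R : realType) (K : nat).
Implicit Types (f g : 'rV[R]_K -> R) (x : 'rV[R]_K).

Lemma norm_scale_delta (h : R) (i : 'I_K) :
  `|h *: (delta_mx 0 i : 'rV[R]_K)| <= `|h|.
Proof.
rewrite normrZ -[leRHS]mulr1 ler_wpM2l //.
rewrite -[leLHS]/(mx_norm _) mx_normrE; apply: bigmax_le => // -[a b] _ /=.
by rewrite mxE; case: (_ && _); rewrite ?normr1 ?normr0.
Qed.

(** Every point of the cube is approached within the cube along each axis, from
   at least one side, so that the limits of difference quotients are unique. *)
Lemma cube_line_proper x (i : 'I_K) : unit_cube x ->
  ProperFilter (within [set h : R | unit_cube (x + h *: delta_mx 0 i)] 0^').
Proof.
move=> cx; apply: Build_ProperFilter_ex => A; rewrite /within /=.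
move=> /nbhs_ballP[d /= d0 hd].
have [h [h0 hd' ch]] : exists h : R, [/\ h != 0, `|h| < d & unit_cube (x + h *: delta_mx 0 i)].
  pose m := Num.min (d / 2) 2^-1.
  have m0 : 0 < m by rewrite lt_min divr_gt0 ?invr_gt0 ?ltr0n.
  have md : m < d by rewrite gt_min ltr_pdivrMr // ltr_pMr // ltr1n.
  have mh : m <= 2^-1 by rewrite ge_min lexx orbT.
  have cube_upd h : 0 <= x 0 i + h <= 1 -> unit_cube (x + h *: delta_mx 0 i).
    move=> hi j; rewrite !mxE eqxx /=; have := cx j.
    by case: eqVneq => [->|_]; rewrite ?mulr1 ?mulr0 ?addr0.
  have /andP[x0 x1] := cx i.
  have [xi|xi] := leP (x 0 i) 2^-1.
    exists m; split; [by rewrite gt_eqF|by rewrite gtr0_norm|].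
    by apply: cube_upd; apply/andP; split; lra.
  exists (- m); split; [by rewrite oppr_eq0 gt_eqF|by rewrite normrN gtr0_norm|].
  by apply: cube_upd; apply/andP; split; lra.
exists h; apply: hd => //.
by rewrite -ball_normE /ball_ /= sub0r normrN.
Qed.

(** The partial derivative of a function that is differentiable on the cube is
   the derivative of its restriction to the line, one-sided on the faces. *)
Lemma partial_spec f x (i : 'I_K) : differentiable_on_cube f -> unit_cube x ->
  forall e, 0 < e -> exists2 d, 0 < d & forall h, `|h| < d ->
    unit_cube (x + h *: delta_mx 0 i) ->
    `|f (x + h *: delta_mx 0 i) - f x - partial i f x * h| <= e * `|h|.
Proof.
move=> df cx; have [a ha] := df x cx.
have key e : 0 < e -> exists2 d, 0 < d & forall h, `|h| < d ->
    unit_cube (x + h *: delta_mx 0 i) ->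
    `|f (x + h *: delta_mx 0 i) - f x - a 0 i * h| <= e * `|h|.
  move=> e0; move/cvgrPdist_le: ha => /(_ e e0).
  rewrite near_withinE => /nbhs_ballP[d /= d0 hd]; exists d => // h hh ch.
  have [->|h0] := eqVneq h 0.
    by rewrite scale0r addr0 subrr mulr0 subr0 normr0 mulr0.
  pose z := x + h *: (delta_mx 0 i : 'rV[R]_K).
  have zx : z - x = h *: delta_mx 0 i by rewrite /z addrC addKr.
  have nzx : z != x.
    rewrite -subr_eq0 zx scaler_eq0 negb_or h0 /=.
    by apply/eqP => /rowP/(_ i)/eqP; rewrite !mxE !eqxx oner_eq0.
  have bz : ball x d z.
    rewrite -ball_normE /ball_ /= -normrN opprB zx.
    exact: le_lt_trans (norm_scale_delta h i) hh.
  have := hd z bz nzx ch; rewrite sub0r normrN normrM normfV.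
  have nz : 0 < `|z - x| by rewrite normr_gt0 subr_eq0.
  rewrite normr_id ler_pdivrMr // => le1.
  have -> : a 0 i * h = \sum_(j < K) a 0 j * (z 0 j - x 0 j).
    rewrite (bigD1 i) //= big1 ?addr0 => [|j /negPf ji].
      by rewrite !mxE !eqxx /= mulr1 addrC addKr.
    by rewrite !mxE ji /= mulr0 addr0 subrr mulr0.
  apply: (le_trans le1); rewrite ler_wpM2l ?(ltW e0) // zx; exact: norm_scale_delta.
suff -> : partial i f x = a 0 i by [].
have pf := cube_line_proper i cx.
apply: cvg_lim => //; apply/cvgrPdist_le => e e0.
have [d d0 hd] := key e e0.
rewrite near_withinE; apply/nbhs_ballP; exists d => //= h.
rewrite -ball_normE /ball_ /= sub0r normrN => hh h0 ch.
have hp : 0 < `|h| by rewrite normr_gt0.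
rewrite -(ler_pM2l hp) -normrM mulrBr mulVKf // [leRHS]mulrC distrC [h * _]mulrC.
exact: hd.
Qed.

Definition upd x (i : 'I_K) (s : R) : 'rV[R]_K := x + (s - x 0 i) *: delta_mx 0 i.

Lemma updE x i s j : upd x i s 0 j = if j == i then s else x 0 j.
Proof.
rewrite !mxE eqxx /=; case: eqVneq => [->|_]; rewrite ?mulr1 ?mulr0 ?addr0 //.
by rewrite addrC subrK.
Qed.

Lemma upd_cube x i s : unit_cube x -> 0 <= s <= 1 -> unit_cube (upd x i s).
Proof. by move=> cx hs j; rewrite updE; case: ifP. Qed.

Lemma upd_id x i : upd x i (x 0 i) = x.
Proof. by rewrite /upd subrr scale0r addr0. Qed.

(** Differentiability on the unit interval, one-sided at its ends. *)
Definition deriv01 (phi psi : R -> R) : Prop :=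
  forall s, 0 <= s <= 1 -> forall e, 0 < e -> exists2 d, 0 < d &
    forall t, 0 <= t <= 1 -> `|t - s| < d ->
      `|phi t - phi s - psi s * (t - s)| <= e * `|t - s|.

Lemma deriv01_line f x i : differentiable_on_cube f -> unit_cube x ->
  deriv01 (fun s => f (upd x i s)) (fun s => partial i f (upd x i s)).
Proof.
move=> df cx s hs e e0.
have [d d0 hd] := partial_spec i df (upd_cube i cx hs) e0.
exists d => // t ht ts.
have ut : upd x i s + (t - s) *: delta_mx 0 i = upd x i t.
  by rewrite /upd -addrA -scalerDl; congr (_ + _ *: _); ring.
by have := hd (t - s) ts; rewrite ut; apply; apply: upd_cube.
Qed.

End LineRestriction.

Section Taylor.
Context (R : realType).
Implicit Types (phi psi : R -> R).

Lemma deriv01_mean_value phi psi (a b B : R) : 0 <= a -> a < b -> b <= 1 ->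
  deriv01 phi psi -> (forall s, a <= s <= b -> `|psi s| <= B) ->
  `|phi b - phi a| <= B * (b - a).
Proof.
move=> a0 ab b1 dphi hB.
have in01 s : a <= s <= b -> 0 <= s <= 1.
  by move=> /andP[as_ sb]; rewrite (le_trans a0) // (le_trans sb).
have [||c /itvP cab ->] := @MVT R phi psi a b ab.
- move=> x; rewrite in_itv /= => /andP[ax xb].
  have xs : a <= x <= b by rewrite !ltW.
  have cv : (fun h : R => h^-1 *: (phi (h *: (1 : R) + x) - phi x)) @ 0^' --> psi x.
    apply/cvgrPdist_le => e e0; have [d d0 hd] := dphi x (in01 x xs) e e0.
    pose m := Num.min d (Num.min (x - a) (b - x)).
    have m0 : 0 < m by rewrite !lt_min d0 !subr_gt0 ax.
    apply/nbhs_ballP; exists m => //= h; rewrite -ball_normE /ball_ /= sub0r normrN.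
    rewrite !lt_min => /and3P[h1 h2 h3] h0.
    have hp : 0 < `|h| by rewrite normr_gt0.
    have := hd (h + x); rewrite addrK => /(_ _ h1).
    have h01 : 0 <= h + x <= 1.
      apply: in01; move: h2 h3; rewrite !ltr_norml => /andP[? ?] /andP[? ?].
      by apply/andP; split; lra.
    move=> /(_ h01) hh; rewrite -(ler_pM2l hp) -normrM mulrBr.
    rewrite [h * (_ *: _)](_ : _ = phi (h + x) - phi x); last first.
      by rewrite -[_ *: 1]/(h * 1) mulr1 -[_ *: _]/(h^-1 * _) mulVKf.
    by rewrite distrC (mulrC h) [leRHS]mulrC.
  split; first by apply/cvg_ex; exists (psi x).
  by apply: cvg_lim.
- apply/subspace_continuousP => x; rewrite /= in_itv /= => hx.
  have hx1 := in01 x hx.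
  apply/cvgrPdist_le => e e0; have [d d0 hd] := dphi x hx1 1 ltr01.
  pose c := 1 + `|psi x|.
  have c0 : 0 < c by rewrite ltr_wpDr.
  rewrite near_withinE; apply/nbhs_ballP; exists (Num.min d (e / c)) => /=.
    by rewrite lt_min d0 divr_gt0.
  move=> t; rewrite -ball_normE /ball_ /= lt_min distrC => /andP[t1 t2].
  rewrite in_itv /= => tab; have := hd t (in01 t tab) t1; rewrite mul1r => h.
  rewrite distrC -[phi t - phi x](subrK (psi x * (t - x))).
  apply: le_trans (ler_normD _ _) _; rewrite normrM.
  apply: (@le_trans _ _ (c * `|t - x|)); first by rewrite mulrDl mul1r lerD2r.
  by rewrite mulrC -ler_pdivlMr // ltW.
have c_ab : a <= c <= b by rewrite !cab.
by rewrite normrM (ger0_norm (_ : 0 <= b - a)) ?subr_ge0 ?(ltW ab) // ler_wpM2r ?subr_ge0 ?(ltW ab) ?hB.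
Qed.

Lemma deriv01_mean_value_dist phi psi (c s B : R) : 0 <= c <= 1 -> 0 <= s <= 1 ->
  deriv01 phi psi ->
  (forall t, 0 <= t <= 1 -> `|t - c| <= `|s - c| -> `|psi t| <= B) ->
  `|phi s - phi c| <= B * `|s - c|.
Proof.
move=> /andP[c0 c1] /andP[s0 s1] dphi hB.
have [->|sc] := eqVneq s c; first by rewrite !subrr normr0 mulr0.
have [sc'|cs] := ltP s c.
  rewrite distrC [`|s - c|]distrC (gtr0_norm (_ : 0 < c - s)) ?subr_gt0 //.
  apply: (deriv01_mean_value s0 sc' c1 dphi) => t /andP[st tc]; apply: hB.
    by rewrite (le_trans s0) // (le_trans tc).
  by rewrite distrC [leRHS]distrC !ger0_norm ?subr_ge0 ?(ltW sc') // lerD2l lerN2.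
have cs' : c < s by rewrite lt_neqAle eq_sym sc.
rewrite (gtr0_norm (_ : 0 < s - c)) ?subr_gt0 //.
apply: (deriv01_mean_value c0 cs' s1 dphi) => t /andP[ct ts]; apply: hB.
  by rewrite (le_trans c0) // (le_trans ts).
by rewrite !ger0_norm ?subr_ge0 // lerD2r.
Qed.

Lemma deriv01_of_is_derive phi psi :
  (forall s : R, is_derive s 1 phi (psi s)) -> deriv01 phi psi.
Proof.
move=> dphi s _ e e0; have [dv dve] := dphi s.
have : (fun h : R => h^-1 *: (phi (h *: (1 : R) + s) - phi s)) @ 0^' --> psi s.
  by rewrite -dve; exact: dv.
move=> /cvgrPdist_le/(_ e e0)/nbhs_ballP[d /= d0 hd]; exists d => // t _ ts.
have [->|h0] := eqVneq t s; first by rewrite !subrr mulr0 subr0 normr0 mulr0.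
have ts0 : t - s != 0 by rewrite subr_eq0.
have := hd (t - s); rewrite -ball_normE /ball_ /= sub0r normrN => /(_ ts ts0).
rewrite -[(t - s) *: 1]/((t - s) * 1) mulr1 subrK distrC => hh.
have hp : 0 < `|t - s| by rewrite normr_gt0.
rewrite -(ler_pM2l hp) in hh; move: hh; rewrite -normrM mulrBr.
by rewrite -[_ *: _]/(_^-1 * _) mulVKf // (mulrC (t - s)) [leRHS]mulrC.
Qed.

Lemma deriv01B (f1 f2 g1 g2 : R -> R) : deriv01 f1 g1 -> deriv01 f2 g2 ->
  deriv01 (fun s => f1 s - f2 s) (fun s => g1 s - g2 s).
Proof.
move=> h1 h2 s hs e e0; have e2 : 0 < e / 2 by rewrite divr_gt0.
have [d1 d10 hd1] := h1 s hs _ e2; have [d2 d20 hd2] := h2 s hs _ e2.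
exists (Num.min d1 d2); first by rewrite lt_min d10.
move=> t ht; rewrite lt_min => /andP[t1 t2].
have -> : f1 t - f2 t - (f1 s - f2 s) - (g1 s - g2 s) * (t - s) =
  (f1 t - f1 s - g1 s * (t - s)) - (f2 t - f2 s - g2 s * (t - s)) by ring.
apply: le_trans (ler_normB _ _) _; rewrite {1}(splitr e) mulrDl.
by apply: lerD; [apply: hd1|apply: hd2].
Qed.

Lemma is_derive_taylor_polynomial (a : nat -> R) (c s : R) k :
  is_derive s (1 : R) (fun s => \sum_(j < k.+1) a j / j`!%:R * (s - c) ^+ j)
    (\sum_(j < k) a j.+1 / j`!%:R * (s - c) ^+ j).
Proof.
have term j : is_derive s (1 : R) (fun s => a j / j`!%:R * (s - c) ^+ j)
    (a j / j`!%:R * (j%:R * (s - c) ^+ j.-1)).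
  have h := @is_deriveX R R (fun s => s - c) j s 1 1.
  case: j h => [|j] h.
    rewrite mul0r mulr0; exact: (is_derive_cst (a 0 / 0`!%:R * 1 : R) s (1 : R)).
  have hb : is_derive s (1 : R) (fun s => s - c) 1.
    by apply: is_derive_eq; rewrite subr0.
  have hz := is_deriveZ (a j.+1 / j.+1`!%:R) (h hb).
  have -> : a j.+1 / j.+1`!%:R * (j.+1%:R * (s - c) ^+ j) =
    (a j.+1 / j.+1`!%:R) *: (j.+1%:R *: (s - c) ^+ j *: (1 : R)).
    by rewrite -[_ *: 1]/(_ * 1) mulr1.
  have <- : a j.+1 / j.+1`!%:R \*: (fun s : R => s - c) ^+ j.+1 =
      (fun s => a j.+1 / j.+1`!%:R * (s - c) ^+ j.+1).
    by apply/funext => z; rewrite /= exprfctE.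
  exact: hz.
have := @is_derive_sum _ _ _ k.+1 (fun j s => a j / j`!%:R * (s - c) ^+ j) s 1
  (fun j => a j / j`!%:R * (j%:R * (s - c) ^+ j.-1)) (fun j => term j).
move=> h; have e : \sum_(j < k.+1) (fun s => a j / j`!%:R * (s - c) ^+ j) =
   (fun s => \sum_(j < k.+1) a j / j`!%:R * (s - c) ^+ j).
  by apply/funext => z; rewrite fct_sumE.
rewrite e in h; apply: (is_derive_eq h).
rewrite big_ord_recl mul0r mulr0 add0r; apply: eq_bigr => j _ /=.
have j0 : j.+1%:R != 0 :> R by rewrite pnatr_eq0.
have f0 : j`!%:R != 0 :> R by rewrite pnatr_eq0 -lt0n fact_gt0.
rewrite /bump /= add1n factS natrM.
move: (j.+1%:R : R) j0 (j`!%:R : R) f0 => J J0 F F0; field.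
by rewrite F0 J0.
Qed.

(** Taylor's inequality on the unit interval; the factorial of the order is
   dropped from the remainder. *)
Lemma taylor01 k (phi : nat -> R -> R) gamma (s c : R) :
  (forall j, (j < k)%N -> deriv01 (phi j) (phi j.+1)) ->
  (forall t, 0 <= t <= 1 -> `|phi k t| <= gamma) -> 0 <= s <= 1 -> 0 <= c <= 1 ->
  `|phi 0 s - \sum_(j < k) phi j c / j`!%:R * (s - c) ^+ j| <= gamma * `|s - c| ^+ k.
Proof.
move=> + + + hc; elim: k phi s => [|k ih] phi s dphi hg hs.
  by rewrite big_ord0 subr0 expr0 mulr1 hg.
pose T s := \sum_(j < k.+1) phi j c / j`!%:R * (s - c) ^+ j.
pose T' s := \sum_(j < k) phi j.+1 c / j`!%:R * (s - c) ^+ j.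
have dT : deriv01 T T'.
  by apply: deriv01_of_is_derive => t; exact: (is_derive_taylor_polynomial (fun j => phi j c)).
have dpsi := deriv01B (dphi 0 isT) dT.
have Tc : T c = phi 0 c.
  rewrite /T big_ord_recl subrr expr0 mulr1 fact0 divr1 big1 ?addr0 // => j _.
  by rewrite expr0n mulr0.
have psi_bd t : 0 <= t <= 1 -> `|t - c| <= `|s - c| ->
    `|phi 1 t - T' t| <= gamma * `|s - c| ^+ k.
  move=> ht tc; have g0 : 0 <= gamma by apply: le_trans (hg t ht).
  have := ih (fun j => phi j.+1) t (fun j jk => dphi j.+1 jk) hg ht.
  by move=> /le_trans; apply; rewrite ler_wpM2l // lerXn2r ?nnegrE.
have := deriv01_mean_value_dist hc hs dpsi psi_bd.
by rewrite Tc subrr subr0 exprSr mulrA.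
Qed.

End Taylor.

(** * Low rank approximation of smooth matrices *)

Section LowRank.
Context (R : realType) (K : nat).
Implicit Types (f : 'rV[R]_K -> R) (s : seq 'I_K) (m : 'I_K -> nat).

Lemma times_differentiable_iter k l (i : 'I_K) f : (l <= k)%N ->
  times_differentiable k f -> times_differentiable (k - l) (iter l (partial i) f).
Proof.
elim: l => [|l ih] lk hf; first by rewrite subn0.
have := ih (ltnW lk) hf.
by rewrite -[(k - l)%N]prednK ?subn_gt0 // -subnS => -[_ /(_ i)].
Qed.

Lemma differentiable_iter k l (i : 'I_K) f : (l < k)%N ->
  times_differentiable k f -> differentiable_on_cube (iter l (partial i) f).
Proof.
move=> lk hf; have := times_differentiable_iter i (ltnW lk) hf.
by rewrite -[(k - l)%N]prednK ?subn_gt0 // => -[].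
Qed.

(** For [s = enum 'I_K] this is [mpartial]; an induction can shorten the list. *)
Definition partials s m f : 'rV[R]_K -> R :=
  foldr (fun i g => iter (m i) (partial i) g) f s.

Lemma partials_rcons s i m f :
  partials (rcons s i) m f = partials s m (iter (m i) (partial i) f).
Proof. by rewrite /partials foldr_rcons. Qed.

Lemma eq_partials s m m' f : {in s, m =1 m'} -> partials s m f = partials s m' f.
Proof.
elim: s => //= i s ih h; rewrite (h i) ?mem_head // ih // => j js.
by apply: h; rewrite inE js orbT.
Qed.

Lemma partials0 s m f : {in s, forall i, m i = 0%N} -> partials s m f = f.
Proof.
elim: s => //= i s ih h; rewrite (h i) ?mem_head //= ih // => j js.
by apply: h; rewrite inE js orbT.
Qed.

(** The rank of a Taylor expansion of order [k] in [a] variables, and its error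
   in units of the remainder, for expansions in one variable at a time. *)
Fixpoint taylor_rank (a k : nat) : nat :=
  if a is a'.+1 then (\sum_(l < k) taylor_rank a' (k - l))%N else 1.

Fixpoint taylor_error (a k : nat) : nat :=
  if a is a'.+1 then (1 + \sum_(l < k) taylor_error a' (k - l))%N else 0.

(** Near a point [c], smooth functions are close to a space of small dimension,
   that is, the matrix of their values is close to one of small rank. The
   expansion in one coordinate at a time, beginning with the innermost
   derivative, avoids any exchange of partial derivatives. The coordinates that
   remain to be expanded are those of [s]. *)
Lemma taylor_low_rank n p s k (g : 'I_p -> 'rV[R]_K -> R)
    (theta : 'I_n -> 'rV[R]_K) (c : 'rV[R]_K) (Q : pred 'I_n) (gamma delta : R) :
  uniq s -> 0 <= gamma -> 0 <= delta ->
  (forall j, times_differentiable k (g j)) ->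
  (forall j m, (\sum_(i <- s) m i = k)%N ->
     forall x, unit_cube x -> `|partials s m (g j) x| <= gamma) ->
  unit_cube c ->
  (forall i, Q i -> unit_cube (theta i)) ->
  (forall i l, Q i -> l \notin s -> theta i 0 l = c 0 l) ->
  (forall i l, Q i -> `|theta i 0 l - c 0 l| <= delta) ->
  exists A : 'M[R]_(n, p), (\rank A <= taylor_rank (size s) k)%N /\
    forall i j, Q i ->
      `|g j (theta i) - A i j| <= gamma * (taylor_error (size s) k)%:R * delta ^+ k.
Proof.
move=> + g0 d0 + + cc; elim/last_ind: s k g theta => [|s i0 ih] k g theta.
  move=> _ _ _ _ hc _; exists ((const_mx 1 : 'cV_n) *m \row_j g j c).
  split; first exact: mulmx_max_rank.
  move=> i j Qi; have -> : theta i = c by apply/rowP => l; apply: hc.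
  by rewrite mxE big_ord1 !mxE mul1r subrr normr0 mulr0 mul0r.
rewrite rcons_uniq size_rcons => /andP[i0s us] dg hb tc hc hd.
have c01 : 0 <= c 0 i0 <= 1 := cc i0.
pose theta' i := upd (theta i) i0 (c 0 i0).
have tc' i : Q i -> unit_cube (theta' i) by move=> Qi; apply: upd_cube (tc i Qi) c01.
have step (l : 'I_k) : exists A : 'M[R]_(n, p), (\rank A <= taylor_rank (size s) (k - l))%N /\
    forall i j, Q i -> `|iter l (partial i0) (g j) (theta' i) - A i j| <=
      gamma * (taylor_error (size s) (k - l))%:R * delta ^+ (k - l).
  apply: (ih (k - l)%N (fun j => iter l (partial i0) (g j)) theta' us).
  - by move=> j; apply: times_differentiable_iter (dg j); apply: ltnW.
  - move=> j m hm x cx; pose m' i := if i == i0 then (l : nat) else m i.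
    have mm' : {in s, m =1 m'}.
      by move=> i si; rewrite /m'; case: eqP => // ii; rewrite -ii si in i0s.
    have m'i0 : m' i0 = l by rewrite /m' eqxx.
    have := hb j m'; rewrite partials_rcons m'i0 -(eq_partials _ mm'); apply => //.
    rewrite -cats1 big_cat big_seq1 /= m'i0.
    have -> : (\sum_(i <- s) m' i = \sum_(i <- s) m i)%N.
      by rewrite !big_seq; apply: eq_bigr => i /mm'.
    by rewrite hm subnK // ltnW.
  - exact: tc'.
  - move=> i l' Qi l's; rewrite updE; case: eqP => [->//|/eqP l'i].
    by apply: hc; rewrite // mem_rcons inE negb_or l'i.
  - move=> i l' Qi; rewrite updE; case: eqP => [->|_]; last exact: hd.
    by rewrite subrr normr0.
have [A hA] := choice step.
pose w (l : 'I_k) : 'rV[R]_n := \row_i ((theta i 0 i0 - c 0 i0) ^+ l / l`!%:R).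
exists (\sum_(l < k) diag_mx (w l) *m A l); split.
  apply: leq_trans (mxrank_sum _ _ _) _; apply: leq_sum => l _.
  exact: leq_trans (mxrankM_maxr _ _) (hA l).1.
move=> i j Qi.
have tay : `|g j (theta i) - \sum_(l < k) iter l (partial i0) (g j) (theta' i) / l`!%:R *
    (theta i 0 i0 - c 0 i0) ^+ l| <= gamma * `|theta i 0 i0 - c 0 i0| ^+ k.
  have := @taylor01 R k (fun l t => iter l (partial i0) (g j) (upd (theta i) i0 t))
    gamma (theta i 0 i0) (c 0 i0).
  rewrite upd_id; apply=> //.
  - move=> l lk; apply: deriv01_line (tc i Qi).
    exact: differentiable_iter lk (dg j).
  - move=> t ht; pose m l := if l == i0 then k else 0%N.
    have m0 : {in s, forall l, m l = 0%N}.
      by move=> l sl; rewrite /m; case: eqP => // ll; rewrite -ll sl in i0s.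
    have mi0 : m i0 = k by rewrite /m eqxx.
    have := hb j m; rewrite partials_rcons mi0 partials0 //; apply.
      rewrite -cats1 big_cat big_seq1 /= mi0 big1_seq ?add0n // => l /m0 //.
    exact: upd_cube (tc i Qi) ht.
  - exact: tc.
have dk : `|theta i 0 i0 - c 0 i0| <= delta by apply: hd.
have AE : (\sum_(l < k) diag_mx (w l) *m A l) i j =
    \sum_(l < k) A l i j / l`!%:R * (theta i 0 i0 - c 0 i0) ^+ l.
  rewrite summxE; apply: eq_bigr => l _; rewrite mul_diag_mx !mxE.
  by rewrite mulrC mulrA mulrAC.
rewrite AE.
set S1 := \sum_(l < k) _ in tay; set S2 := \sum_(l < k) _.
have S12 : `|S1 - S2| <= \sum_(l < k) gamma * (taylor_error (size s) (k - l))%:R * delta ^+ k.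
  rewrite -sumrB; apply: le_trans (ler_norm_sum _ _ _) _; apply: ler_sum => l _.
  rewrite -mulrBl -mulrBl !normrM.
  have -> : delta ^+ k = delta ^+ (k - l) * delta ^+ l by rewrite -exprD subnK // ltnW.
  rewrite mulrA normrX; apply: ler_pM => //.
  - rewrite -[leRHS]mulr1; apply: ler_pM => //; first exact: (hA l).2.
    rewrite normfV normr_nat invf_le1 ?ltr0n ?fact_gt0 // ler1n fact_gt0 //.
  - by rewrite lerXn2r ?nnegrE.
rewrite -[g j (theta i)](subrK S1) -addrA; apply: le_trans (ler_normD _ _) _.
apply: le_trans (lerD tay S12) _ => /=.
rewrite natrD natr_sum mulrDr mulr1 mulrDl; apply: lerD.
  by rewrite ler_wpM2l // lerXn2r ?nnegrE.
by rewrite mulr_sumr mulr_suml.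
Qed.

Definition cell q (x : R) : 'I_q.+1 := inord (minn (Num.truncn (x * q.+1%:R)) q).

Lemma cell_dist q (x : R) : 0 <= x <= 1 ->
  `|x - (cell q x)%:R / q.+1%:R| <= q.+1%:R^-1.
Proof.
move=> /andP[x0 x1]; have q0 : 0 < q.+1%:R :> R by rewrite ltr0n.
have cE : cell q x = minn (Num.truncn (x * q.+1%:R)) q :> nat.
  by rewrite /cell inordK // ltnS geq_minr.
have -> : x - (cell q x)%:R / q.+1%:R = (x * q.+1%:R - (cell q x)%:R) / q.+1%:R.
  by rewrite mulrBl mulfK // gt_eqF.
rewrite normrM [`|_^-1|]gtr0_norm ?invr_gt0 // ler_piMl ?invr_ge0 ?(ltW q0) // cE.
have xq : 0 <= x * q.+1%:R by rewrite mulr_ge0 // ltW.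
have := truncn_itv xq => /andP[t1 t2].
case: (leqP (Num.truncn (x * q.+1%:R)) q) => h.
  by rewrite ger0_norm ?subr_ge0 // lerBlDr addrC natr1 ltW.
have xq1 : x * q.+1%:R <= q.+1%:R by rewrite ler_piMl // ltW.
have qx : q%:R <= x * q.+1%:R by apply: le_trans t1; rewrite ler_nat ltnW.
by rewrite ger0_norm ?subr_ge0 // lerBlDr addrC natr1.
Qed.

(** The rows whose latent vectors lie in a common cell of side [1 / q.+1] share
   a Taylor approximation of bounded rank, and the ranks of the cells add up. *)
Lemma smooth_matrix_low_rank n p L gamma (M : 'M[R]_(n, p)) q :
  0 <= gamma -> smooth_matrix L gamma K M ->
  exists A : 'M[R]_(n, p), (\rank A <= q.+1 ^ K * taylor_rank K L)%N /\
    forall i j, `|M i j - A i j| <= gamma * (taylor_error K L)%:R * q.+1%:R^-1 ^+ L.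
Proof.
move=> g0 [f [theta [hf ctheta ME]]].
pose kap i : {ffun 'I_K -> 'I_q.+1} := [ffun k => cell q (theta i k)].
pose c (z : {ffun 'I_K -> 'I_q.+1}) : 'rV[R]_K := \row_k ((z k)%:R / q.+1%:R).
have q0 : 0 < q.+1%:R :> R by rewrite ltr0n.
have cc z : unit_cube (c z).
  move=> k; rewrite mxE divr_ge0 ?ler0n //= ler_pdivrMr // mul1r ler_nat.
  exact: ltnW.
have szK : size (enum 'I_K) = K by rewrite size_enum_ord.
have loc (z : {ffun 'I_K -> 'I_q.+1}) : exists A : 'M[R]_(n, p), (\rank A <= taylor_rank K L)%N /\
    forall i j, kap i == z ->
     `|f j (row i theta) - A i j| <= gamma * (taylor_error K L)%:R * q.+1%:R^-1 ^+ L.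
  have := @taylor_low_rank n p (enum 'I_K) L f (fun i => row i theta) (c z)
    (fun i => kap i == z) gamma q.+1%:R^-1.
  rewrite szK; apply=> //.
  - exact: enum_uniq.
  - by move=> j; have [] := hf j.
  - move=> j m hm; have [_ h] := hf j; apply: h; rewrite -hm.
    by rewrite big_enum.
  - by move=> i l _; rewrite mem_enum.
  - move=> i l /eqP <-; rewrite !mxE ffunE; apply: cell_dist.
    by have := ctheta i l; rewrite mxE.
have [A hA] := choice loc.
exists (\sum_z diag_mx (\row_i (kap i == z)%:R) *m A z); split.
  apply: leq_trans (mxrank_sum _ _ _) _.
  apply: (@leq_trans (\sum_(z : {ffun 'I_K -> 'I_q.+1}) taylor_rank K L)%N).
    by apply: leq_sum => z _; exact: leq_trans (mxrankM_maxr _ _) (hA z).1.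
  by rewrite sum_nat_const card_ffun !card_ord.
move=> i j; rewrite ME summxE (bigD1 (kap i)) //= big1 => [|z zi].
  by rewrite addr0 mul_diag_mx !mxE eqxx mul1r; apply: (hA (kap i)).2.
by rewrite mul_diag_mx !mxE eq_sym (negPf zi) mul0r.
Qed.

End LowRank.

(** * Optimal accuracy *)

Section Rates.
Context {R : realType}.
Variables (L K : nat).
Hypotheses (L0 : (0 < L)%N) (K0 : (0 < K)%N).
Variables n p N : nat.
Hypotheses (n0 : (0 < n)%N) (p0 : (0 < p)%N) (N0 : (0 < N)%N).
Local Notation r := (base_rate n p N : R).
Local Notation e := (eps_opt L K n p N : R).
Local Notation s := (K%:R / L%:R : R).

Lemma base_rate_gt0 : 0 < r.
Proof.
rewrite /base_rate; apply: divr_gt0; last by rewrite ltr0n.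
apply: mulr_gt0; first by rewrite ltr0n leq_max n0.
by rewrite ln_gt0 // ltr1n (leq_add n0 p0).
Qed.

Lemma eps_opt_gt0 : 0 < e.
Proof. by rewrite powR_gt0 // base_rate_gt0. Qed.

Lemma eps_opt_balance : r * e `^ (- s) = e ^+ 2.
Proof.
have L2 : (2 * L + K)%:R != 0 :> R by rewrite pnatr_eq0 addn_eq0 negb_and -!lt0n K0 orbT.
have L1 : L%:R != 0 :> R by rewrite pnatr_eq0 -lt0n.
rewrite /eps_opt -powRrM -powR_mulrn ?powR_ge0 // -powRrM.
rewrite -{1}[r]powRr1 ?(ltW base_rate_gt0) // -powRD; last first.
  by rewrite (gt_eqF base_rate_gt0) implybT.
congr (_ `^ _); rewrite natrD natrM in L2 *; field.
by rewrite L1 andbT.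
Qed.

Lemma powR_antitone (x y t : R) : 0 < x -> x <= y -> 0 <= t ->
  y `^ (- t) <= x `^ (- t).
Proof.
move=> x0 xy t0; have y0 := lt_le_trans x0 xy.
rewrite !powRN lef_pV2 ?posrE ?powR_gt0 //.
by apply: ge0_ler_powR; rewrite ?nnegrE ?(ltW x0) ?(ltW y0).
Qed.

(** Both terms are monotone in [eps], in opposite directions, and they agree at
   [eps_opt], which is therefore optimal up to the factor 2. *)
Lemma eps_opt_optimal (eps : R) : 0 < eps ->
  r * e `^ (- s) + e ^+ 2 <= 2 * (r * eps `^ (- s) + eps ^+ 2).
Proof.
move=> eps0; rewrite eps_opt_balance -mulr2n -[_ *+ 2]mulr_natl ler_wpM2l //.
have r0 := base_rate_gt0; have e0 := eps_opt_gt0.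
have [ee|ee] := leP e eps.
  by rewrite -[leLHS]add0r lerD ?lerXn2r ?nnegrE ?(ltW e0) ?(ltW eps0) // mulr_ge0 ?powR_ge0 ?ltW.
rewrite -[leLHS]addr0 lerD ?sqr_ge0 // -eps_opt_balance ler_wpM2l ?(ltW r0) //.
by apply: powR_antitone => //; rewrite ?ltW // divr_ge0.
Qed.

(** As for the power law itself, except that the lower bound on [J] is available
   near zero only; this suffices because above [eps_opt] the term [eps ^+ 2]
   alone is large enough. *)
Lemma upper_bound_optimal (C2 c1 c2 eps0 : R) (J : R -> \bar R) :
  0 < C2 -> 0 < c1 -> 0 < c2 ->
  let c := C2 ^+ 2 * ((1 + Num.sqrt 2) / 2) ^+ 2 in
  (forall eps, 0 < eps -> (0 <= J eps)%E) ->
  (forall eps, 0 < eps < eps0 ->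
     ((c1 * eps `^ (- s))%:E <= J eps <= (c2 * eps `^ (- s))%:E)%E) ->
  e < eps0 -> forall eps, 0 < eps ->
  (upper_bound C2 J n p N e <=
   ((c * c2 + 1) * (1 + (c * c1)^-1))%:E * upper_bound C2 J n p N eps)%E.
Proof.
move=> C20 c10 c20 c J0 hJ ee0 eps epsp.
have c0 : 0 < c.
  by rewrite mulr_gt0 ?exprn_gt0 // divr_gt0 // ltr_wpDr ?sqrtr_ge0.
have r0 := base_rate_gt0; have e0 := eps_opt_gt0.
have cr0 : 0 < c * r by rewrite mulr_gt0.
have crJ0 x : 0 < x -> (0 <= (c * r)%:E * J x)%E.
  by move=> x0; rewrite mule_ge0 ?J0 // lee_fin ltW.
have e2 : 0 < e ^+ 2 by rewrite exprn_gt0.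
have cc1 : 0 < c * c1 by rewrite mulr_gt0.
have up : (upper_bound C2 J n p N e <= ((c * c2 + 1) * e ^+ 2)%:E)%E.
  have /andP[_ h] : ((c1 * e `^ (- s))%:E <= J e <= (c2 * e `^ (- s))%:E)%E.
    by apply: hJ; rewrite e0.
  apply: (@le_trans _ _ ((c * r)%:E * (c2 * e `^ (- s))%:E + (e ^+ 2)%:E)%E).
    by rewrite leeD2r // lee_wpmul2l // lee_fin ltW.
  rewrite -EFinM -EFinD lee_fin -{2}eps_opt_balance le_eqVlt; apply/orP; left.
  by apply/eqP; rewrite -eps_opt_balance; ring.
apply: le_trans up _.
have low : ((e ^+ 2)%:E <= (1 + (c * c1)^-1)%:E * upper_bound C2 J n p N eps)%E.
  have k0 : 0 < (c * c1)^-1 by rewrite invr_gt0.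
  have [ee|ee] := leP e eps.
    apply: (@le_trans _ _ (1%:E * (eps ^+ 2)%:E)%E).
      by rewrite mul1e lee_fin lerXn2r ?nnegrE ?(ltW e0) ?(ltW epsp).
    apply: lee_pmul; rewrite ?lee_fin ?sqr_ge0 //; first by rewrite lerDl ltW.
    by rewrite leeDr // crJ0.
  have /andP[h _] : ((c1 * eps `^ (- s))%:E <= J eps <= (c2 * eps `^ (- s))%:E)%E.
    by apply: hJ; rewrite epsp (lt_trans ee).
  apply: (@le_trans _ _ (((c * c1)^-1)%:E * ((c * r)%:E * (c1 * e `^ (- s))%:E))%E).
    rewrite -!EFinM lee_fin -eps_opt_balance le_eqVlt; apply/orP; left; apply/eqP.
    by field; rewrite !gt_eqF.
  apply: lee_pmul.
  - by rewrite lee_fin ltW.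
  - by rewrite mule_ge0 ?lee_fin ?(ltW cr0) // mulr_ge0 ?powR_ge0 ?(ltW c10).
  - by rewrite lee_fin lerDr.
  apply: (@le_trans _ _ ((c * r)%:E * J eps)%E).
    apply: lee_wpmul2l; first by rewrite lee_fin ltW.
    apply: le_trans h; rewrite lee_fin ler_wpM2l ?(ltW c10) //.
    by apply: powR_antitone => //; rewrite ?ltW // divr_ge0.
  by rewrite leeDl // lee_fin sqr_ge0.
rewrite !EFinM -muleA; apply: lee_wpmul2l low.
by rewrite lee_fin addr_ge0 // mulr_ge0 ?ltW.
Qed.

End Rates.

(** * The approximation number *)

Section ApproximationNumber.
Context {R : realType}.
Implicit Types (L K : nat).

Definition constant_on_cube K (c : R) (f : 'rV[R]_K -> R) : Prop :=
  forall x, unit_cube x -> f x = c.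

Lemma partial_constant K (i : 'I_K) c f : constant_on_cube c f ->
  constant_on_cube 0 (partial i f).
Proof.
move=> fc x cx; have pf := cube_line_proper i cx.
apply: cvg_lim => //; apply/cvgrPdist_le => e e0.
rewrite near_withinE; near=> h => ch.
by rewrite fc // fc // subrr mulr0 subr0 normr0 ltW.
Unshelve. all: by end_near. Qed.

Lemma differentiable_constant K c (f : 'rV[R]_K -> R) : constant_on_cube c f ->
  differentiable_on_cube f.
Proof.
move=> fc x cx; exists 0; apply/cvgrPdist_le => e e0.
rewrite near_withinE; near=> y => cy.
rewrite fc // fc // subrr big1 => [|i _]; last by rewrite mxE mul0r.
by rewrite subr0 mul0r subr0 normr0 ltW.
Unshelve. all: by end_near. Qed.

Lemma times_differentiable_constant K L c (f : 'rV[R]_K -> R) :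
  constant_on_cube c f -> times_differentiable L f.
Proof.
elim: L c f => //= L ih c f fc; split; first exact: differentiable_constant fc.
by move=> i; apply: ih (partial_constant i fc).
Qed.

Lemma partials_constant K (s : seq 'I_K) m c (f : 'rV[R]_K -> R) :
  constant_on_cube c f -> (0 < \sum_(i <- s) m i)%N ->
  constant_on_cube 0 (partials s m f).
Proof.
move=> fc; suff [c' hc' h] : exists2 c', constant_on_cube c' (partials s m f) &
    (0 < \sum_(i <- s) m i)%N -> c' = 0 by move=> /h <-.
elim: s => [|i s [c' hc' h]]; first by exists c; rewrite ?big_nil.
have iter0 l c1 g : constant_on_cube c1 g ->
    exists2 c2, constant_on_cube c2 (iter l (@partial R K i) g) & ((0 < l)%N -> c2 = 0) /\ (l = 0%N -> c2 = c1).
  by elim: l => [|l ih] gc; [exists c1|have [c2 h2 _] := ih gc; exists 0 => //; exact: partial_constant h2].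
have [c2 h2 [hl h0]] := iter0 (m i) _ _ hc'; exists c2 => //.
rewrite big_cons; have [mi|/hl //] := posnP (m i).
by rewrite mi add0n (h0 mi).
Qed.

Lemma smooth_class_constant L gamma K c : (0 < L)%N -> 0 <= gamma ->
  @smooth_class R L gamma K (fun=> c).
Proof.
move=> L0 g0; have cc : @constant_on_cube K c (fun=> c) by [].
split; first exact: times_differentiable_constant cc.
move=> m mL x cx; rewrite -[mpartial m _]/(partials (enum 'I_K) m _).
by rewrite (partials_constant cc) ?normr0 // big_enum mL.
Qed.

(** The class contains every constant, whereas bounded coefficients only reach
   bounded functions: no finite family qualifies. *)
Lemma Jstar_pinfty L gamma K (C0 eps : R) : (0 < L)%N -> 0 <= gamma -> 0 < C0 ->
  Jstar L gamma K C0 eps = +oo%E.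
Proof.
move=> L0 g0 C00; rewrite /Jstar (_ : image _ _ = set0) ?ereal_inf0 //.
rewrite predeqE => z; split => // -[J [psi [_ _ psiC approx]] _].
have [beta [bC hb]] := approx _ (smooth_class_constant K (`|eps| + J%:R * ((1 + C0) * C0) + 1) L0 g0).
pose x : 'rV[R]_K := 0.
have cx : unit_cube x by move=> i; rewrite mxE lexx ler01.
have := hb x cx; rewrite leNgt => /negP; apply.
have b1 l : `|beta l| <= 1 + C0.
  have bl : beta l ^+ 2 <= C0.
    apply: le_trans bC; rewrite (bigD1 l) //= lerDl.
    by apply: sumr_ge0 => k _; rewrite sqr_ge0.
  rewrite leNgt; apply/negP => lt.
  have : (1 + C0) ^+ 2 < `|beta l| ^+ 2 by rewrite ltr_sqr ?nnegrE // addr_ge0 ?ltW.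
  rewrite real_normK ?num_real // => /lt_le_trans/(_ bl); nra.
have sm : `|\sum_(l < J) beta l * psi l x| <= J%:R * ((1 + C0) * C0).
  apply: le_trans (ler_norm_sum _ _ _) _.
  apply: (@le_trans _ _ (\sum_(l < J) (1 + C0) * C0)).
    by apply: ler_sum => l _; rewrite normrM ler_pM // psiC.
  by rewrite sumr_const card_ord mulr_natl.
have := ler_norm (\sum_(l < J) beta l * psi l x); have := ler_norm eps.
set S := \sum_(l < J) _ in sm *; set b := J%:R * _ in sm *.
have := ler_norm (`|eps| + b + 1 - S); lra.
Qed.

Lemma upper_bound_pinfty L gamma K (C0 C2 eps : R) n p N :
  (0 < L)%N -> 0 <= gamma -> 0 < C0 -> 0 < C2 ->
  (0 < n)%N -> (0 < p)%N -> (0 < N)%N ->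
  upper_bound C2 (Jstar L gamma K C0) n p N eps = +oo%E.
Proof.
move=> L0 g0 C00 C20 n0 p0 N0; rewrite /upper_bound Jstar_pinfty //.
rewrite gt0_muley ?addye // lte_fin mulr_gt0 ?(base_rate_gt0 n0 p0 N0) //.
by rewrite mulr_gt0 ?exprn_gt0 // divr_gt0 // ltr_wpDr ?sqrtr_ge0.
Qed.

End ApproximationNumber.

(** * Oracle inequality and measurability of the loss *)

Section Estimator.
Context {R : realType}.

(** Unique factorization identifies the eigenvalues with [d] up to order. *)
Lemma nuclear_normE n p (A : 'M[R]_(n, p)) V d : gram_spectral A V d ->
  nuclear_norm A = \sum_i Num.sqrt (d 0 i).
Proof.
move=> h; rewrite /nuclear_norm /eigenvalues.
set S := [set s | _].
pose s0 := [seq d 0 i | i <- enum 'I_p].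
have hs0 : S s0 by rewrite /S /= (gram_char_poly h) big_map big_enum.
have : S (xget [::] S) by apply: (xgetPex _ (ex_intro _ s0 hs0)).
rewrite {1}/S /= hs0 => /esym/prod_XsubC_eq pe.
by rewrite (perm_big _ pe) big_map big_enum.
Qed.

Lemma frobenius_sqr n p (A : 'M[R]_(n, p)) : frobenius A ^+ 2 = ip A A.
Proof.
rewrite /frobenius sqr_sqrtr ?ipE; last by do 2 apply: sumr_ge0 => ? _; rewrite sqr_ge0.
by apply: eq_bigr => i _; apply: eq_bigr => j _; rewrite expr2.
Qed.

Definition mean_data n p N (y : 'I_N -> R) (X : 'I_N -> 'M[R]_(n, p)) : 'M[R]_(n, p) :=
  N%:R^-1 *: (\sum_t y t *: X t).

Lemma objectiveE n p N lam y (X : 'I_N -> 'M[R]_(n, p)) A V d :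
  gram_spectral A V d ->
  objective lam y X A = (n * p)%:R^-1 * ip A A - 2 * ip (mean_data y X) A
    + lam * \sum_i Num.sqrt (d 0 i).
Proof.
move=> h; rewrite /objective frobenius_sqr (nuclear_normE h).
rewrite -[inner _ _]/(ip _ _) -scalerA ipZl //.
Qed.

Lemma estimator_oracle n p N lam y (X : 'I_N -> 'M[R]_(n, p)) (M Mh A : 'M[R]_(n, p)) :
  (0 < n)%N -> (0 < p)%N -> 0 < lam ->
  is_estimator lam y X Mh ->
  opbd (mean_data y X - (n * p)%:R^-1 *: M) (lam / 2) ->
  loss Mh M <= 3 * loss A M + 18 * ((n * p)%:R * lam ^+ 2 * (\rank A)%:R).
Proof.
move=> n0 p0 lam0 est hop.
have [VA [dA hA]] := exists_gram_spectral A.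
have [VM [dM hM]] := exists_gram_spectral Mh.
have mu0 : 0 < (n * p)%:R^-1 :> R by rewrite invr_gt0 ltr0n muln_gt0 n0.
have basic := est A; rewrite (objectiveE _ _ _ hA) (objectiveE _ _ _ hM) in basic.
have YE : mean_data y X = (n * p)%:R^-1 *: M + (mean_data y X - (n * p)%:R^-1 *: M).
  by rewrite addrC subrK.
rewrite YE in basic.
have := oracle_inequality hA hM mu0 lam0 hop basic.
by rewrite /loss !frobenius_sqr invrK [lam ^+ 2 * _]mulrC.
Qed.

Lemma estimator_lipschitz n p N lam y y' (X X' : 'I_N -> 'M[R]_(n, p)) (A B : 'M[R]_(n, p)) :
  (0 < n)%N -> (0 < p)%N -> 0 <= lam ->
  is_estimator lam y X A -> is_estimator lam y' X' B ->
  (n * p)%:R^-1 ^+ 2 * ip (A - B) (A - B) <=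
  4 * ip (mean_data y X - mean_data y' X') (mean_data y X - mean_data y' X').
Proof.
move=> n0 p0 lam0 eA eB.
have [VA [dA hA]] := exists_gram_spectral A.
have [VB [dB hB]] := exists_gram_spectral B.
have [VC [dC hC]] := exists_gram_spectral (2^-1 *: (A + B)).
have mu0 : 0 < (n * p)%:R^-1 :> R by rewrite invr_gt0 ltr0n muln_gt0 n0.
have := eA (2^-1 *: (A + B)); have := eB (2^-1 *: (A + B)).
rewrite !(objectiveE _ _ _ hA, objectiveE _ _ _ hB, objectiveE _ _ _ hC) => bB bA.
exact: (minimizer_lipschitz hA hB hC mu0 lam0 bA bB).
Qed.

End Estimator.

Section Measurability.
Context d (T : measurableType d) (R : realType).

(** A lower semicontinuous function of finitely many measurable functions:
   its superlevel sets are countable unions of rational boxes. *)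
Lemma measurable_semicontinuous n p (Y : T -> 'M[R]_(n, p)) (f : T -> R) c :
  measurable_mx Y ->
  (forall w, c < f w -> exists2 e, 0 < e &
    forall w', (forall i j, `|Y w i j - Y w' i j| < e) -> c < f w') ->
  measurable [set w | c < f w].
Proof.
move=> mY hf.
pose box (Qk : 'M[rat]_(n, p) * nat) : set T :=
  [set w | forall i j, `|Y w i j - ratr (Qk.1 i j)| < Qk.2.+1%:R^-1].
have mbox Qk : measurable (box Qk).
  have -> : box Qk = \bigcap_(ij in [set: 'I_n * 'I_p])
      [set w | `|Y w ij.1 ij.2 - ratr (Qk.1 ij.1 ij.2)| < Qk.2.+1%:R^-1].
    rewrite predeqE => w; split=> [h ij _|h i j]; first exact: h.
    exact: (h (i, j) Logic.I).
  apply: fin_bigcap_measurable => // -[i j] _ /=.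
  have mf : measurable_fun setT (fun w => `|Y w i j - ratr (Qk.1 i j)|).
    by apply: measurableT_comp => //; apply: measurable_funB => //; exact: mY.
  have := mf measurableT [set` `]-oo, Qk.2.+1%:R^-1[] (measurable_itv _).
  by rewrite setTI; congr measurable; rewrite predeqE => w; rewrite /= in_itv.
pose good Qk := forall w, box Qk w -> c < f w.
have -> : [set w | c < f w] = \bigcup_(Qk in [set Qk | good Qk]) box Qk.
  rewrite predeqE => w; split=> [/= fw|[Qk /= gQ /gQ //]].
  have [e e0 he] := hf w fw.
  have e2 : 0 < e / 2 by rewrite divr_gt0.
  pose k := Num.truncn (e / 2)^-1.
  have k0 : 0 < k.+1%:R^-1 :> R by rewrite invr_gt0 ltr0n.
  have ke : k.+1%:R^-1 < e / 2.
    rewrite -[ltRHS]invrK ltf_pV2 ?posrE ?invr_gt0 ?ltr0n //; exact: truncnS_gt.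
  have hq (ij : 'I_n * 'I_p) : exists q : rat, `|Y w ij.1 ij.2 - ratr q| < k.+1%:R^-1.
    have lt : Y w ij.1 ij.2 - k.+1%:R^-1 < Y w ij.1 ij.2 + k.+1%:R^-1.
      by rewrite ltrD2l gtrN.
    have [q] := rat_in_itvoo lt; rewrite in_itv /= => /andP[q1 q2]; exists q.
    by rewrite ltr_distlC q1 q2.
  have [q hq'] := choice hq.
  exists (\matrix_(i, j) q (i, j), k); last by move=> i j /=; rewrite mxE; exact: hq' (i, j).
  move=> w' hw'; apply: he => i j; rewrite (splitr e).
  have := hw' i j; have := hq' (i, j); rewrite /= mxE => h1 h2.
  rewrite -(subrK (ratr (q (i, j))) (Y w i j)) -addrA.
  apply: le_lt_trans (ler_normD _ _) _; apply: ltrD; first exact: lt_trans h1 ke.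
  by rewrite distrC; exact: lt_trans h2 ke.
rewrite bigcup_mkcond; apply: countable_bigcupT_measurable => [|Qk].
  exact: countableP.
by case: ifP.
Qed.

(** The loss of the estimator is an event of the probability space because the
   estimator is a Lipschitz function of the mean of the data. *)
Lemma measurable_loss n p N lam (y : T -> 'I_N -> R) (X : T -> 'I_N -> 'M[R]_(n, p))
    (Mh : T -> 'M[R]_(n, p)) (M : 'M[R]_(n, p)) c :
  (0 < n)%N -> (0 < p)%N -> 0 <= lam ->
  measurable_mx (fun w => mean_data (y w) (X w)) ->
  (forall w, is_estimator lam (y w) (X w) (Mh w)) ->
  measurable [set w | c < loss (Mh w) M].
Proof.
move=> n0 p0 lam0 mY est; apply: (measurable_semicontinuous mY) => w cw.
have np0 : 0 < (n * p)%:R :> R by rewrite ltr0n muln_gt0 n0.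
pose a := ip (Mh w - M) (Mh w - M); have a0 : 0 <= a by apply: ip_ge0.
pose g := a - (n * p)%:R * c.
have g0 : 0 < g.
  move: cw; rewrite /loss frobenius_sqr -/a mulrC ltr_pdivlMr // => cw.
  by rewrite /g subr_gt0 mulrC.
pose kap : R := 4 * (n * p)%:R ^+ 3.
have kap0 : 0 < kap by rewrite mulr_gt0 // exprn_gt0.
pose h := kap * (a + 1) + 1.
have h1 : 1 <= h by rewrite lerDr mulr_ge0 ?(ltW kap0) // addr_ge0.
have h0 : 0 < h by apply: lt_le_trans h1.
exists (g / (2 * h)); first by rewrite divr_gt0 // mulr_gt0.
move=> w' close; set e := g / (2 * h) in close.
pose D := mean_data (y w) (X w) - mean_data (y w') (X w').
have D2 : ip D D <= (n * p)%:R * e ^+ 2.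
  rewrite ipE; apply: (@le_trans _ _ (\sum_(i < n) \sum_(j < p) e ^+ 2)).
    apply: ler_sum => i _; apply: ler_sum => j _; rewrite -expr2.
    have Dij : `|D i j| <= e.
      have -> : D i j = mean_data (y w) (X w) i j - mean_data (y w') (X w') i j.
        by rewrite /D !mxE.
      exact/ltW/close.
    have e0 : 0 <= e by apply: le_trans Dij.
    by rewrite -[leLHS]real_normK ?num_real // lerXn2r ?nnegrE.
  by rewrite !sumr_const !card_ord -mulrnA mulr_natl mulnC.
have := estimator_lipschitz n0 p0 lam0 (est w) (est w'); rewrite -/D.
set t := ip (Mh w - Mh w') _ => lip.
have t0 : 0 <= t by apply: ip_ge0.
have tk : t <= kap * e ^+ 2.
  have np2 : 0 < (n * p)%:R ^+ 2 :> R by rewrite exprn_gt0.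
  move: lip; rewrite exprVn mulrC ler_pdivrMr // => /le_trans; apply.
  have -> : kap * e ^+ 2 = 4 * ((n * p)%:R * e ^+ 2) * (n * p)%:R ^+ 2.
    by rewrite /kap; ring.
  by rewrite ler_wpM2r ?(ltW np2) // ler_wpM2l.
pose x := ip (Mh w - Mh w') (Mh w - M).
have x2 : x ^+ 2 <= t * a by apply: ip_cauchy_schwarz.
have xg : x < g / 2.
  rewrite ltNge; apply/negP => gx.
  have gta : (g / 2) ^+ 2 <= t * a.
    have g20 : 0 <= g / 2 by rewrite divr_ge0 // ltW.
    by apply: le_trans x2; rewrite lerXn2r ?nnegrE // (le_trans g20).
  have ta : t * a <= kap * e ^+ 2 * (a + 1).
    by apply: ler_pM => //; rewrite lerDl.
  have := le_trans gta ta; rewrite leNgt => /negP; apply.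
  have -> : kap * e ^+ 2 * (a + 1) = (kap * (a + 1)) / h * ((g / 2) ^+ 2 / h).
    by rewrite /e; field; rewrite gt_eqF.
  have gg : 0 < (g / 2) ^+ 2 by rewrite exprn_gt0 // divr_gt0.
  apply: (@lt_le_trans _ _ (1 * ((g / 2) ^+ 2 / h))).
    by rewrite ltr_pM2r ?divr_gt0 // ltr_pdivrMr // mul1r ltrDl.
  by rewrite mul1r ler_pdivrMr // ler_peMr // ltW.
have bE : ip (Mh w' - M) (Mh w' - M) = a - 2 * x + t.
  rewrite /x /t /a !ip_lin (ipC M (Mh w)) (ipC M (Mh w')) (ipC (Mh w') (Mh w)).
  ring.
rewrite /loss frobenius_sqr bE mulrC ltr_pdivlMr //.
rewrite /g in xg *; lra.
Qed.

End Measurability.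

(** * Rate of convergence *)

Section Deterministic.
Context {R : realType}.
Variables (n p N L K : nat).
Hypotheses (n0 : (0 < n)%N) (p0 : (0 < p)%N) (N0 : (0 < N)%N).
Hypothesis K0 : (0 < K)%N.
Local Notation r := (base_rate n p N : R).
Local Notation rt := (rate L K n p N : R).

Lemma loss_le (A M : 'M[R]_(n, p)) b : (forall i j, `|A i j - M i j| <= b) ->
  loss A M <= b ^+ 2.
Proof.
move=> h; have b0 : 0 <= b by apply: le_trans (h (Ordinal n0) (Ordinal p0)).
have np0 : 0 < (n * p)%:R :> R by rewrite ltr0n muln_gt0 n0.
rewrite /loss frobenius_sqr ler_pdivrMl // ipE.
apply: (@le_trans _ _ (\sum_(i < n) \sum_(j < p) b ^+ 2)).
  apply: ler_sum => i _; apply: ler_sum => j _; rewrite -expr2.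
  have -> : (A - M) i j = A i j - M i j by rewrite !mxE.
  by rewrite -[leLHS]real_normK ?num_real // lerXn2r ?nnegrE.
by rewrite !sumr_const !card_ord -mulrnA -[leLHS]mulr_natl mulnC.
Qed.

Lemma tuning_sqr C2 : (n * p)%:R * tuning C2 n p N ^+ 2 = C2 ^+ 2 * r.
Proof.
have m0 : (minn n p)%:R != 0 :> R by rewrite pnatr_eq0 -lt0n leq_min n0.
have N1 : N%:R != 0 :> R by rewrite pnatr_eq0 -lt0n.
have l0 : 0 <= ln (n + p)%:R :> R.
  by rewrite ln_ge0 // ler1n addn_gt0 n0.
rewrite /tuning exprMn sqr_sqrtr; last by rewrite divr_ge0 // mulr_ge0.
have -> : (n * p)%:R = (minn n p)%:R * (maxn n p)%:R :> R.
  by rewrite -natrM; congr _%:R; case: leqP => // _; rewrite mulnC.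
by rewrite /base_rate; field; rewrite N1 m0.
Qed.

(** If [r < 1], the oracle inequality is applied to an approximation with cells
   of side about [r ^ (1 / (2 * L + K))], which balances error and rank. If
   [1 <= r], the zero matrix is good enough. *)
Lemma loss_le_rate (C2 a gamma : R) (M Mh : 'M[R]_(n, p)) y (X : 'I_N -> 'M[R]_(n, p)) :
  0 < tuning C2 n p N -> 0 <= gamma ->
  smooth_matrix L gamma K M -> (forall i j, `|M i j| <= a) ->
  is_estimator (tuning C2 n p N) y X Mh ->
  opbd (mean_data y X - (n * p)%:R^-1 *: M) (tuning C2 n p N / 2) ->
  loss Mh M <= (3 * a ^+ 2 + 3 * (gamma * (taylor_error K L)%:R) ^+ 2 +
    18 * (C2 ^+ 2 * ((2 ^ K)%:R * (taylor_rank K L)%:R)) + 1) * rt.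
Proof.
move=> lam0 g0 smooth Ma est hop.
have r0 : 0 < r := base_rate_gt0 n0 p0 N0.
have oracle A := estimator_oracle A n0 p0 lam0 est hop.
set E := gamma * _; set D := (2 ^ K)%:R * _.
have D0 : 0 <= D by rewrite mulr_ge0.
have a2 : 0 <= 3 * a ^+ 2 by rewrite mulr_ge0 ?sqr_ge0.
have E2 : 0 <= 3 * E ^+ 2 by rewrite mulr_ge0 ?sqr_ge0.
have CD0 : 0 <= 18 * (C2 ^+ 2 * D) by rewrite mulr_ge0 // mulr_ge0 ?sqr_ge0.
have k0 : (2 * L + K)%:R != 0 :> R by rewrite pnatr_eq0 addn_eq0 negb_and -!lt0n K0 orbT.
have [r1|r1] := leP 1 r.
  have rt1 : 1 <= rt.
    by rewrite /rate -[leLHS](powRr0 r) ler_powR // divr_ge0.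
  apply: (@le_trans _ _ (3 * a ^+ 2)).
    have := oracle 0; rewrite mxrank0 mulr0 mulr0 addr0 => /le_trans; apply.
    rewrite ler_wpM2l //; apply: loss_le => i j.
    by rewrite mxE sub0r normrN.
  rewrite -[leLHS]mulr1; apply: ler_pM => //; lra.
pose e1 := r `^ ((2 * L + K)%:R^-1).
have e0 : 0 < e1 by rewrite powR_gt0.
have er : e1 ^+ (2 * L + K) = r.
  by rewrite -powR_mulrn ?ltW // -powRrM mulVf // powRr1 // ltW.
have ert : rt = e1 ^+ (2 * L).
  by rewrite -powR_mulrn ?(ltW e0) // -powRrM /rate mulrC.
have e11 : e1 <= 1.
  have -> : 1 = 1 `^ ((2 * L + K)%:R^-1) :> R by rewrite powR1.
  by rewrite ge0_ler_powR ?nnegrE ?invr_ge0 // ltW.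
pose q := Num.truncn e1^-1.
have ei : 1 <= e1^-1 by rewrite invf_ge1.
have q1 : q.+1%:R^-1 <= e1.
  by rewrite -[leRHS]invrK lef_pV2 ?posrE ?invr_gt0 ?ltr0n // ltW // truncnS_gt.
have q2 : q.+1%:R <= 2 * e1^-1.
  have : q%:R <= e1^-1 by rewrite truncn_le invr_ge0 ltW.
  by rewrite -(natr1 q) mulr_natl mulr2n => ?; apply: lerD.
have [A [rA hA]] := smooth_matrix_low_rank q g0 smooth.
have lossA : loss A M <= (E * e1 ^+ L) ^+ 2.
  apply: loss_le => i j; rewrite distrC; apply: le_trans (hA i j) _.
  rewrite -/E ler_wpM2l ?mulr_ge0 // lerXn2r ?nnegrE ?invr_ge0 ?(ltW e0) //.
have rankA : r * (\rank A)%:R <= D * rt.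
  apply: (@le_trans _ _ (r * ((2 * e1^-1) ^+ K * (taylor_rank K L)%:R))).
    rewrite ler_wpM2l ?(ltW r0) //; apply: le_trans (_ : (q.+1 ^ K * taylor_rank K L)%:R <= _).
      by rewrite ler_nat.
    by rewrite natrM natrX ler_wpM2r // lerXn2r ?nnegrE ?mulr_ge0 ?invr_ge0 ?(ltW e0).
  rewrite -{1}er ert exprD exprMn exprVn /D natrX le_eqVlt; apply/orP; left; apply/eqP.
  by field; rewrite expf_neq0 // gt_eqF.
apply: le_trans (oracle A) _.
have -> : (n * p)%:R * tuning C2 n p N ^+ 2 * (\rank A)%:R = C2 ^+ 2 * (r * (\rank A)%:R).
  by rewrite tuning_sqr mulrA.
have lossA' : loss A M <= E ^+ 2 * rt.
  by apply: le_trans lossA _; rewrite ert exprMn mulnC exprM.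
have rt0 : 0 <= rt by rewrite powR_ge0.
have rankA' : C2 ^+ 2 * (r * (\rank A)%:R) <= C2 ^+ 2 * D * rt.
  by rewrite -mulrA ler_wpM2l ?sqr_ge0.
have a2rt := mulr_ge0 a2 rt0.
rewrite [leRHS](_ : _ = 3 * a ^+ 2 * rt + 3 * (E ^+ 2 * rt) + 18 * (C2 ^+ 2 * D * rt) + rt);
  last by ring.
clear -lossA' rankA' a2rt rt0.
move: (C2 ^+ 2 * (r * _)) (3 * a ^+ 2 * rt) (E ^+ 2 * rt) (C2 ^+ 2 * D * rt) (loss A M)
  rt lossA' rankA' a2rt rt0 => u v w z l t; lra.
Qed.

End Deterministic.

(** * Probability of a large loss *)

Section SampleMean.
Context (R : realType) d (T : measurableType d) (P : probability T R).
Variables (n p N : nat) (M : 'M[R]_(n, p)) (sigma : R).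
Variables (X : 'I_N -> T -> 'M[R]_(n, p)) (xi : 'I_N -> {RV P >-> R}).
Variable y : 'I_N -> T -> R.
Hypothesis sample : completion_sample M sigma X xi y.

(** The positions take finitely many values and the noise is measurable. *)
Lemma measurable_mean_data : measurable_mx (fun w => mean_data (y ^~ w) (X ^~ w)).
Proof.
have [pos posE] := exists_position sample.
have mphi t (phi : 'I_n * 'I_p -> R) : measurable_fun setT (fun w => phi (pos t w)).
  move=> _ B mB; rewrite setTI.
  have [+ _] := finite_valued P [set i | `[< B (phi i) >]]%SET (measurable_pos sample posE t).
  by congr measurable; rewrite predeqE => w /=; rewrite inE asboolE.
move=> i j; under eq_fun do rewrite mxE summxE.
apply: measurable_funM => //; apply: measurable_sum => t.
under eq_fun do rewrite mxE.
apply: measurable_funM; last first.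
  under eq_fun do rewrite posE.
  exact: (mphi t (fun l => (delta_mx l.1 l.2 : 'M[R]_(n, p)) i j)).
have yE : y t = fun w => inner (delta_mx (pos t w).1 (pos t w).2) M + xi t w.
  by case: sample => _ _ _ _ yE; apply/funext => w; rewrite yE posE.
rewrite yE.
apply: measurable_funD; last exact: measurable_funPT.
exact: (mphi t (fun l => inner (delta_mx l.1 l.2) M)).
Qed.

End SampleMean.

Lemma noise_constant_gt0 (R : realType) (sigma a : R) : 0 < sigma -> 0 < noise_constant sigma a.
Proof.
move=> s0; rewrite /noise_constant mulr_gt0 ?mulr_gt0 ?expR_gt0 // sqrtr_gt0.
rewrite mulr_gt0 //; first by rewrite ltr_wpDl // mulr_ge0 ?expR_ge0.
by rewrite ltr_wpDl ?sqr_ge0 // mulr_gt0 // exprn_gt0.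
Qed.

Lemma tuning_gt0 (R : realType) (C2 : R) n p N : 0 < C2 ->
  (0 < n)%N -> (0 < p)%N -> (0 < N)%N -> 0 < tuning C2 n p N.
Proof.
move=> C20 n0 p0 N0; rewrite mulr_gt0 // sqrtr_gt0 divr_gt0 //.
  by rewrite ln_gt0 // ltr1n (leq_add n0 p0).
by rewrite mulr_gt0 // ltr0n // leq_min n0.
Qed.

Lemma entry_le_norm (R : realType) n p (M : 'M[R]_(n, p)) i j : `|M i j| <= `|M|.
Proof.
rewrite -[leRHS]/(mx_norm M) mx_normrE.
exact: (le_bigmax _ (fun ij : 'I_n * 'I_p => `|M ij.1 ij.2|) (i, j)).
Qed.

(** From this dimension on, the logarithm is at least 2 and the failure
   probability [10 / (n + p)] is at most [eta]. *)
Definition large_dimension (R : realType) (eta : R) : nat :=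
  maxn (Num.truncn (expR 2 : R)).+1 (Num.truncn (10 / eta)).+1.

Lemma large_dimension_ln (R : realType) (eta : R) D :
  (large_dimension eta <= D)%N -> 2 <= ln D%:R :> R.
Proof.
rewrite geq_max => /andP[h _].
have h' : expR 2 <= D%:R :> R.
  by apply: le_trans (ltW (truncnS_gt _)) _; rewrite ler_nat.
by rewrite -[leLHS]expRK ler_ln // posrE ?expR_gt0 // (lt_le_trans (expR_gt0 2)).
Qed.

Lemma large_dimension_inv (R : realType) (eta : R) D : 0 < eta ->
  (large_dimension eta <= D)%N -> 10 * D%:R^-1 <= eta.
Proof.
rewrite geq_max => e0 /andP[_ h].
have D0 : 0 < D%:R :> R by rewrite ltr0n; apply: leq_trans h.
rewrite ler_pdivrMr // mulrC -ler_pdivrMr //.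
by apply: le_trans (ltW (truncnS_gt _)) _; rewrite ler_nat.
Qed.

Theorem theorem2 (R : realType) :
  (* with J* replaced by its order, the bound is minimized, up to a factor
     depending only on L and K, at eps_opt, where its two terms are equal *)
  (forall L K : nat, (0 < L)%N -> (0 < K)%N ->
    exists kappa : R, 0 < kappa /\
      forall n p N : nat, (0 < n)%N -> (0 < p)%N -> (0 < N)%N ->
        let r : R := base_rate n p N in
        let e : R := eps_opt L K n p N in
        let q := fun eps : R => r * eps `^ (- (K%:R / L%:R)) + eps ^+ 2 in
        [/\ 0 < e,
            r * e `^ (- (K%:R / L%:R)) = e ^+ 2 &
            forall eps : R, 0 < eps -> q e <= kappa * q eps])
  /\
  (* a is the value of the entrywise maximum norm of M *)
  forall sigma a : R, 0 < sigma -> 0 <= a ->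
  exists C2 : R, 0 < C2 /\
  forall (L K : nat) (gamma : R), (0 < L)%N -> (0 < K)%N -> 0 < gamma ->
    (* the bound itself, for every J of order eps^(-K/L) as eps -> 0 *)
    (forall c1 c2 eps0 : R, 0 < c1 -> 0 < c2 -> 0 < eps0 ->
      exists kappa : R, 0 < kappa /\
        forall J : R -> \bar R,
          (forall eps : R, 0 < eps -> (0 <= J eps)%E) ->
          (forall eps : R, 0 < eps < eps0 ->
             ((c1 * eps `^ (- (K%:R / L%:R)))%:E <= J eps
              <= (c2 * eps `^ (- (K%:R / L%:R)))%:E)%E) ->
          forall n p N : nat, (0 < n)%N -> (0 < p)%N -> (0 < N)%N ->
            eps_opt L K n p N < eps0 ->
            forall eps : R, 0 < eps ->
              (upper_bound C2 J n p N (eps_opt L K n p N)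
               <= kappa%:E * upper_bound C2 J n p N eps)%E)
    /\
    forall eta : R, 0 < eta ->
    exists (C : R) (m0 : nat), 0 < C /\
    forall n p N : nat, (0 < n)%N -> (0 < p)%N -> (0 < N)%N ->
      (m0 <= n + p)%N ->
      (minn n p)%:R * ln (n + p)%:R ^+ 2 <= N%:R :> R ->
    forall (d : measure_display) (T : measurableType d) (P : probability T R)
      (M : 'M[R]_(n, p)) (X : 'I_N -> T -> 'M[R]_(n, p))
      (xi : 'I_N -> {RV P >-> R}) (y : 'I_N -> T -> R)
      (Mhat : T -> 'M[R]_(n, p)),
      smooth_matrix L gamma K M ->
      `|M| = a ->
      completion_sample M sigma X xi y ->
      (forall w, is_estimator (tuning C2 n p N) (y ^~ w) (X ^~ w) (Mhat w)) ->
      (forall C0 eps : R, 0 < C0 -> 0 < eps ->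
         (P [set w | upper_bound C2 (Jstar L gamma K C0) n p N eps
                     < (loss (Mhat w) M)%:E] <= eta%:E)%E)
      /\
      (P [set w | (C * rate L K n p N < loss (Mhat w) M)%R] <= eta%:E)%E.
Proof.
split.
  move=> L K L0 K0; exists 2; split=> // n p N n0 p0 N0; split.
  - exact: eps_opt_gt0.
  - exact: eps_opt_balance.
  - by move=> eps; exact: eps_opt_optimal.
move=> sigma a s0 a0; exists (noise_constant sigma a).
have C20 := noise_constant_gt0 a s0; split=> // L K gamma L0 K0 g0; split.
  move=> c1 c2 eps0 c10 c20 _.
  pose c := noise_constant sigma a ^+ 2 * ((1 + Num.sqrt 2) / 2) ^+ 2.
  have c0 : 0 < c.
    by rewrite mulr_gt0 ?exprn_gt0 // divr_gt0 // ltr_wpDr ?sqrtr_ge0.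
  exists ((c * c2 + 1) * (1 + (c * c1)^-1)); split.
    apply: mulr_gt0; apply: addr_gt0; rewrite ?invr_gt0 //; exact: mulr_gt0.
  move=> J J0 hJ n p N n0 p0 N0 ee eps e0.
  exact: (upper_bound_optimal L0 K0 n0 p0 N0 C20 c10 c20 J0 hJ ee e0).
move=> eta eta0.
exists (3 * a ^+ 2 + 3 * (gamma * (taylor_error K L)%:R) ^+ 2 +
    18 * (noise_constant sigma a ^+ 2 * ((2 ^ K)%:R * (taylor_rank K L)%:R)) + 1).
exists (large_dimension eta); split.
  have sq (x : R) : 0 <= 3 * x ^+ 2 by rewrite mulr_ge0 ?sqr_ge0.
  have D0 : 0 <= 18 * (noise_constant sigma a ^+ 2 * ((2 ^ K)%:R * (taylor_rank K L)%:R)).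
    by rewrite mulr_ge0 // mulr_ge0 ?sqr_ge0 // mulr_ge0.
  apply: ltr_wpDl => //; apply: addr_ge0 => //; exact: addr_ge0.
move=> n p N n0 p0 N0 D0 Nlarge d T P M X xi y Mhat smooth Ma sample est.
split=> [C0 eps C00 _|].
  rewrite [X in P X](_ : _ = set0) ?measure0 ?lee_fin ?(ltW eta0) //.
  rewrite predeqE => w; split=> //=.
  by rewrite (upper_bound_pinfty K eps L0 (ltW g0)) // ltNge leey.
have Mij i j : `|M i j| <= a by rewrite -Ma entry_le_norm.
have lam0 := tuning_gt0 C20 n0 p0 N0.
have [pos posE] := exists_position sample.
have ln2 := large_dimension_ln D0.
have [mF PF] := noise_failure_prob sample s0 posE Mij n0 p0 N0 ln2 Nlarge.
apply: le_trans (le_trans PF _); last by rewrite lee_fin large_dimension_inv.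
apply: le_measure; rewrite ?inE //.
  exact: (measurable_loss (Mh := Mhat) M _ n0 p0 (ltW lam0) (measurable_mean_data sample) est).
move=> w /= lossw; apply: contrapT => hw.
have := noise_operator_bound sample s0 posE n0 p0 N0 ln2 hw.
move=> /(loss_le_rate n0 p0 N0 K0 lam0 (ltW g0) smooth Mij (est w)).
by rewrite leNgt lossw.
Qed.
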